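(* Let $\gamma>0$, and consider the system with error signal $$\dot x = f(x,t)+g(x,t)\big(u(x,t)-h(x)\big),\qquad \dot e = f_e(e,t)+g_e(x,t)\big(u(x,t)-h(x)\big),$$ where $f,g,h,f_e,g_e$, the bounded desired trajectory $x_d$, the Lyapunov function $Q$, the reproducing kernel Hilbert space $\mathcal H\ni h$ with kernel $\mathsf K$, and the feature map $\Phi$ satisfy the dynamics regularity, error regularity, Lyapunov stability, kernel, and second moment assumptions listed in the context. Then the adaptive control input $$u(x,t)=-\gamma\int_0^t \mathsf K(x,x(\tau))\,g_e(x(\tau),\tau)^{\mathsf T}\,\nabla Q(e(\tau),\tau)\,d\tau$$ ensures that both $x(t)$ and $e(t)$ exist and are uniformly bounded for all $t\ge 0$. Moreover, $u(\cdot,t)\in\mathcal H$ for all $t\ge0$ and $\lim_{t\to\infty}\|x(t)-x_d(t)\|_2=0$.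
   Context: Regularity notions. For normed spaces $E_1,E_2$, a function $F(x,t)$ from $E_1\times\mathbb R_{\ge0}$ to $E_2$ is locally Lipschitz in $x$ if for all finite $T,R>0$, $\sup_{t\in[0,T]}\sup_{\|x\|,\|y\|\le R,\,x\ne y}\|F(x,t)-F(y,t)\|/\|x-y\|<\infty$. It is locally bounded in $x$ uniformly in $t$ if for all finite $R>0$, $\sup_{t\ge0}\sup_{\|x\|\le R}\|F(x,t)\|<\infty$. Dimensions. $f:\mathbb R^n\times\mathbb R_{\ge0}\to\mathbb R^n$, $g:\mathbb R^n\times\mathbb R_{\ge0}\to\mathbb R^{n\times d}$, $h:\mathbb R^n\to\mathbb R^d$, $f_e:\mathbb R^s\times\mathbb R_{\ge0}\to\mathbb R^s$, $g_e:\mathbb R^n\times\mathbb R_{\ge0}\to\mathbb R^{s\times d}$; $x(t)\in\mathbb R^n$ is the state, $e(t)\in\mathbb R^s$ the observed error signal (with its given initial value), $x_d(t)\in\mathbb R^n$ a bounded desired trajectory. $\|\cdot\|_{\mathrm{op}}$ is the $\ell_2\to\ell_2$ operator norm. Dynamics regularity. $f,g,h$ are locally Lipschitz in $x$ and locally bounded in $x$ uniformly in $t$. Error regularity. $f_e,g_e$ are locally Lipschitz in their first argument and locally bounded in their first argument uniformly in $t$; and (i) $f_e(0,t)=0$ for all $t\ge0$; (ii) for all $T>0$, $\sup_{t\in[0,T]}\|e(t)\|_2<\infty$ implies $\sup_{t\in[0,T]}\|x(t)-x_d(t)\|_2<\infty$; (iii) $\lim_{t\to\infty}\|e(t)\|_2=0$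 implies $\lim_{t\to\infty}\|x(t)-x_d(t)\|_2=0$. Lyapunov stability. There is a continuously differentiable $Q:\mathbb R^s\times\mathbb R_{\ge0}\to\mathbb R$ and class-$\mathcal K_\infty$ functions $\rho,\mu_1,\mu_2$ such that for all $e\in\mathbb R^s$, $t\ge0$: $\nabla Q(e,t)$ (gradient in $e$) and $\frac{\partial Q}{\partial t}(e,t)$ are locally bounded in $e$ uniformly in $t$; $\nabla Q$ is locally Lipschitz in $e$; $\langle\nabla Q(e,t),f_e(e,t)\rangle+\frac{\partial Q}{\partial t}(e,t)\le-\rho(\|e\|_2)$; and $\mu_1(\|e\|_2)\le Q(e,t)\le\mu_2(\|e\|_2)$. Kernel assumption. $h$ lies in an RKHS $\mathcal H$ of functions $\mathbb R^n\to\mathbb R^d$ with operator-valued reproducing kernel $\mathsf K:\mathbb R^n\times\mathbb R^n\to\mathbb R^{d\times d}$, meaning: $\sum_{i,j}\langle w_i,\mathsf K(x_i,x_j)w_j\rangle\ge0$ for all finite families $x_i\in\mathbb R^n$, $w_i\in\mathbb R^d$; $\mathsf K(\cdot,x)w\in\mathcal H$ for all $x,w$; and $\mathcal H$ is the closure of the set of finite sums $\sum_i\mathsf K(\cdot,x_i)w_i$. Moreover $\mathsf K(x,y)=\int_\Theta\Phi(x,\theta)\Phi(y,\theta)^{\mathsf T}d\nu(\theta)$ for a feature map $\Phi:\mathbb R^n\times\Theta\to\mathbb R^{d\times d_1}$, $d_1\le d$, and a probability measure $\nu$ on a measurable space $\Theta$. Second moment assumption. For every $x\in\mathbb R^n$,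 $\int_\Theta\|\Phi(x,\theta)\|_{\mathrm{op}}^2d\nu(\theta)<\infty$, and for every $R>0$, $\sup_{\|x\|_2,\|y\|_2\le R,\,x\ne y}\big(\int_\Theta\|\Phi(x,\theta)-\Phi(y,\theta)\|_{\mathrm{op}}^2d\nu(\theta)\big)^{1/2}/\|x-y\|_2<\infty$.
   Formalization: Error condition (ii) is taken over half-open intervals [0,T) with T = ∞ allowed (for finite closed intervals only, x may be unbounded); solutions are Carathéodory solutions, and measurability in t of f, g, f_e, g_e and of Φ in θ is assumed. *)

(* Defs.v *)
From HB Require Import structures.
From mathcomp Require Import all_boot all_order all_algebra.
From mathcomp Require Import all_classical all_reals all_analysis.

Set Implicit Arguments.
Unset Strict Implicit.
Unset Printing Implicit Defensive.

Import Order.TTheory GRing.Theory Num.Theory.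
Import numFieldNormedType.Exports.

Local Open Scope classical_set_scope.
Local Open Scope ring_scope.

(* The library norm on matrices is the maximum norm; the l2 norm and its
   operator norm are defined here. *)
Definition dot (R : realType) (k : nat) (x y : 'cV[R]_k) : R :=
  \sum_(i < k) x i ord0 * y i ord0.

Definition l2norm (R : realType) (k : nat) (x : 'cV[R]_k) : R :=
  Num.sqrt (dot x x).

Definition opnorm (R : realType) (k l : nat) (A : 'M[R]_(k, l)) : R :=
  sup [set l2norm (A *m v) | v in [set v | l2norm v <= 1]].

Section Regularity.
Context {R : realType} {E1 E2 : zmodType}.
Variables (N1 : E1 -> R) (N2 : E2 -> R).

Definition locally_lipschitz (F : E1 -> R -> E2) : Prop :=
  forall T r : R, 0 < T -> 0 < r ->
  exists L : R, forall (t : R) (x y : E1), 0 <= t <= T ->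
    N1 x <= r -> N1 y <= r -> x != y ->
    N2 (F x t - F y t) / N1 (x - y) <= L.

Definition locally_bounded (F : E1 -> R -> E2) : Prop :=
  forall r : R, 0 < r ->
  exists M : R, forall (t : R) (x : E1), 0 <= t -> N1 x <= r -> N2 (F x t) <= M.

End Regularity.

Section MatrixIntegral.
Context {R : realType} {d : measure_display} {T : measurableType d}.

Definition mx_measurable (k l : nat) (D : set T) (F : T -> 'M[R]_(k, l)) : Prop :=
  forall i j, measurable_fun D (fun s => F s i j).

Definition mx_integrable (k l : nat) (mu : {measure set T -> \bar R}) (D : set T)
    (F : T -> 'M[R]_(k, l)) : Prop :=
  forall i j, mu.-integrable D (fun s => (F s i j)%:E).

Definition mx_integral (k l : nat) (mu : {measure set T -> \bar R}) (D : set T)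
    (F : T -> 'M[R]_(k, l)) : 'M[R]_(k, l) :=
  \matrix_(i, j) (\int[mu]_(s in D) F s i j).

End MatrixIntegral.

Definition class_Kinf (R : realType) (r : R -> R) : Prop :=
  [/\ r 0 = 0,
      {within [set a : R | 0 <= a], continuous r},
      (forall a b : R, 0 <= a -> a < b -> r a < r b) &
      r a @[a --> +oo] --> +oo].

(* Continuous differentiability on the closed half-space R^s x [0, +oo): the
   derivative is taken relative to that set, hence one-sided in t at t = 0. *)
Definition C1_with_derivatives (R : realType) (s : nat) (Q : 'cV[R]_s -> R -> R)
    (gradQ : 'cV[R]_s -> R -> 'cV[R]_s) (dtQ : 'cV[R]_s -> R -> R) : Prop :=
  let D := [set p : 'cV[R]_s * R | 0 <= p.2] in
  [/\ (forall (e : 'cV[R]_s) (t : R), 0 <= t -> forall eps : R, 0 < eps ->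
         \forall p \near within D (nbhs (e, t)),
           `|Q p.1 p.2 - Q e t - (dot (gradQ e t) (p.1 - e) + dtQ e t * (p.2 - t))|
             <= eps * (l2norm (p.1 - e) + `|p.2 - t|)),
      {within D, continuous (fun p => gradQ p.1 p.2)} &
      {within D, continuous (fun p => dtQ p.1 p.2)}].

Record lyapunov_stability (R : realType) (s : nat)
    (fe : 'cV[R]_s -> R -> 'cV[R]_s) (Q : 'cV[R]_s -> R -> R)
    (gradQ : 'cV[R]_s -> R -> 'cV[R]_s) (dtQ : 'cV[R]_s -> R -> R)
    (rho mu1 mu2 : R -> R) : Prop := LyapunovStability {
  lyap_C1 : C1_with_derivatives Q gradQ dtQ ;
  lyap_rho : class_Kinf rho ;
  lyap_mu1 : class_Kinf mu1 ;
  lyap_mu2 : class_Kinf mu2 ;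
  lyap_gradQ_bounded : locally_bounded (@l2norm R s) (@l2norm R s) gradQ ;
  lyap_dtQ_bounded : locally_bounded (@l2norm R s) Num.norm dtQ ;
  lyap_gradQ_lipschitz : locally_lipschitz (@l2norm R s) (@l2norm R s) gradQ ;
  lyap_decrease : forall (e : 'cV[R]_s) (t : R), 0 <= t ->
    dot (gradQ e t) (fe e t) + dtQ e t <= - rho (l2norm e) ;
  lyap_bounds : forall (e : 'cV[R]_s) (t : R), 0 <= t ->
    mu1 (l2norm e) <= Q e t <= mu2 (l2norm e) }.

Record inner_product (R : realType) (H : completeNormedModType R)
    (ip : H -> H -> R) : Prop := InnerProduct {
  ip_sym : forall v w, ip v w = ip w v ;
  ip_linear : forall (a : R) (v v' w : H), ip (a *: v + v') w = a * ip v w + ip v' w ;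
  ip_norm : forall v, ip v v = `|v| ^+ 2 }.

(* A Hilbert space of functions R^n -> R^d is a Hilbert space H together with an
   injective linear map ev sending v : H to the function it denotes. *)
Record is_rkhs (R : realType) (n d : nat) (H : completeNormedModType R)
    (ip : H -> H -> R) (ev : {linear H -> ('cV[R]_n -> 'cV[R]_d)})
    (K : 'cV[R]_n -> 'cV[R]_n -> 'M[R]_d) : Prop := IsRKHS {
  rkhs_ip : inner_product ip ;
  rkhs_inj : injective ev ;
  rkhs_psd : forall (m : nat) (x : 'I_m -> 'cV[R]_n) (w : 'I_m -> 'cV[R]_d),
    0 <= \sum_(i < m) \sum_(j < m) dot (w i) (K (x i) (x j) *m w j) ;
  rkhs_section : forall (x : 'cV[R]_n) (w : 'cV[R]_d),
    range ev (fun z => K z x *m w) ;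
  rkhs_reproducing : forall (x : 'cV[R]_n) (w : 'cV[R]_d) (k v : H),
    ev k = (fun z => K z x *m w) -> ip v k = dot (ev v x) w ;
  rkhs_dense : closure [set v : H |
    exists (m : nat) (x : 'I_m -> 'cV[R]_n) (w : 'I_m -> 'cV[R]_d),
      ev v = (fun z => \sum_(i < m) K z (x i) *m w i)] = setT }.

Record feature_representation (R : realType) (n d d1 : nat)
    (dT : measure_display) (Theta : measurableType dT) (nu : probability Theta R)
    (Phi : 'cV[R]_n -> Theta -> 'M[R]_(d, d1))
    (K : 'cV[R]_n -> 'cV[R]_n -> 'M[R]_d) : Prop := FeatureRepresentation {
  feature_measurable : forall x, mx_measurable setT (Phi x) ;
  feature_integrable : forall x y,
    mx_integrable nu setT (fun th => Phi x th *m (Phi y th)^T) ;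
  feature_kernel : forall x y,
    K x y = mx_integral nu setT (fun th => Phi x th *m (Phi y th)^T) }.

Record second_moment (R : realType) (n d d1 : nat)
    (dT : measure_display) (Theta : measurableType dT) (nu : probability Theta R)
    (Phi : 'cV[R]_n -> Theta -> 'M[R]_(d, d1)) : Prop := SecondMoment {
  moment_finite : forall x,
    (\int[nu]_th (opnorm (Phi x th) ^+ 2)%:E < +oo)%E ;
  moment_lipschitz : forall r : R, 0 < r ->
    exists L : R, forall x y : 'cV[R]_n, l2norm x <= r -> l2norm y <= r ->
      x != y ->
      ((\int[nu]_th (opnorm (Phi x th - Phi y th) ^+ 2)%:E) `^ 2^-1
         <= (L * l2norm (x - y))%:E)%E }.

Section System.
Context {R : realType} {n d s : nat}.
Variables (f : 'cV[R]_n -> R -> 'cV[R]_n) (g : 'cV[R]_n -> R -> 'M[R]_(n, d))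
  (h : 'cV[R]_n -> 'cV[R]_d)
  (fe : 'cV[R]_s -> R -> 'cV[R]_s) (ge : 'cV[R]_n -> R -> 'M[R]_(s, d)).

Definition time_interval (T : \bar R) : set R := [set t | 0 <= t /\ (t%:E < T)%E].

Record dynamics_regularity : Prop := DynamicsRegularity {
  dyn_f_lip : locally_lipschitz (@l2norm R n) (@l2norm R n) f ;
  dyn_g_lip : locally_lipschitz (@l2norm R n) (@opnorm R n d) g ;
  dyn_h_lip : locally_lipschitz (@l2norm R n) (@l2norm R d) (fun x _ => h x) ;
  dyn_f_bnd : locally_bounded (@l2norm R n) (@l2norm R n) f ;
  dyn_g_bnd : locally_bounded (@l2norm R n) (@opnorm R n d) g ;
  dyn_h_bnd : locally_bounded (@l2norm R n) (@l2norm R d) (fun x _ => h x) }.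

(* Regularity in x does not constrain the dependence on t; measurability in t
   is what gives meaning to the time integrals of the right-hand sides. *)
Definition measurable_in_time : Prop :=
  [/\ forall x, mx_measurable (time_interval +oo) (f x),
      forall x, mx_measurable (time_interval +oo) (g x),
      forall e, mx_measurable (time_interval +oo) (fe e) &
      forall x, mx_measurable (time_interval +oo) (ge x)].

(* (x, e) solves, on [0, T) and in the sense of Caratheodory, the system driven
   by the input u:
     x' = f(x,t) + g(x,t) (u(x,t) - h(x)),  e' = f_e(e,t) + g_e(x,t) (u(x,t) - h(x))
   with x(0) = x0 and e(0) = e0. *)
Definition solution (u : 'cV[R]_n -> R -> 'cV[R]_d) (x0 : 'cV[R]_n) (e0 : 'cV[R]_s)
    (T : \bar R) (x : R -> 'cV[R]_n) (e : R -> 'cV[R]_s) : Prop :=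
  let Fx t := f (x t) t + g (x t) t *m (u (x t) t - h (x t)) in
  let Fe t := fe (e t) t + ge (x t) t *m (u (x t) t - h (x t)) in
  forall t, time_interval T t ->
    [/\ mx_integrable (@lebesgue_measure R) `[0, t] Fx,
        mx_integrable (@lebesgue_measure R) `[0, t] Fe,
        x t = x0 + mx_integral (@lebesgue_measure R) `[0, t] Fx &
        e t = e0 + mx_integral (@lebesgue_measure R) `[0, t] Fe].

Section ClosedLoop.
Variables (gamma : R) (K : 'cV[R]_n -> 'cV[R]_n -> 'M[R]_d)
  (gradQ : 'cV[R]_s -> R -> 'cV[R]_s).

Definition control_integrand (x : R -> 'cV[R]_n) (e : R -> 'cV[R]_s)
    (z : 'cV[R]_n) (tau : R) : 'cV[R]_d :=
  K z (x tau) *m (ge (x tau) tau)^T *m gradQ (e tau) tau.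

Definition adaptive_control (x : R -> 'cV[R]_n) (e : R -> 'cV[R]_s)
    (z : 'cV[R]_n) (t : R) : 'cV[R]_d :=
  - gamma *: mx_integral (@lebesgue_measure R) `[0, t] (control_integrand x e z).

Definition closed_loop_solution (x0 : 'cV[R]_n) (e0 : 'cV[R]_s) (T : \bar R)
    (x : R -> 'cV[R]_n) (e : R -> 'cV[R]_s) : Prop :=
  (forall z t, time_interval T t ->
     mx_integrable (@lebesgue_measure R) `[0, t] (control_integrand x e z)) /\
  solution (adaptive_control x e) x0 e0 T x e.

End ClosedLoop.

End System.

Definition bounded_signal (R : realType) (k : nat) (D : set R) (y : R -> 'cV[R]_k) :
    Prop := exists M : R, forall t, D t -> l2norm (y t) <= M.

(* S T x e stands for: (x, e) is a trajectory defined on [0, T), T <= +oo.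
   In err_bounded the supremum is over [0, T), with T = +oo allowed. *)
Record error_regularity (R : realType) (n d s : nat)
    (fe : 'cV[R]_s -> R -> 'cV[R]_s) (ge : 'cV[R]_n -> R -> 'M[R]_(s, d))
    (xd : R -> 'cV[R]_n)
    (S : \bar R -> (R -> 'cV[R]_n) -> (R -> 'cV[R]_s) -> Prop) : Prop :=
  ErrorRegularity {
  err_fe_lip : locally_lipschitz (@l2norm R s) (@l2norm R s) fe ;
  err_ge_lip : locally_lipschitz (@l2norm R n) (@opnorm R s d) ge ;
  err_fe_bnd : locally_bounded (@l2norm R s) (@l2norm R s) fe ;
  err_ge_bnd : locally_bounded (@l2norm R n) (@opnorm R s d) ge ;
  err_fe0 : forall t : R, 0 <= t -> fe 0 t = 0 ;
  err_bounded : forall (T : \bar R) x e, (0 < T)%E -> S T x e ->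
    bounded_signal (time_interval T) e ->
    bounded_signal (time_interval T) (fun t => x t - xd t) ;
  err_limit : forall x e, S +oo%E x e ->
    l2norm (e t) @[t --> +oo] --> 0 ->
    l2norm (x t - xd t) @[t --> +oo] --> 0 }.

(* Main.v *)
(* The closed loop is a Volterra equation: the velocity at time t depends on the
   trajectory on [0, t], in a way that is measurable in t and Lipschitz on
   bounded sets.  Clipping the state to a ball and iterating Picard's map in a
   norm weighted by exp(-2 C t) gives global solutions of clipped equations, which
   glue to a solution of the original one that is either global or unbounded on a
   bounded time interval.

   The input u(., t) lies in H because z |-> int_0^t <z(x(tau)), w(tau)> dtau, with
   w = g_e^T grad Q, is a bounded linear form on H.  By the reproducing property
   the derivative of |u(., t) - h|^2 / (2 gamma) is - <u(x, t) - h(x), w>, which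
   cancels the indefinite term in the derivative of Q(e(t), t), so that
   V = Q + |u - h|^2 / (2 gamma) satisfies V(t) = V(0) + int_0^t q with
   q <= - rho(|e|): the solutions are only Caratheodory, but V - int q has
   derivative zero at every point, not just almost everywhere.  Hence e is bounded,
   then x is, which excludes blow-up; and V decreases by a fixed amount during
   each excursion of the Lipschitz function e away from 0, so that e tends to 0. *)

Require Import Defs.
From mathcomp Require Import all_boot all_order all_algebra.
From mathcomp Require Import all_classical all_reals all_analysis.
From mathcomp Require Import measurable_realfun ring lra.
Import Order.TTheory GRing.Theory Num.Theory.
Import numFieldNormedType.Exports.
Local Open Scope classical_set_scope.
Local Open Scope ring_scope.
Set Implicit Arguments.
Unset Strict Implicit.
Unset Printing Implicit Defensive.

(** * Indefinite integrals on [0, b] *)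

(** Trajectories are differentiable almost everywhere at best, because the velocity is only
    measurable in [t]. Two choices avoid Lebesgue differentiation. All equations are kept in
    integral form. In the energy identity each integrand pairs a factor that is bounded and
    measurable with one that is continuous along the trajectory. The unknown of the fixed-point
    problem is the finite-dimensional pair (x, e), the input being a functional of its past. No
    integral with values in H is formed: the element of H is obtained separately at each time by
    representing a linear form, and its Lipschitz dependence on time follows by testing that form on
    increments. The estimates apply to an arbitrary solution on any [0, T). They thus serve twice:
    to exclude blow-up of the constructed solution, and to describe every global one. *)

Definition continuous_on (R : realType) (V : normedModType R) (b : R)
    (y : R -> V) : Prop :=
  forall t, 0 <= t <= b -> forall eps, 0 < eps -> exists2 dlt, 0 < dlt &
  forall s, 0 <= s <= b -> `|s - t| < dlt -> `|y s - y t| < eps.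

Section RealAnalysis.
Context {R : realType}.
Implicit Types (b t C : R) (p : R -> R).
Notation mu := (@lebesgue_measure R).

Lemma lipschitz_continuous_on (V : normedModType R) b C (y : R -> V) :
  (forall s t, 0 <= s <= b -> 0 <= t <= b -> `|y s - y t| <= C * `|s - t|) ->
  continuous_on b y.
Proof.
move=> yC t tb eps e0; have C1 : 0 < `|C| + 1 by rewrite ltr_wpDl.
exists (eps / (`|C| + 1)); first exact: divr_gt0.
move=> s sb; rewrite ltr_pdivlMr// => st.
apply: (le_lt_trans (yC s t sb tb)); apply: le_lt_trans st.
rewrite mulrC ler_wpM2l// (le_trans (ler_norm C))// lerDl//.
Qed.

Lemma continuous_on_within b p : continuous_on b p -> {within `[0, b], continuous p}.
Proof.
move=> pc; apply/subspace_continuousP => t; rewrite /= in_itv/= => tb.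
apply/cvgrPdist_lt => eps e0; have [dlt d0 h] := pc t tb eps e0.
near=> s; rewrite distrC; apply: h.
- have : (`[0, b]%classic : set R) s by near: s; exact: withinT.
  by rewrite /= in_itv.
- near: s; apply: cvg_within; exists dlt => //= s; rewrite /ball/= distrC.
  by [].
Unshelve. all: by end_near. Qed.

Lemma continuous_on_measurable b p : continuous_on b p -> measurable_fun `[0, b] p.
Proof.
by move=> pc; apply: subspace_continuous_measurable_fun => //; exact: continuous_on_within.
Qed.

Lemma within_continuous_on b p : {within `[0, b], continuous p} -> continuous_on b p.
Proof.
move=> /subspace_continuousP pc t tb eps e0.
have /cvgrPdist_lt/(_ _ e0) : p s @[s --> within `[0, b] (nbhs t)] --> p t.
  by apply: pc; rewrite /= in_itv.
move=> [dlt d0 h]; exists dlt => // s sb st; rewrite distrC; apply: h => /=.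
  by rewrite /ball/= distrC.
by rewrite in_itv.
Qed.

Lemma bounded_itv_integrable b p C : measurable_fun `[0, b] p ->
  (forall t, 0 <= t <= b -> `|p t| <= C) -> mu.-integrable `[0, b] (EFin \o p).
Proof.
move=> mp pC; apply: measurable_bounded_integrable => //.
  by rewrite /= lebesgue_measure_itv/=; case: ifP => // _; rewrite ltry.
exists C; split; first exact: num_real.
by move=> M CM t /=; rewrite in_itv/= => /pC/le_trans; apply; exact: ltW.
Qed.

Lemma integrable_sub b c p : c <= b ->
  mu.-integrable `[0, b] (EFin \o p) -> mu.-integrable `[0, c] (EFin \o p).
Proof.
move=> cb; apply: integrableS => // t /=; rewrite !in_itv/= => /andP[-> /le_trans ->//].
Qed.

Lemma indefinite_le b C p s t : mu.-integrable `[0, b] (EFin \o p) ->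
  0 <= s -> s <= t -> t <= b -> (forall u, s <= u <= t -> p u <= C) ->
  \int[mu]_(u in `[0, t]) p u - \int[mu]_(u in `[0, s]) p u <= C * (t - s).
Proof.
move=> ip s0 st tb pC; have ipt := integrable_sub tb ip.
rewrite (@Rintegral_itvB _ p (BLeft 0) (BRight t) s)//.
apply: (@le_trans _ _ (\int[mu]_(x in `]s, t]) C)); last first.
  rewrite Rintegral_cst//= lebesgue_measure_itv/= lte_fin.
  by move: st; rewrite le_eqVlt => /predU1P[->|->//]; rewrite ltxx subrr.
apply: le_Rintegral => //.
- apply: integrableS ipt => // u; rewrite /= !in_itv/= => /andP[su ->].
  by rewrite andbT (le_trans s0)// ltW.
- apply: measurable_bounded_integrable => //.
    by rewrite /= lebesgue_measure_itv/=; case: ifP => // _; rewrite ltry.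
  exists `|C|; split; first exact: num_real.
  by move=> M CM u /= _; exact: ltW.
- by move=> u; rewrite /= in_itv/= => /andP[su ut]; apply: pC; rewrite ut ltW.
Qed.

Lemma RintegralN b p : mu.-integrable `[0, b] (EFin \o p) ->
  \int[mu]_(u in `[0, b]) (- p u) = - \int[mu]_(u in `[0, b]) p u.
Proof.
move=> ip; under eq_Rintegral do rewrite -mulN1r.
by rewrite RintegralZl// mulN1r.
Qed.

Lemma integrableNR b p : mu.-integrable `[0, b] (EFin \o p) ->
  mu.-integrable `[0, b] (EFin \o (fun u => - p u)).
Proof. by move=> ip; apply: eq_integrable (integrableN ip). Qed.

(** Only the values of [p] between [s] and [t] are bounded, so that [C] can be small when [p] is
    small near [t]. The minimum and maximum spare callers from ordering the two times. *)
Lemma indefinite_lipschitz b C p s t : mu.-integrable `[0, b] (EFin \o p) ->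
  0 <= s <= b -> 0 <= t <= b ->
  (forall u, Num.min s t <= u <= Num.max s t -> `|p u| <= C) ->
  `|\int[mu]_(u in `[0, t]) p u - \int[mu]_(u in `[0, s]) p u| <= C * `|t - s|.
Proof.
move=> ip; wlog st : s t / s <= t.
  move=> hw; have /orP[/hw//|/hw h] := le_total s t.
  by move=> sb tb; rewrite minC maxC distrC (distrC t); exact: h.
rewrite (min_idPl st) (max_idPr st) => /andP[s0 sb] /andP[t0 tb] pC.
rewrite (@ger0_norm _ (t - s)) ?subr_ge0// ler_norml; apply/andP; split.
  have := @indefinite_le b C (fun u => - p u) s t (integrableNR ip) s0 st tb.
  rewrite !RintegralN; [|exact: integrable_sub ip|exact: integrable_sub ip].
  move=> h; suff : forall u, s <= u <= t -> - p u <= C by move=> /h; lra.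
  by move=> u /pC; apply: le_trans; rewrite -normrN ler_norm.
apply: indefinite_le ip _ _ _ _ => // u /pC; apply: le_trans; exact: ler_norm.
Qed.

Lemma indefinite0 p : \int[mu]_(u in `[0, 0]) p u = 0.
Proof. by rewrite set_itv1 Rintegral_set1. Qed.

Lemma indefinite_bound b C p t : mu.-integrable `[0, b] (EFin \o p) ->
  0 <= t <= b -> (forall u, 0 <= u <= t -> `|p u| <= C) ->
  `|\int[mu]_(u in `[0, t]) p u| <= C * t.
Proof.
move=> ip tb pC; have t0 : 0 <= t by case/andP: tb.
have := @indefinite_lipschitz b C p 0 t ip _ tb.
rewrite indefinite0 !subr0 (ger0_norm t0); apply.
  by rewrite lexx /=; case/andP: tb; exact: le_trans.
by rewrite (min_idPl t0) (max_idPr t0).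
Qed.

End RealAnalysis.

(** * Caratheodory functions *)

Section Caratheodory.
Context {R : realType}.

(** The curve [y] is replaced by step functions, and continuity in the first argument carries
    measurability to the limit. *)
Lemma caratheodory_measurable (V : normedModType R) (b : R) (F : V -> R -> R)
    (y : R -> V) :
  (forall z, measurable_fun `[0, b] (F z)) ->
  (forall t, 0 <= t <= b -> {for y t, continuous (F^~ t)}) ->
  continuous_on b y -> measurable_fun `[0, b] (fun t => F (y t) t).
Proof.
move=> mF cF cy.
(* The largest multiple of 1 / (k + 1) not exceeding [t]; rounding down keeps it in [[0, b]], where
   [y] is continuous. *)
pose q (k : nat) (t : R) : R := (Num.truncn (k.+1%:R * t))%:R / k.+1%:R.
have k0 k : 0 < k.+1%:R :> R by [].
have qP k t : 0 <= t -> 0 <= q k t <= t /\ t - q k t < k.+1%:R^-1.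
  move=> t0; have := truncn_itv (mulr_ge0 (ltW (k0 k)) t0) => /andP[h1 h2].
  split; first by rewrite /q divr_ge0 ?ler0n//= ler_pdivrMr// (mulrC t).
  have : t < q k t + k.+1%:R^-1.
    by rewrite /q -[X in _ + X]mul1r -mulrDl natr1 ltr_pdivlMr// (mulrC t).
  by rewrite ltrBlDl.
apply: (@measurable_fun_cvg _ _ _ _ (fun k t => F (y (q k t)) t)).
(* On each cell of the grid [y (q k t)] is constant, so the approximant is [F z] for a fixed [z]. *)
- move=> k; pose E (i : nat) : set R :=
    `[0, b] `&` `[i%:R / k.+1%:R, i.+1%:R / k.+1%:R[.
  have -> : `[0, b]%classic = \bigcup_i E i.
    apply/seteqP; split => t /=; last by case=> i _ [].
    rewrite in_itv/= => tb; exists (Num.truncn (k.+1%:R * t)) => //.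
    split; rewrite /= in_itv//= ler_pdivrMr// ltr_pdivlMr//.
    have /andP[t0 _] := tb.
    by have := truncn_itv (mulr_ge0 (ltW (k0 k)) t0); rewrite mulrC.
  apply/measurable_fun_bigcup => i; first exact: measurableI.
  apply: (@eq_measurable_fun _ _ _ _ _ (F (y (i%:R / k.+1%:R)))).
    move=> t /set_mem[/=]; rewrite !in_itv/= => tb.
    rewrite ler_pdivrMr// ltr_pdivlMr// (mulrC t) => h.
    by rewrite /q (truncn_def h).
  by apply: measurable_funS (mF _) => // t [].
- move=> t; rewrite /= in_itv/= => tb; have /andP[t0 tb'] := tb.
  apply: (@cvg_comp _ _ _ (fun k => y (q k t)) (F^~ t) _ (nbhs (y t))); last exact: cF.
  apply/cvgrPdist_lt => eps e0; have [dlt d0 h] := cy t tb eps e0.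
  near=> k; rewrite distrC; have [/andP[q0 qt] tq] := qP k t t0.
  apply: h; first by rewrite q0 (le_trans qt).
  rewrite distrC ger0_norm ?subr_ge0//; apply: lt_trans tq _.
  by near: k; exact: near_infty_natSinv_lt (PosNum d0).
Unshelve. all: by end_near. Qed.

Lemma indefinite_continuous (b : R) (p : R -> R) :
  (@lebesgue_measure R).-integrable `[0, b] (EFin \o p) ->
  continuous_on b (fun t => \int[@lebesgue_measure R]_(u in `[0, t]) p u).
Proof.
move=> ip t tb; have b0 : 0 <= b by case/andP: tb => /le_trans; exact.
exact: (within_continuous_on (parameterized_integral_continuous b0 ip)).
Qed.

(** For fixed [eps], let [c] be the supremum of the times up to which |p s - p 0| <= eps * s. The
    bound holds at [c] and can be continued past it unless [c = b]. *)
Lemma zero_derivative_const (b : R) (p : R -> R) : 0 <= b ->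
  (forall t, 0 <= t <= b -> forall eps, 0 < eps -> exists2 dlt, 0 < dlt &
    forall s, 0 <= s <= b -> `|s - t| < dlt ->
      `|p s - p t| <= eps * `|s - t|) ->
  p b = p 0.
Proof.
move=> b0 dp; apply/eqP; rewrite -subr_eq0 -normr_le0; apply/ler_addgt0Pr => eta eta0.
rewrite add0r.
(* Dividing by [b + 1] covers [b = 0] and still gives [eps * b <= eta]. *)
pose eps := eta / (b + 1); have b1 : 0 < b + 1 by rewrite ltr_wpDl.
have eps0 : 0 < eps by exact: divr_gt0.
suff h : `|p b - p 0| <= eps * b.
  apply: (le_trans h); rewrite /eps -mulrA ger_pMr// mulrC ler_pdivrMr// mul1r.
  by rewrite lerDl.
pose A := [set t | 0 <= t <= b /\ forall s, 0 <= s <= t -> `|p s - p 0| <= eps * s].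
have A0 : A 0.
  split; first by rewrite lexx.
  by move=> s /le_anti <-; rewrite subrr normr0 mulr0.
have bA : ubound A b by move=> t [/andP[]].
have hsA : has_sup A by split; [exists 0 | exists b].
set c := sup A.
have c0 : 0 <= c by apply: ub_le_sup => //; exists b.
have cb : c <= b by apply: ge_sup => //; exists 0.
have cA s : 0 <= s -> s < c -> `|p s - p 0| <= eps * s.
  move=> s0 sc; have [t [_ At] st] : exists2 t, A t & s < t.
    have := sup_gt (ex_intro _ _ A0) sc; case => t At; exists t => //.
  by apply: At; rewrite s0 ltW.
have [dlt d0 hd] := dp c (introT andP (conj c0 cb)) eps eps0.
(* The bound passes to [c] by comparison with a point [s] less than [dlt] to its left. *)
have Ac : `|p c - p 0| <= eps * c.
  have [<-|c_gt0] := eqVneq 0 c; first by rewrite subrr normr0 mulr0.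
  have {}c_gt0 : 0 < c by rewrite lt_def c0 eq_sym c_gt0.
  pose s := Num.max 0 (c - dlt / 2).
  have s0 : 0 <= s by rewrite le_max lexx.
  have sc : s < c by rewrite gt_max c_gt0 gtrBl divr_gt0.
  have scd : c - s < dlt.
    have : c - dlt / 2 <= s by rewrite le_max lexx orbT.
    lra.
  have h2 : `|p s - p c| <= eps * (c - s).
    have := hd s; rewrite s0 (le_trans (ltW sc) cb) (distrC s) => /(_ isT).
    by rewrite ger0_norm ?subr_ge0 ?(ltW sc)// => /(_ scd).
  have h1 := cA s s0 sc; have h3 := ler_distD (p s) (p c) (p 0).
  rewrite (distrC (p c) (p s)) in h3; lra.
have [cb'|] := ltP c b; last first.
  by move=> bc; have -> : b = c by apply/le_anti; rewrite bc cb.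
(* If [c < b], the derivative condition at [c] extends the bound up to this [t > c], against the
   choice of [c]. *)
pose t := Num.min b (c + dlt / 2).
have tb : t <= b by rewrite ge_min lexx.
have ct : c < t by rewrite lt_min cb' ltrDl divr_gt0.
have td : t <= c + dlt / 2 by rewrite ge_min lexx orbT.
suff : A t by move=> /(ub_le_sup (ex_intro _ b bA)); rewrite leNgt ct.
split; first by rewrite tb (le_trans c0 (ltW ct)).
move=> s /andP[s0 st]; have [sc|cs] := ltP s c; first exact: cA.
have := hd s; rewrite s0 (le_trans st tb) ger0_norm ?subr_ge0// => /(_ isT).
have -> : s - c < dlt by lra.
move=> /(_ isT) h1; have h3 := ler_distD (p c) (p s) (p 0); lra.
Qed.

(** Measured against exp(lam t), integration gains a factor 1 / lam. This is what makes Picard's map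
    a contraction on intervals of any length. *)
Lemma integral_expR_le (b lam C : R) (p : R -> R) :
  (@lebesgue_measure R).-integrable `[0, b] (EFin \o p) -> 0 < lam -> 0 <= C ->
  (forall t, 0 <= t <= b -> `|p t| <= C * expR (lam * t)) ->
  forall t, 0 <= t <= b ->
    `|\int[@lebesgue_measure R]_(u in `[0, t]) p u| <= C / lam * expR (lam * t).
Proof.
move=> ip lam0 C0 pC t tb; have /andP[t0 tb'] := tb.
move: t0; rewrite le_eqVlt => /predU1P[<-|t0].
  by rewrite indefinite0 normr0 mulr_ge0 ?expR_ge0// divr_ge0// ltW.
have ipt := integrable_sub tb' ip.
pose F (u : R) : R := C / lam * expR (lam * u).
have dF (u : R) : is_derive u (1 : R) F (C * expR (lam * u)).
  apply: is_derive_eq.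
  by rewrite /GRing.scale/= mulr1 (mulrC (expR _)) mulrA divfK ?lt0r_neq0.
have cE : continuous (fun u : R => C * expR (lam * u)).
  move=> u; apply: cvgM; first exact: cvg_cst.
  apply: continuous_comp; last exact: continuous_expR.
  exact: mulrl_continuous.
have cF : continuous F.
  by move=> u; apply: differentiable_continuous; apply/derivable1_diffP; have [] := dF u.
have iE : (@lebesgue_measure R).-integrable `[0, t] (EFin \o (fun u : R => C * expR (lam * u))).
  apply: continuous_compact_integrable; first exact: segment_compact.
  exact: continuous_subspaceT.
apply: (le_trans (le_normr_Rintegral _ ipt)) => //.
apply: (@le_trans _ _ (\int[@lebesgue_measure R]_(u in `[0, t]) (C * expR (lam * u)))).
  apply: le_Rintegral => //; first exact: integrable_norm ipt.
  by move=> u /=; rewrite in_itv/= => /andP[u0 ut]; apply: pC; rewrite u0 (le_trans ut).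
have := @continuous_FTC2 R (fun u => C * expR (lam * u)) F 0 t t0.
rewrite /Rintegral => ->//=.
- by rewrite /F lerBlDr lerDl mulr_ge0 ?expR_ge0// divr_ge0// ltW.
- exact: continuous_subspaceT.
- split.
  + by move=> u _; have [] := dF u.
  + exact/cvg_at_right_filter/cF.
  + exact/cvg_at_left_filter/cF.
- by move=> u _; rewrite derive1E; have [] := dF u.
Qed.

End Caratheodory.

Lemma Rintegral_sum (d : measure_display) (T : measurableType d) (R : realType)
    (mu : {measure set T -> \bar R}) (D : set T) (I : Type) (s : seq I) (p : I -> T -> R) :
  measurable D -> (forall i, mu.-integrable D (EFin \o p i)) ->
  mu.-integrable D (EFin \o (fun x => \sum_(i <- s) p i x)) /\
  \int[mu]_(x in D) (\sum_(i <- s) p i x) = \sum_(i <- s) \int[mu]_(x in D) p i x.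
Proof.
move=> mD ip; elim: s => [|i s [IH1 IH2]].
  under [X in EFin \o X]eq_fun do rewrite big_nil.
  under eq_Rintegral do rewrite big_nil.
  rewrite big_nil Rintegral_cst// mul0r; split=> //.
  exact: integrable0.
under [X in EFin \o X]eq_fun do rewrite big_cons.
under eq_Rintegral do rewrite big_cons.
rewrite big_cons RintegralD// IH2; split=> //.
exact: eq_integrable (integrableD _ (ip i) IH1).
Qed.

(** * The maximum norm and clipping *)

Section MaxNorm.
Context {R : realType}.

(** The condition [0 <= C] takes care of matrices without entries. *)
Lemma mx_norm_leP (m k : nat) (A : 'M[R]_(m, k)) (C : R) :
  `|A| <= C <-> 0 <= C /\ forall i j, `|A i j| <= C.
Proof.
rewrite [`|A|]mx_normrE; split=> [AC|[C0 AC]].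
  split=> [|i j]; first by apply: le_trans AC; exact: bigmax_ge_id.
  by apply: le_trans AC; exact: (@le_bigmax _ _ _ 0 (fun ij => `|A ij.1 ij.2|) (i, j)).
by apply: bigmax_le => // -[i j] _; exact: AC.
Qed.

Lemma mx_entry_le (m k : nat) (A : 'M[R]_(m, k)) i j : `|A i j| <= `|A|.
Proof. by have [_] := (mx_norm_leP A _).1 (lexx _); exact. Qed.

Lemma cV_norm_le (k : nat) (v : 'cV[R]_k) (C : R) : 0 <= C ->
  (forall i, `|v i ord0| <= C) -> `|v| <= C.
Proof. by move=> C0 vC; apply/mx_norm_leP; split=> // i j; rewrite ord1. Qed.

(** Clamping coordinatewise is a retraction onto the ball of the maximum norm, 1-Lipschitz for that
    same norm. *)
Definition clip (r : R) (k : nat) (v : 'cV[R]_k) : 'cV[R]_k :=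
  map_mx (fun a => Num.max (- r) (Num.min r a)) v.

Lemma clip_le r k (v : 'cV[R]_k) : 0 <= r -> `|clip r v| <= r.
Proof.
move=> r0; apply: cV_norm_le => // i; rewrite mxE ler_norml le_max lexx /=.
by rewrite ge_max ge_min lexx andbT (le_trans _ r0)// oppr_le0.
Qed.

Lemma clip_lipschitz r k (v w : 'cV[R]_k) : `|clip r v - clip r w| <= `|v - w|.
Proof.
apply: cV_norm_le => // i; apply: le_trans (mx_entry_le (v - w) i ord0).
rewrite !mxE; move: (v i ord0) (w i ord0) => a c.
have h (x y : R) : `|Num.min r x - Num.min r y| <= `|x - y|.
  have := ler_norm (x - y); have := ler_norm (y - x); rewrite distrC ler_norml.
  by rewrite /Num.min; case: (ltP r x); case: (ltP r y) => *; apply/andP; split; lra.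
apply: le_trans (h a c); move: (Num.min r a) (Num.min r c) => {h} {}a {}c.
have := ler_norm (a - c); have := ler_norm (c - a); rewrite distrC ler_norml.
by rewrite /Num.max; case: (ltP (- r) a); case: (ltP (- r) c) => *; apply/andP; split; lra.
Qed.

Lemma clip_id r k (v : 'cV[R]_k) : `|v| <= r -> clip r v = v.
Proof.
move=> vr; apply/matrixP => i j; rewrite mxE.
have := le_trans (mx_entry_le v i j) vr; rewrite ler_norml => /andP[h1 h2].
by rewrite (min_idPr h2) (max_idPr h1).
Qed.

Lemma le_geometric_limit (x a B : R) : (forall k, x <= a + B / 2 ^+ k) -> x <= a.
Proof.
move=> h; have cv : a + B / 2 ^+ k @[k --> \oo] --> a.
  rewrite -[X in _ --> X]addr0; apply: cvgD; first exact: cvg_cst.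
  rewrite -[X in _ --> X](mulr0 B); apply: cvgM; first exact: cvg_cst.
  under eq_fun do rewrite -exprVn.
  by apply: cvg_expr; rewrite ger0_norm ?invr_ge0// invf_lt1// ltr1n.
by rewrite -(cvg_lim _ cv)//; apply: limr_ge; [apply/cvg_ex; exists a|exact: nearW].
Qed.

(** The intervals with centre [u k] and radius [2 * A / 2 ^+ k] are nested, so the supremum of their
    left ends lies in all of them. This gives the limit and the rate together. *)
Lemma geometric_limit (u : nat -> R) (A : R) : 0 <= A ->
  (forall k, `|u k.+1 - u k| <= A / 2 ^+ k) ->
  forall k, `|limn u - u k| <= 2 * A / 2 ^+ k.
Proof.
move=> A0 uA.
have e2 k : 2 * A / 2 ^+ k = A / 2 ^+ k + 2 * A / 2 ^+ k.+1.
  by rewrite exprS; field; rewrite expf_neq0// pnatr_eq0.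
have e0 k : 0 <= 2 * A / 2 ^+ k by rewrite divr_ge0 ?mulr_ge0 ?exprn_ge0.
have up m k : (m <= k)%N -> u m - 2 * A / 2 ^+ m <= u k - 2 * A / 2 ^+ k.
  move=> /subnK <-; elim: (k - m)%N => [//|j]; rewrite addSn => /le_trans; apply.
  have := uA (j + m)%N; rewrite ler_norml => /andP[]; have := e2 (j + m)%N; lra.
have dn m k : (m <= k)%N -> u k + 2 * A / 2 ^+ k <= u m + 2 * A / 2 ^+ m.
  move=> /subnK <-; elim: (k - m)%N => [//|j]; rewrite addSn; apply: le_trans.
  have := uA (j + m)%N; rewrite ler_norml => /andP[]; have := e2 (j + m)%N; lra.
have ud m k : u m - 2 * A / 2 ^+ m <= u k + 2 * A / 2 ^+ k.
  have := e0 m; have := e0 k.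
  have [/up|/ltnW/dn] := leqP m k; lra.
pose S := range (fun k => u k - 2 * A / 2 ^+ k).
have hS : has_sup S.
  split; first by exists (u 0%N - 2 * A / 2 ^+ 0), 0%N.
  by exists (u 0%N + 2 * A / 2 ^+ 0) => _ [k _ <-].
have h k : `|sup S - u k| <= 2 * A / 2 ^+ k.
  rewrite ler_norml lerBlDl lerBrDr; apply/andP; split.
    rewrite addrC; apply: ub_le_sup; [by case: hS | by exists k].
  by apply: ge_sup; [by case: hS | move=> _ [m _ <-]].
suff -> : limn u = sup S by [].
apply: cvg_lim => //; apply/cvgrPdist_le => eps eps0.
have cv : 2 * A / 2 ^+ k @[k --> \oo] --> (0 : R).
  rewrite -(mulr0 (2 * A)); apply: cvgM; first exact: cvg_cst.
  under eq_fun do rewrite -exprVn.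
  by apply: cvg_expr; rewrite ger0_norm ?invr_ge0// invf_lt1// ltr1n.
near=> k; apply: (le_trans (h k)); apply: le_trans (ler_norm _) _.
by near: k; move/cvgr0Pnorm_le : cv; apply.
Unshelve. all: by end_near. Qed.

End MaxNorm.

(** * Causal operators *)

Definition caratheodory (R : realType) (V : normedModType R) (b : R) (F : V -> R -> R) :=
  (forall z, measurable_fun `[0, b] (F z)) /\
  forall r, exists C : R, forall t z w, 0 <= t <= b -> `|z| <= r -> `|w| <= r ->
    `|F z t| <= C /\ `|F z t - F w t| <= C * `|z - w|.

Definition admissible (R : realType) (V : normedModType R) (r b : R) (y : R -> V) :=
  continuous_on b y /\ forall t, 0 <= t <= b -> `|y t| <= r.

(* In the third clause the values of y and z on [0, t] alone control the
   difference at time t, so that Phi is in particular causal. *)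
Definition causal_operator (R : realType) (V : normedModType R) (r b : R)
    (Phi : (R -> V) -> R -> R) :=
  exists C : R, [/\ 0 <= C,
    (forall y, admissible r b y -> measurable_fun `[0, b] (Phi y)),
    (forall y, admissible r b y -> forall t, 0 <= t <= b -> `|Phi y t| <= C) &
    (forall y z, admissible r b y -> admissible r b z -> forall t, 0 <= t <= b ->
       forall dlt, (forall u, 0 <= u <= t -> `|y u - z u| <= dlt) ->
       `|Phi y t - Phi z t| <= C * dlt)].

Section CausalOperators.
Context {R : realType} {V : normedModType R}.
Implicit Types (r b : R) (Phi Psi : (R -> V) -> R -> R).

Lemma caratheodory_bound b (F : V -> R -> R) : caratheodory b F ->
  forall r, exists2 C : R, 0 <= C & forall t z w, 0 <= t <= b -> `|z| <= r -> `|w| <= r ->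
    `|F z t| <= C /\ `|F z t - F w t| <= C * `|z - w|.
Proof.
move=> [_ cF] r; have [C hC] := cF r; exists `|C| => // t z w tb zr wr.
have [h1 h2] := hC t z w tb zr wr; split; first exact: le_trans h1 (ler_norm _).
by apply: le_trans h2 _; rewrite ler_wpM2r// ler_norm.
Qed.

Lemma caratheodory_continuous b (F : V -> R -> R) t : caratheodory b F ->
  0 <= t <= b -> continuous (F^~ t).
Proof.
move=> cF tb v; apply/cvgrPdist_le => eps e0.
(* The Lipschitz constant belongs to a ball, so [w] is kept within distance 1 of [v] before [eps] is
   used. *)
have [C C0 hC] := caratheodory_bound cF (`|v| + 1).
have C1 : 0 < C + 1 by rewrite ltr_wpDl.
near=> w.
have vw : `|v - w| <= Num.min 1 (eps / (C + 1)).
  by near: w; apply: cvgr_dist_le; rewrite // lt_min ltr01 divr_gt0.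
have wr : `|w| <= `|v| + 1.
  have := ler_distD v w 0; rewrite !subr0 => /le_trans; apply; rewrite addrC lerD2l.
  by rewrite distrC; apply: (le_trans vw); rewrite ge_min lexx.
have vr : `|v| <= `|v| + 1 by rewrite lerDl.
have [_ h] := hC t v w tb vr wr.
apply: (le_trans h); apply: (@le_trans _ _ ((C + 1) * (eps / (C + 1)))).
  apply: ler_pM => //; first by rewrite lerDl.
  by apply: (le_trans vw); rewrite ge_min lexx orbT.
by rewrite mulrC divfK// lt0r_neq0.
Unshelve. all: by end_near. Qed.

Lemma caratheodory_comp_measurable b (F : V -> R -> R) y :
  caratheodory b F -> continuous_on b y -> measurable_fun `[0, b] (fun t => F (y t) t).
Proof.
move=> cF cy; apply: caratheodory_measurable => //; first by case: cF.
by move=> t tb; apply: caratheodory_continuous cF tb _.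
Qed.

Lemma causal_caratheodory r b (F : V -> R -> R) :
  caratheodory b F -> causal_operator r b (fun y t => F (y t) t).
Proof.
move=> cF; have [C C0 hC] := caratheodory_bound cF r; exists C; split=> //.
- by move=> y [cy _]; exact: caratheodory_comp_measurable.
- by move=> y [_ yr] t tb; have [] := hC t (y t) (y t) tb (yr _ tb) (yr _ tb).
- move=> y z [_ yr] [_ zr] t tb dlt h.
  have [_ /le_trans] := hC t (y t) (z t) tb (yr _ tb) (zr _ tb); apply.
  by rewrite ler_wpM2l// h// lexx andbT; case/andP: tb.
Qed.

Lemma causal_ext r b Phi Psi :
  (forall y, admissible r b y -> forall t, 0 <= t <= b -> Phi y t = Psi y t) ->
  causal_operator r b Phi -> causal_operator r b Psi.
Proof.
move=> h [C [C0 mC bC lC]]; exists C; split=> //.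
- move=> y hy; apply: (@eq_measurable_fun _ _ _ _ _ (Phi y)) (mC y hy) => t /set_mem.
  by rewrite /= in_itv/= => tb; exact: h.
- by move=> y hy t tb; rewrite -h//; exact: bC.
- by move=> y z hy hz t tb dlt hd; rewrite -!h//; exact: lC.
Qed.

Lemma causal_integrable r b Phi y : causal_operator r b Phi -> admissible r b y ->
  (@lebesgue_measure R).-integrable `[0, b] (EFin \o Phi y).
Proof.
by move=> [C [_ mC bC _]] hy; apply: (@bounded_itv_integrable _ _ _ C); [exact: mC|exact: bC].
Qed.

Lemma causal_cst r b c : causal_operator r b (fun (_ : R -> V) (_ : R) => c).
Proof.
exists `|c|; split=> // y z _ _ t /andP[t0 _] dlt h; rewrite subrr normr0 mulr_ge0//.
by apply: le_trans (h 0 _); rewrite // lexx.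
Qed.

Lemma causal_add r b Phi Psi : causal_operator r b Phi -> causal_operator r b Psi ->
  causal_operator r b (fun y t => Phi y t + Psi y t).
Proof.
move=> [C [C0 mC bC lC]] [D [D0 mD bD lD]]; exists (C + D); split.
- exact: addr_ge0.
- by move=> y hy; apply: measurable_funD; [exact: mC|exact: mD].
- by move=> y hy t tb; rewrite (le_trans (ler_normD _ _))// lerD ?bC ?bD.
- move=> y z hy hz t tb dlt h; rewrite opprD addrACA (le_trans (ler_normD _ _))//.
  by rewrite mulrDl lerD// ?lC// lD.
Qed.

Lemma causal_mul r b Phi Psi : causal_operator r b Phi -> causal_operator r b Psi ->
  causal_operator r b (fun y t => Phi y t * Psi y t).
Proof.
move=> [C [C0 mC bC lC]] [D [D0 mD bD lD]]; exists (2 * (C * D)); split.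
- by rewrite !mulr_ge0.
- by move=> y hy; apply: measurable_funM; [exact: mC|exact: mD].
- move=> y hy t tb; rewrite normrM (le_trans (ler_pM _ _ (bC y hy t tb) (bD y hy t tb)))//.
  by rewrite mulr_natl mulr2n lerDl mulr_ge0.
- move=> y z hy hz t tb dlt h.
  have -> : Phi y t * Psi y t - Phi z t * Psi z t =
    Phi y t * (Psi y t - Psi z t) + (Phi y t - Phi z t) * Psi z t by ring.
  apply: (le_trans (ler_normD _ _)); rewrite !normrM.
  have -> : 2 * (C * D) * dlt = C * (D * dlt) + C * dlt * D by ring.
  by apply: lerD; apply: ler_pM => //; [exact: bC|exact: lD|exact: lC|exact: bD].
Qed.

Lemma causal_opp r b Phi : causal_operator r b Phi ->
  causal_operator r b (fun y t => - Phi y t).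
Proof.
move=> h; apply: causal_ext (causal_mul (causal_cst r b (-1)) h) => y _ t _.
by rewrite mulN1r.
Qed.

Lemma causal_sum r b (I : Type) (s : seq I) (Phi : I -> (R -> V) -> R -> R) :
  (forall i, causal_operator r b (Phi i)) ->
  causal_operator r b (fun y t => \sum_(i <- s) Phi i y t).
Proof.
move=> h; elim: s => [|i s IH].
  by apply: causal_ext (causal_cst r b 0) => y _ t _; rewrite big_nil.
by apply: causal_ext (causal_add (h i) IH) => y _ t _; rewrite big_cons.
Qed.

Definition locally_lipschitz2 (k : V -> V -> R) := forall r', exists C : R,
  forall v w v' w', `|v| <= r' -> `|w| <= r' -> `|v'| <= r' -> `|w'| <= r' ->
    `|k v w| <= C /\ `|k v w - k v' w'| <= C * (`|v - v'| + `|w - w'|).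

Lemma locally_lipschitz2_bound (k : V -> V -> R) : locally_lipschitz2 k ->
  forall r', exists2 C : R, 0 <= C & forall v w v' w', `|v| <= r' -> `|w| <= r' ->
     `|v'| <= r' -> `|w'| <= r' ->
     `|k v w| <= C /\ `|k v w - k v' w'| <= C * (`|v - v'| + `|w - w'|).
Proof.
move=> hk r'; have [C hC] := hk r'; exists `|C| => // v w v' w' h1 h2 h3 h4.
have [h5 h6] := hC v w v' w' h1 h2 h3 h4.
split; first exact: le_trans h5 (ler_norm _).
by apply: (le_trans h6); rewrite ler_wpM2r ?addr_ge0// ler_norm.
Qed.

Lemma kernel_product_measurable r b (k : V -> V -> R) Phi z y :
  locally_lipschitz2 k -> causal_operator r b Phi -> admissible r b y ->
  measurable_fun `[0, b] (fun u => k z (y u) * Phi y u).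
Proof.
move=> /locally_lipschitz2_bound hk [D [D0 mD bD lD]].
move=> hy; apply: measurable_funM; last exact: mD.
(* Large enough for [z] and for all points within 1 of the curve [y]. *)
pose r' := Num.max `|z| (r + 1); have [C' C'0 hC'] := hk r'.
have zr : `|z| <= r' by rewrite le_max lexx.
apply: (@caratheodory_measurable R V b (fun w _ => k z w)) => //; last by case: hy.
move=> t tb; apply/cvgrPdist_le => eps e0.
have C1 : 0 < C' + 1 by rewrite ltr_wpDl.
near=> w.
have vw : `|y t - w| <= Num.min 1 (eps / (C' + 1)).
  by near: w; apply: cvgr_dist_le; rewrite // lt_min ltr01 divr_gt0.
have yr : `|y t| <= r by case: hy => _; exact.
have wr : `|w| <= r'.
  have := ler_distD (y t) w 0; rewrite !subr0 => /le_trans; apply.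
  rewrite le_max; apply/orP; right; rewrite addrC; apply: (lerD yr).
  by rewrite distrC; apply: (le_trans vw); rewrite ge_min lexx.
have yr' : `|y t| <= r' by rewrite le_max; apply/orP; right; rewrite (le_trans yr)// lerDl.
have [_ h] := hC' z (y t) z w zr yr' zr wr.
apply: (le_trans h); rewrite subrr normr0 add0r.
apply: (@le_trans _ _ ((C' + 1) * (eps / (C' + 1)))).
  apply: ler_pM => //; first by rewrite lerDl.
  by apply: (le_trans vw); rewrite ge_min lexx orbT.
by rewrite mulrC divfK// lt0r_neq0.
Unshelve. all: by end_near. Qed.

Lemma kernel_product_integrable r b (k : V -> V -> R) Phi z y :
  locally_lipschitz2 k -> causal_operator r b Phi -> admissible r b y ->
  (@lebesgue_measure R).-integrable `[0, b] (EFin \o (fun u => k z (y u) * Phi y u)).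
Proof.
move=> /[dup] hk0 /locally_lipschitz2_bound hk /[dup] hPhi [D [D0 mD bD lD]].
move=> hy; pose r' := Num.max `|z| r; have [C' C'0 hC'] := hk r'.
have zr : `|z| <= r' by rewrite le_max lexx.
apply: (@bounded_itv_integrable _ _ _ (C' * D)); first exact: kernel_product_measurable hPhi hy.
move=> t tb; rewrite normrM; apply: ler_pM => //; last exact: bD.
have yr : `|y t| <= r' by rewrite le_max; case: hy => _ ->; rewrite ?orbT.
by have [] := hC' z (y t) z (y t) zr yr zr yr.
Qed.

(** The memory term of the input stays causal: its integrand sees only the past, where [k] and [Phi]
    are bounded and Lipschitz. *)
Lemma causal_integral r b (k : V -> V -> R) Phi :
  locally_lipschitz2 k -> causal_operator r b Phi ->
  causal_operator r b
    (fun y t => \int[@lebesgue_measure R]_(u in `[0, t]) (k (y t) (y u) * Phi y u)).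
Proof.
move=> /[dup] hk0 /locally_lipschitz2_bound hk /[dup] hPhi [D [D0 mD bD lD]].
have [C C0 hC] := hk r.
have ik z y hy := @kernel_product_integrable r b k Phi z y hk0 hPhi hy.
have [b0|b0] := ltP b 0.
  exists 0; split=> //.
  - by move=> y hy; rewrite set_itv_ge ?bnd_simp -?ltNge//; exact: measurable_fun_set0.
  - by move=> y hy t /andP[/le_trans h /h]; rewrite leNgt b0.
  - by move=> y z hy hz t /andP[/le_trans h /h]; rewrite leNgt b0.
(* A perturbation [dlt] changes the integrand by at most C D [dlt] through [Phi] and 2 C D [dlt]
   through the two arguments of [k]; the integral runs over a length of at most [b]. *)
exists (3 * (C * D) * b); split.
- by rewrite !mulr_ge0.
(* Time occurs twice, as upper limit and inside [y t]. With [y t] replaced by a fixed [z] the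
   integral is continuous in [t], and it is Lipschitz in [z] near [y t]; so its restriction to the
   curve is measurable. *)
- move=> y hy; apply: (@caratheodory_measurable R V b
    (fun z t => \int[@lebesgue_measure R]_(u in `[0, t]) (k z (y u) * Phi y u))).
  + by move=> z; apply: continuous_on_measurable; apply: indefinite_continuous; exact: ik.
  + move=> t tb; apply/cvgrPdist_le => eps e0.
    have [C' C'0 hC'] := hk (r + 1).
    have C1 : 0 < C' * D * b + 1 by rewrite ltr_wpDl// !mulr_ge0.
    near=> w.
    have vw : `|y t - w| <= Num.min 1 (eps / (C' * D * b + 1)).
      by near: w; apply: cvgr_dist_le; rewrite // lt_min ltr01 divr_gt0.
    have yr u : 0 <= u <= b -> `|y u| <= r + 1.
      by case: hy => _ h /h /le_trans; apply; rewrite lerDl.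
    have wr : `|w| <= r + 1.
      have := ler_distD (y t) w 0; rewrite !subr0 => /le_trans; apply.
      rewrite addrC; apply: lerD; first by case: hy => _; exact.
      by rewrite distrC; apply: (le_trans vw); rewrite ge_min lexx.
    have tb' : t <= b by case/andP: tb.
    rewrite -RintegralB//; [|exact: (integrable_sub tb' (ik _ _ hy))..].
    have := @indefinite_bound R b (C' * D * `|y t - w|)
      (fun u => k (y t) (y u) * Phi y u - k w (y u) * Phi y u) t _ tb _.
    move=> h; apply: (le_trans (h _ _)).
    * apply: eq_integrable (integrableB _ (ik (y t) _ hy) (ik w _ hy)) => //.
    * move=> u /andP[u0 ut]; have ub : 0 <= u <= b by rewrite u0 (le_trans ut).
      rewrite -mulrBl normrM mulrAC; apply: ler_pM => //; last exact: bD.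
      have [_] := hC' _ _ _ _ (yr _ tb) (yr _ ub) wr (yr _ ub).
      by rewrite subrr normr0 addr0.
    * rewrite mulrAC; apply: (@le_trans _ _ ((C' * D * b + 1) * (eps / (C' * D * b + 1)))).
        apply: ler_pM => //.
        - by rewrite !mulr_ge0//; case/andP: tb.
        - by rewrite ler_wpDr// ler_wpM2l// mulr_ge0.
        - by apply: (le_trans vw); rewrite ge_min lexx orbT.
      by rewrite mulrC divfK// lt0r_neq0.
  + by case: hy.
- move=> y hy t tb; have /andP[t0 tb'] := tb.
  apply: (le_trans (@indefinite_bound _ b (C * D) _ t (ik _ _ hy) tb _)).
    move=> u /andP[u0 ut]; have ub : 0 <= u <= b by rewrite u0 (le_trans ut).
    rewrite normrM; apply: ler_pM => //; last exact: bD.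
    case: hy => _ yr; have [] := hC _ _ _ _ (yr _ tb) (yr _ ub) (yr _ tb) (yr _ ub).
    by [].
  have CD0 : 0 <= C * D by rewrite mulr_ge0.
  have h1 : C * D * t <= C * D * b by rewrite ler_wpM2l.
  have h2 : 0 <= C * D * b by rewrite mulr_ge0.
  lra.
- move=> y z hy hz t tb dlt h; have /andP[t0 tb'] := tb.
  have d0 : 0 <= dlt by apply: le_trans (h 0 _); rewrite // lexx.
  rewrite -RintegralB//; [|exact: (integrable_sub tb' (ik _ _ _))..].
  apply: (le_trans (@indefinite_bound _ b (3 * (C * D) * dlt)
    (fun u => k (y t) (y u) * Phi y u - k (z t) (z u) * Phi z u) t _ tb _)).
  + by apply: eq_integrable (integrableB _ (ik (y t) _ hy) (ik (z t) _ hz)).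
  + move=> u /andP[u0 ut]; have ub : 0 <= u <= b by rewrite u0 (le_trans ut).
    have -> : k (y t) (y u) * Phi y u - k (z t) (z u) * Phi z u =
      k (y t) (y u) * (Phi y u - Phi z u) + (k (y t) (y u) - k (z t) (z u)) * Phi z u.
      by ring.
    case: (hy) (hz) => _ yr [_ zr].
    have [h1 h2] := hC _ _ _ _ (yr _ tb) (yr _ ub) (zr _ tb) (zr _ ub).
    apply: (le_trans (ler_normD _ _)); rewrite !normrM.
    have -> : 3 * (C * D) * dlt = C * (D * dlt) + C * (dlt + dlt) * D by ring.
    apply: lerD; apply: ler_pM => //.
    * by apply: lD => // v /andP[v0 vu]; apply: h; rewrite v0 (le_trans vu).
    * apply: (le_trans h2); rewrite ler_wpM2l// lerD// h// ?u0// lexx andbT//.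
    * exact: bD.
  + by rewrite mulrAC ler_wpM2r// ler_wpM2l// !mulr_ge0.
Unshelve. all: by end_near. Qed.

End CausalOperators.

(** * Picard iteration *)

Section MatrixIndefinite.
Context {R : realType}.

Lemma mx_indefinite_lipschitz (k : nat) (b C : R) (p : R -> 'cV[R]_k) s t :
  mx_integrable (@lebesgue_measure R) `[0, b] p -> 0 <= C ->
  0 <= s <= b -> 0 <= t <= b -> (forall u, 0 <= u <= b -> `|p u| <= C) ->
  `|mx_integral (@lebesgue_measure R) `[0, t] p - mx_integral (@lebesgue_measure R) `[0, s] p|
    <= C * `|t - s|.
Proof.
move=> ip C0 sb tb pC; apply: cV_norm_le => [|i]; first exact: mulr_ge0.
rewrite !mxE; apply: (indefinite_lipschitz (ip i ord0)) => // u /andP[u1 u2].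
apply: le_trans (mx_entry_le _ _ _) (pC u _).
move: sb tb u1 u2 => /andP[s0 sb] /andP[t0 tb].
rewrite ge_min le_max => /orP[h1|h1] /orP[h2|h2]; apply/andP; split; lra.
Qed.

Lemma mx_integral0 (k : nat) (p : R -> 'cV[R]_k) :
  mx_integral (@lebesgue_measure R) `[0, 0] p = 0.
Proof. by apply/matrixP => i j; rewrite !mxE indefinite0. Qed.

Lemma eq_mx_integral (k l : nat) (D : set R) (p q : R -> 'M[R]_(k, l)) :
  (forall t, D t -> p t = q t) ->
  mx_integral (@lebesgue_measure R) D p = mx_integral (@lebesgue_measure R) D q.
Proof.
move=> pq; apply/matrixP => i j; rewrite !mxE; apply: eq_Rintegral => t /set_mem Dt.
by rewrite pq.
Qed.

End MatrixIndefinite.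

Definition causal_map (R : realType) (N : nat) (r b : R)
    (F : (R -> 'cV[R]_N) -> R -> 'cV[R]_N) :=
  exists C : R, [/\ 0 < C,
    (forall y, admissible r b y -> mx_measurable `[0, b] (F y)),
    (forall y, admissible r b y -> forall t, 0 <= t <= b -> `|F y t| <= C) &
    (forall y z, admissible r b y -> admissible r b z -> forall t, 0 <= t <= b ->
       forall dlt, (forall u, 0 <= u <= t -> `|y u - z u| <= dlt) ->
       `|F y t - F z t| <= C * dlt)].

Lemma causal_mapP (R : realType) (N : nat) (r b : R) (F : (R -> 'cV[R]_N) -> R -> 'cV[R]_N) :
  (forall i, causal_operator r b (fun y t => F y t i ord0)) -> causal_map r b F.
Proof.
move=> /choice[C hC]; have C0 i : 0 <= C i by have [] := hC i.
have CS i : C i <= 1 + \sum_j C j.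
  by rewrite (bigD1 i)//= addrCA lerDl addr_ge0// sumr_ge0.
have S1 : 0 < 1 + \sum_j C j by rewrite ltr_pwDl// sumr_ge0.
(* The summand 1 keeps the constant positive even if all [C i] vanish or [N = 0]; the Picard
   estimates divide by it. *)
exists (1 + \sum_j C j); split => //.
- by move=> y hy i j; rewrite ord1; have [_ h _ _] := hC i; exact: h.
- move=> y hy t tb; apply: cV_norm_le => [|i]; first exact: ltW.
  by have [_ _ h _] := hC i; apply: le_trans (CS i); exact: h.
- move=> y z hy hz t tb dlt h.
  have d0 : 0 <= dlt by apply: le_trans (h 0 _); rewrite // lexx; case/andP: tb.
  apply: cV_norm_le => [|i]; first by rewrite mulr_ge0// ltW.
  rewrite !mxE; have [_ _ _ lC] := hC i; apply: (le_trans (lC y z hy hz t tb dlt h)).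
  by rewrite ler_wpM2r.
Qed.

Lemma geometric_half (R : realType) (D : R) k : D / 2 ^+ k.+1 = D / 2 ^+ k / 2.
Proof. by rewrite exprS invfM mulrA mulrAC. Qed.

Section Picard.
Context {R : realType} {N : nat}.
Context (G : (R -> 'cV[R]_N) -> R -> 'cV[R]_N) (y0 : 'cV[R]_N).
Notation mu := (@lebesgue_measure R).

(** The clauses of [causal_map] freed from the radius: the form they take once the state is
    clipped. *)
Definition saturated (C b : R) := [/\ 0 < C,
  (forall y, continuous_on b y -> mx_measurable `[0, b] (G y)),
  (forall y, continuous_on b y -> forall t, 0 <= t <= b -> `|G y t| <= C) &
  (forall y z, continuous_on b y -> continuous_on b z -> forall t, 0 <= t <= b ->
     forall dlt, (forall u, 0 <= u <= t -> `|y u - z u| <= dlt) ->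
     `|G y t - G z t| <= C * dlt)].

Definition picard (y : R -> 'cV[R]_N) (t : R) : 'cV[R]_N :=
  y0 + mx_integral mu `[0, t] (G y).

Lemma saturated_integrable C b y : saturated C b -> continuous_on b y ->
  mx_integrable mu `[0, b] (G y).
Proof.
move=> [C0 mG bG _] cy i j; apply: (@bounded_itv_integrable _ _ _ C); first exact: mG.
by move=> t tb; apply: le_trans (mx_entry_le _ _ _) _; exact: bG.
Qed.

Lemma picard_lipschitz C b y s t : saturated C b -> continuous_on b y ->
  0 <= s <= b -> 0 <= t <= b -> `|picard y s - picard y t| <= C * `|s - t|.
Proof.
move=> hG cy sb tb; have [C0 _ bG _] := hG.
rewrite /picard opprD addrACA subrr add0r.
by apply: (mx_indefinite_lipschitz (saturated_integrable hG cy)) (ltW C0) tb sb (bG y cy).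
Qed.

Lemma picard_contraction C b y z D : saturated C b ->
  continuous_on b y -> continuous_on b z -> 0 <= D ->
  (forall t, 0 <= t <= b -> `|y t - z t| <= D * expR (2 * C * t)) ->
  forall t, 0 <= t <= b -> `|picard y t - picard z t| <= D / 2 * expR (2 * C * t).
Proof.
move=> hG cy cz D0 yz t tb; have [C0 _ _ lG] := hG; have /andP[t0 tb'] := tb.
have E0 : 0 <= D / 2 * expR (2 * C * t) by rewrite mulr_ge0 ?expR_ge0// divr_ge0.
apply: cV_norm_le => // i; rewrite !mxE opprD addrACA subrr add0r.
have iy := saturated_integrable hG cy; have iz := saturated_integrable hG cz.
rewrite -RintegralB//; [|exact: (integrable_sub tb' (iy _ _))
                        |exact: (integrable_sub tb' (iz _ _))].
(* The Lipschitz constant [C] over the rate [2 * C] of the weight is the contraction factor 1/2. *)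
have -> : D / 2 = C * D / (2 * C) by field; rewrite lt0r_neq0.
apply: (@integral_expR_le R b (2 * C) (C * D) (fun u => G y u i ord0 - G z u i ord0)) => //.
- exact: eq_integrable (integrableB _ (iy i ord0) (iz i ord0)).
- by rewrite mulr_gt0.
- by rewrite mulr_ge0// ltW.
- move=> u ub; have := mx_entry_le (G y u - G z u) i ord0; rewrite !mxE => /le_trans; apply.
  rewrite -mulrA; apply: lG => // v /andP[v0 vu]; have /andP[u0 ub'] := ub.
  apply: (le_trans (yz v _)); first by rewrite v0 (le_trans vu).
  by rewrite ler_wpM2l// ler_expR ler_wpM2l// mulr_ge0// ltW.
Qed.

Lemma picard_iterates C b (u : nat -> R -> 'cV[R]_N) D : saturated C b ->
  (forall k, continuous_on b (u k)) -> 0 <= D ->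
  (forall k t, 0 <= t <= b -> u k.+1 t = picard (u k) t) ->
  (forall t, 0 <= t <= b -> `|u 1%N t - u 0%N t| <= D) ->
  forall k t, 0 <= t <= b -> `|u k.+1 t - u k t| <= D / 2 ^+ k * expR (2 * C * t).
Proof.
move=> hG cu D0 uS u10; have [C0 _ _ _] := hG; elim=> [|k IH] t tb.
  rewrite expr0 divr1; apply: (le_trans (u10 t tb)).
  have /andP[t0 _] := tb.
  rewrite ler_peMr// -expR0 ler_expR; apply: mulr_ge0 => //; apply: mulr_ge0 => //; exact: ltW.
rewrite (uS k.+1)// (uS k)//.
rewrite geometric_half.
by apply: picard_contraction hG _ _ _ _ t tb => //; rewrite divr_ge0// exprn_ge0.
Qed.

(** Both fixed points stay within [C * b] of [y0], which bounds their distance; applying the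
    contraction [k] times divides that bound by [2 ^+ k]. *)
Lemma picard_unique C b y z : saturated C b ->
  continuous_on b y -> continuous_on b z ->
  (forall t, 0 <= t <= b -> y t = picard y t) ->
  (forall t, 0 <= t <= b -> z t = picard z t) ->
  forall t, 0 <= t <= b -> y t = z t.
Proof.
move=> hG cy cz yP zP t tb; have [C0 _ bG lG] := hG; have /andP[t0 tb'] := tb.
have b0 : 0 <= b := le_trans t0 tb'.
have near0 w s : continuous_on b w -> (forall t, 0 <= t <= b -> w t = picard w t) ->
    0 <= s <= b -> `|w s - y0| <= C * b.
  move=> cw wP sb; have /andP[s0 sb'] := sb; rewrite wP//.
  have := @picard_lipschitz C b w s 0 hG cw sb; rewrite lexx b0 => /(_ isT).
  rewrite [picard w 0]/picard mx_integral0 addr0 subr0 => /le_trans; apply.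
  by rewrite ger0_norm// ler_wpM2l// ltW.
have D0 : 0 <= 2 * (C * b) by rewrite !mulr_ge0// ltW.
have h k : forall s, 0 <= s <= b ->
    `|y s - z s| <= 2 * (C * b) / 2 ^+ k * expR (2 * C * s).
  elim: k => [|k IH] s sb.
    rewrite expr0 divr1; apply: (@le_trans _ _ (2 * (C * b))).
      have := ler_distD y0 (y s) (z s); have := near0 y s cy yP sb.
      have := near0 z s cz zP sb; rewrite (distrC (z s)); lra.
    have /andP[s0 _] := sb.
    rewrite ler_peMr// -expR0 ler_expR; apply: mulr_ge0 => //; apply: mulr_ge0 => //; exact: ltW.
  rewrite yP// zP//.
  rewrite geometric_half.
  by apply: picard_contraction hG _ _ _ IH s sb => //; rewrite divr_ge0// exprn_ge0.
apply/eqP; rewrite -subr_eq0 -normr_le0.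
apply: (@le_geometric_limit _ _ _ (2 * (C * b) * expR (2 * C * t))) => k.
by rewrite add0r mulrAC; exact: h.
Qed.

(** The curve is chosen before [b] and [C]: the iterates do not depend on the horizon, so their
    pointwise limit serves every interval on which the operator is saturated. *)
Lemma picard_exists : exists y, forall b C, 0 <= b -> saturated C b ->
    (forall s t, 0 <= s <= b -> 0 <= t <= b -> `|y s - y t| <= C * `|s - t|) /\
    forall t, 0 <= t <= b -> y t = picard y t.
Proof.
pose u := fix u (k : nat) : R -> 'cV[R]_N :=
  if k is k'.+1 then picard (u k') else fun=> y0.
have uL b C : saturated C b -> forall k s t, 0 <= s <= b -> 0 <= t <= b ->
    `|u k s - u k t| <= C * `|s - t|.
  move=> hG; elim=> [s t _ _|k IH s t sb tb] /=.
    by rewrite subrr normr0 mulr_ge0//; case: hG => /ltW.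
  by apply: picard_lipschitz hG _ sb tb; exact: lipschitz_continuous_on IH.
pose y t : 'cV[R]_N := \col_i limn (fun k => u k t i ord0).
exists y => b C b0 hG; have C0 : 0 < C by case: hG.
have cu k : continuous_on b (u k) := lipschitz_continuous_on (uL b C hG k).
have D0 : 0 <= C * b by rewrite mulr_ge0// ltW.
have hu : forall k t, 0 <= t <= b ->
    `|u k.+1 t - u k t| <= C * b / 2 ^+ k * expR (2 * C * t).
  apply: (picard_iterates hG cu D0) => // t tb /=.
  have := @picard_lipschitz C b (u 0%N) t 0 hG (cu 0%N) tb; rewrite lexx b0 => /(_ isT).
  rewrite [picard _ 0]/picard mx_integral0 addr0 subr0 => /le_trans; apply.
  by case/andP: tb => t0 tb; rewrite ger0_norm// ler_wpM2l// ltW.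
pose A := C * b * expR (2 * C * b).
have A0 : 0 <= A by rewrite mulr_ge0// expR_ge0.
have yu k t : 0 <= t <= b -> `|y t - u k t| <= 2 * A / 2 ^+ k.
  move=> tb; apply: cV_norm_le => [|i]; first by apply: divr_ge0; [exact: mulr_ge0|exact: exprn_ge0].
  rewrite !mxE; apply: (@geometric_limit _ (fun k => u k t i ord0)) => // m.
  have := mx_entry_le (u m.+1 t - u m t) i ord0; rewrite !mxE => /le_trans; apply.
  apply: (le_trans (hu m t tb)); rewrite /A mulrAC ler_pM2r ?invr_gt0 ?exprn_gt0//.
  case/andP: tb => t0 tb; rewrite ler_wpM2l// ler_expR ler_wpM2l// mulr_ge0// ltW//.
have yL s t : 0 <= s <= b -> 0 <= t <= b -> `|y s - y t| <= C * `|s - t|.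
  (* Each iterate is [C]-Lipschitz, and replacing [y] by [u k] at the two ends costs at most
     [4 * A / 2 ^+ k]. *)
  move=> sb tb; apply: (@le_geometric_limit _ _ _ (4 * A)) => k.
  have := uL b C hG k s t sb tb; have := yu k s sb; have := yu k t tb.
  have := ler_distD (u k s) (y s) (y t); have := ler_distD (u k t) (u k s) (y t).
  rewrite (distrC (u k t) (y t)); lra.
split=> // t tb; have cy := lipschitz_continuous_on yL.
apply/eqP; rewrite -subr_eq0 -normr_le0.
(* The iterate [u k.+1], which is [picard (u k)], is close both to [y] and to [picard y], with
   geometric errors. *)
apply: (@le_geometric_limit _ _ _ (2 * A + A * expR (2 * C * t))) => k.
rewrite add0r.
have h1 := yu k.+1 t tb.
have h2 : `|picard y t - picard (u k) t| <= 2 * A / 2 ^+ k / 2 * expR (2 * C * t).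
  apply: (picard_contraction hG cy (cu k) _ _ tb); first by apply: divr_ge0; [exact: mulr_ge0|exact: exprn_ge0].
  move=> s sb; apply: (le_trans (yu k s sb)); rewrite ler_peMr//.
    by apply: divr_ge0; [exact: mulr_ge0|exact: exprn_ge0].
  have /andP[s0 _] := sb.
  rewrite -expR0 ler_expR; apply: mulr_ge0 => //; apply: mulr_ge0 => //; exact: ltW.
have h3 := ler_distD (u k.+1 t) (y t) (picard y t).
rewrite (distrC (u k.+1 t)) in h3.
apply: (le_trans h3); apply: (le_trans (lerD h1 h2)).
have -> : 2 * A / 2 ^+ k.+1 = A / 2 ^+ k.
  by rewrite exprS; field; rewrite expf_neq0// pnatr_eq0.
have -> : 2 * A / 2 ^+ k / 2 = A / 2 ^+ k.
  by field; rewrite expf_neq0// pnatr_eq0.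
have : 0 <= A / 2 ^+ k by apply: divr_ge0 => //; exact: exprn_ge0.
by move: (expR _) ((2 ^+ k)^-1) => E Z; lra.
Qed.

End Picard.

(** * Maximal solutions *)

Section MaximalSolution.
Context {R : realType} {N : nat}.

(** Causality proper, as the case [dlt = 0] of the Lipschitz clause. *)
Lemma causal_map_eq (r b : R) (F : (R -> 'cV[R]_N) -> R -> 'cV[R]_N) y z t :
  causal_map r b F -> admissible r b y -> admissible r b z -> 0 <= t <= b ->
  (forall u, 0 <= u <= t -> y u = z u) -> F y t = F z t.
Proof.
move=> [C [_ _ _ lF]] hy hz tb yz; apply/eqP; rewrite -subr_eq0 -normr_le0.
rewrite -(mulr0 C); apply: lF => // u ut; by rewrite yz// subrr normr0.
Qed.

Lemma clip_continuous_on (r b : R) (y : R -> 'cV[R]_N) :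
  continuous_on b y -> continuous_on b (fun t => clip r (y t)).
Proof.
move=> cy t tb eps e0; have [dlt d0 h] := cy t tb eps e0; exists dlt => // s sb st.
exact: le_lt_trans (clip_lipschitz _ _ _) (h s sb st).
Qed.

Lemma clip_saturated (r b : R) (F : (R -> 'cV[R]_N) -> R -> 'cV[R]_N) : 0 <= r ->
  causal_map r b F -> exists C, saturated (fun y => F (fun t => clip r (y t))) C b.
Proof.
move=> r0 [D [D0 mF bF lF]]; exists D.
have ca (y : R -> 'cV[R]_N) : continuous_on b y -> admissible r b (fun t => clip r (y t)).
  by move=> cy; split=> [|t tb]; [apply: clip_continuous_on cy|exact: clip_le].
split => //.
- by move=> y /ca; exact: mF.
- by move=> y /ca hy; exact: bF.
- move=> y z /ca hy /ca hz t tb dlt h; apply: lF => // u ut.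
  exact: le_trans (clip_lipschitz _ _ _) (h u ut).
Qed.

Lemma continuous_on_ext (V : normedModType R) (b : R) (y z : R -> V) :
  (forall t, 0 <= t <= b -> y t = z t) -> continuous_on b y -> continuous_on b z.
Proof.
move=> yz cy t tb eps e0; have [dlt d0 h] := cy t tb eps e0; exists dlt => // s sb st.
by rewrite -!yz//; exact: h.
Qed.

Lemma continuous_on_sub (V : normedModType R) (b c : R) (y : R -> V) :
  c <= b -> continuous_on b y -> continuous_on c y.
Proof.
move=> cb cy t /andP[t0 tc] eps e0.
have [|dlt d0 h] := cy t _ eps e0; first by rewrite t0 (le_trans tc).
by exists dlt => // s /andP[s0 sc]; apply: h; rewrite s0 (le_trans sc).
Qed.

(** The curve [Y r] solves the equation clipped at radius [r], hence the original one as long as it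
    stays in its ball. [T] is the supremum of the times up to which some [Y r] does so. *)
Lemma maximal_solution (F : (R -> 'cV[R]_N) -> R -> 'cV[R]_N) (y0 : 'cV[R]_N) :
  (forall r b, 0 <= r -> 0 <= b -> causal_map r b F) ->
  exists (T : \bar R) y, [/\ (0 < T)%E,
    (forall t, time_interval T t -> continuous_on t y /\ y t = picard F y0 y t) &
    (T < +oo)%E -> forall M, ~ (forall t, time_interval T t -> `|y t| <= M)].
Proof.
move=> hF.
pose G r (y : R -> 'cV[R]_N) := F (fun t => clip r (y t)).
have /choice[Y hY] := fun r => picard_exists (G r) y0.
have sat r b : 0 <= r -> 0 <= b -> exists C, saturated (G r) C b.
  by move=> r0 b0; apply: clip_saturated (hF r b r0 b0).
have cY r b : 0 <= r -> 0 <= b -> continuous_on b (Y r).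
  move=> r0 b0; have [C hC] := sat r b r0 b0.
  by have [+ _] := hY r b C b0 hC; exact: lipschitz_continuous_on.
have YP r t : 0 <= r -> 0 <= t -> Y r t = picard (G r) y0 (Y r) t.
  move=> r0 t0; have [C hC] := sat r t r0 t0.
  by have [_ ->] := hY r t C t0 hC; rewrite // t0 lexx.
have adm r b (y : R -> 'cV[R]_N) : 0 <= r -> continuous_on b y -> admissible r b (fun t => clip r (y t)).
  by move=> r0 cy; split=> [|t tb]; [apply: clip_continuous_on cy|exact: clip_le].
(* Clipped solutions coincide while one of them lies in both balls: no clipping is active on it, so
   [Y r1] also solves the equation clipped at [r2], whose solution is unique. *)
have U r1 r2 t : 0 <= r1 -> 0 <= r2 -> 0 <= t ->
    (forall s, 0 <= s <= t -> `|Y r1 s| <= r1 /\ `|Y r1 s| <= r2) ->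
    forall s, 0 <= s <= t -> Y r1 s = Y r2 s.
  move=> r10 r20 t0 Yr; have [C hC] := sat r2 t r20 t0.
  apply: (picard_unique (y0 := y0) hC); [exact: cY|exact: cY| |]; last first.
    by move=> s /andP[s0 _]; exact: YP.
  move=> s /andP[s0 st]; rewrite [LHS]YP// /picard; congr (_ + _).
  apply: eq_mx_integral => u; rewrite /= in_itv/= => /andP[u0 us].
  (* Causality of [F] is available on one ball at a time, so both clipped curves are placed in the
     larger one. *)
  pose r := Num.max r1 r2; have r0 : 0 <= r by rewrite le_max r10.
  have adm' r' : 0 <= r' -> r' <= r -> admissible r t (fun v => clip r' (Y r1 v)).
    move=> r'0 r'r; have [h1 h2] := adm r' t (Y r1) r'0 (cY r1 t r10 t0).
    by split=> // v vt; apply: le_trans (h2 v vt) r'r.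
  apply: (causal_map_eq (hF r t r0 t0)).
  - by apply: adm' => //; rewrite le_max lexx.
  - by apply: adm' => //; rewrite le_max lexx orbT.
  - by rewrite u0 (le_trans us).
  - move=> v /andP[v0 vu]; have [|h1 h2] := Yr v.
      by rewrite v0 (le_trans vu)// (le_trans us).
    by rewrite !clip_id.
pose ok r t := [/\ 0 <= r, 0 <= t & forall s, 0 <= s <= t -> `|Y r s| <= r].
have ok_sub r t s : ok r t -> 0 <= s -> s <= t -> ok r s.
  by move=> [r0 t0 h] s0 st; split=> // u /andP[u0 us]; apply: h; rewrite u0 (le_trans us).
pose A := [set t%:E | t in [set t : R | exists r, ok r t]].
pose T := ereal_sup A.
have okT r t : ok r t -> (t%:E <= T)%E.
  by move=> h; apply: ereal_sup_ubound; exists t => //; exists r.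
have Tok t : time_interval T t -> exists r, ok r t.
  move=> [t0 /ereal_sup_gt[_ [t' [r h] <-]]]; rewrite lte_fin => tt'.
  by exists r; apply: ok_sub h t0 (ltW tt').
have /choice[rr hrr] : forall t, exists r, time_interval T t -> ok r t.
  move=> t; have [/Tok[r h]|h] := pselect (time_interval T t); first by exists r.
  by exists 0.
pose y t := Y (rr t) t.
have subT s t : time_interval T t -> 0 <= s <= t -> time_interval T s.
  by move=> [t0 tT] /andP[s0 st]; split=> //; apply: le_lt_trans tT; rewrite lee_fin.
have yY t : time_interval T t -> forall s, 0 <= s <= t -> y s = Y (rr t) s.
  move=> hT s /[dup] hs /andP[s0 st]; have hTs := subT s t hT hs.
  have [rt0 _ ht] := hrr t hT; have [rs0 _ hs'] := hrr s hTs.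
  (* [U] is applied to the solution with the smaller radius, which lies in both balls. *)
  have [le|/ltW le] := leP (rr s) (rr t).
    apply: (U (rr s) (rr t) s) => //; last by rewrite s0 lexx.
    by move=> u us; split; [exact: hs'|exact: le_trans (hs' u us) le].
  apply/esym/(U (rr t) (rr s) s) => //; last by rewrite s0 lexx.
  move=> u /andP[u0 us]; have h : `|Y (rr t) u| <= rr t by apply: ht; rewrite u0 (le_trans us).
  by split=> //; exact: le_trans h le.
have Tpos : (0 < T)%E.
  (* At speed at most [C] the curve needs time 1 / C to leave the ball of radius |y0| + 1; [t <= 1]
     respects the horizon for which [C] is valid. *)
  pose r := `|y0| + 1; have r0 : 0 <= r by rewrite addr_ge0.
    have [C hC] := sat r 1 r0 ler01; have [Yl _] := hY r 1 C ler01 hC.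
    have C0 : 0 < C by case: hC.
    pose t := Num.min 1 C^-1; have t0 : 0 < t by rewrite lt_min ltr01 invr_gt0.
    have t1 : t <= 1 by rewrite ge_min lexx.
    have tC : C * t <= 1.
      by rewrite -(divff (lt0r_neq0 C0)) ler_pM2l// ge_min lexx orbT.
    apply: (@lt_le_trans _ _ t%:E); first by rewrite lte_fin.
    apply: (okT r); split=> //; first exact: ltW.
    move=> s /andP[s0 st]; have s1 : s <= 1 by exact: le_trans t1.
    have := Yl s 0; rewrite s0 s1 lexx ler01 subr0 => /(_ isT isT).
    rewrite [Y r 0]YP// /picard mx_integral0 addr0 (ger0_norm s0) => h.
    have := ler_distD y0 (Y r s) 0; rewrite !subr0 => /le_trans; apply.
    rewrite addrC lerD2l; apply: (le_trans h); apply: le_trans tC.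
    by rewrite ler_wpM2l// ltW.
exists T, y; split.
- exact: Tpos.
- move=> t hT; have [r0 t0 Yr] := hrr t hT; have yYt := yY t hT.
  have cYt := cY (rr t) t r0 t0.
  have cy : continuous_on t y.
    by apply: continuous_on_ext cYt => s st; rewrite yYt.
  split=> //; rewrite /y [LHS]YP// /picard; congr (_ + _); apply: eq_mx_integral => u.
  rewrite /= in_itv/= => /andP[u0 ut]; apply: (causal_map_eq (hF (rr t) t r0 t0)).
  + exact: adm.
  + by split=> // s st; rewrite -[Y (rr s) s]/(y s) yYt// Yr.
  + by rewrite u0.
  + move=> v /andP[v0 vu]; have vt : 0 <= v <= t by rewrite v0 (le_trans vu).
    by rewrite clip_id ?Yr// -[RHS]/(y v) yYt.
- move=> Too M yM.
  have [T0 TE] : exists T0, T = T0%:E by exists (fine T); rewrite fineK// ge0_fin_numE// ltW.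
  have T0pos : 0 < T0 by rewrite TE lte_fin in Tpos.
  have T00 := ltW T0pos.
  have inT s : 0 <= s -> s < T0 -> time_interval T s.
    by move=> s0 sT; split=> //; rewrite TE lte_fin.
  (* The extra unit of radius is the room in which [Y r] continues past [T0]. *)
  pose r := `|M| + 1; have r0 : 0 <= r by rewrite addr_ge0.
  have YM s : 0 <= s -> s < T0 -> `|Y r s| <= `|M|.
    move=> s0 sT; have hT := inT s s0 sT; have [rs0 _ hs] := hrr s hT.
    have h u : 0 <= u <= s -> `|Y (rr s) u| <= `|M|.
      move=> us; rewrite -(yY s hT u us).
      by apply: le_trans (ler_norm M); apply: yM; exact: subT hT us.
    have ss : 0 <= s <= s by rewrite s0 lexx.
    rewrite -(U (rr s) r s rs0 r0 s0 _ s ss); first exact: h.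
    move=> u us; split; first exact: hs.
    by apply: (le_trans (h u us)); rewrite lerDl.
  have T01 : 0 <= T0 + 1 by rewrite addr_ge0.
  have [C hC] := sat r (T0 + 1) r0 T01; have [Yl _] := hY r (T0 + 1) C T01 hC.
  have C0 : 0 < C by case: hC.
  (* [Y r] is followed from a time not before [T0 - eta] up to [T0 + eta], and [C * (2 * eta) <= 1]
     keeps the displacement within the spare unit. *)
  pose eta := Num.min 1 (C^-1 / 2).
  have eta0 : 0 < eta by rewrite lt_min ltr01 divr_gt0// invr_gt0.
  have eta1 : eta <= 1 by rewrite ge_min lexx.
  have etaC : C * (2 * eta) <= 1.
    have etaC : eta <= C^-1 / 2 by rewrite ge_min lexx orbT.
    have h := divff (lt0r_neq0 C0).
    have : C * eta <= C * (C^-1 / 2) by rewrite ler_pM2l.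
    by rewrite mulrA h; lra.
  suff /okT : ok r (T0 + eta) by rewrite TE lee_fin gerDl leNgt eta0.
  split=> //; first by rewrite addr_ge0// ltW.
  move=> s /andP[s0 sT]; have [/YM h|T0s] := ltP s T0.
    by apply: (le_trans (h s0)); rewrite lerDl.
  pose s' := Num.max 0 (T0 - eta).
  have s'0 : 0 <= s' by rewrite le_max lexx.
  have s'T : s' < T0 by rewrite gt_max T0pos gtrBl.
  have s's : s - s' <= 2 * eta.
    have : T0 - eta <= s' by rewrite le_max lexx orbT.
    lra.
  have sb : 0 <= s <= T0 + 1 by rewrite s0 (le_trans sT)// lerD2l.
  have sb' : 0 <= s' <= T0 + 1 by rewrite s'0 (le_trans (ltW s'T))// lerDl.
  have := Yl s s' sb sb'; rewrite ger0_norm ?subr_ge0 ?(le_trans (ltW s'T))// => h.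
  have := ler_distD (Y r s') (Y r s) 0; rewrite !subr0 => /le_trans; apply.
  rewrite /r addrC lerD//; first exact: YM.
  by apply: (le_trans h); apply: le_trans etaC; rewrite ler_pM2l.
Qed.

End MaximalSolution.

(** * Euclidean and operator norms *)

Section Euclidean.
Context {R : realType}.

Lemma l2norm_ge0 (k : nat) (v : 'cV[R]_k) : 0 <= l2norm v.
Proof. exact: sqrtr_ge0. Qed.

Lemma dotvv_ge0 (k : nat) (v : 'cV[R]_k) : 0 <= dot v v.
Proof. by apply: sumr_ge0 => i _; rewrite -expr2 sqr_ge0. Qed.

Lemma norm_le_l2norm (k : nat) (v : 'cV[R]_k) : `|v| <= l2norm v.
Proof.
apply: cV_norm_le => [|i]; first exact: l2norm_ge0.
rewrite /l2norm -sqrtr_sqr ler_sqrt ?dotvv_ge0// /dot (bigD1 i)//= -expr2 lerDl.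
by apply: sumr_ge0 => j _; rewrite -expr2 sqr_ge0.
Qed.

Lemma dot_le (k : nat) (v w : 'cV[R]_k) : `|dot v w| <= k%:R * `|v| * `|w|.
Proof.
apply: (le_trans (ler_norm_sum _ _ _)).
apply: (@le_trans _ _ (\sum_(i < k) `|v| * `|w|)).
  by apply: ler_sum => i _; rewrite normrM ler_pM// mx_entry_le.
by rewrite sumr_const card_ord -[X in X <= _]mulr_natl mulrA.
Qed.

(** With [norm_le_l2norm], the equivalence of the two norms. The sharp factor is the square root of
    [k], but any finite one serves. *)
Lemma l2norm_le (k : nat) (v : 'cV[R]_k) : l2norm v <= k%:R * `|v|.
Proof.
rewrite -(@ger0_norm _ (_ * _)) ?mulr_ge0// -sqrtr_sqr ler_sqrt ?sqr_ge0//.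
apply: (le_trans (ler_norm _)); apply: (le_trans (dot_le _ _)).
rewrite exprMn -mulrA -expr2 ler_wpM2r ?sqr_ge0// -natrX ler_nat.
by case: k v => [|k] v; rewrite ?mul0n// leq_pmulr.
Qed.

Lemma l2norm_eq0 (k : nat) (v : 'cV[R]_k) : l2norm v = 0 -> v = 0.
Proof.
by move=> v0; apply/eqP; rewrite -normr_le0 -v0; exact: norm_le_l2norm.
Qed.

Lemma dotC (k : nat) (v w : 'cV[R]_k) : dot v w = dot w v.
Proof. by apply: eq_bigr => i _; rewrite mulrC. Qed.

Lemma dotDl (k : nat) (u v w : 'cV[R]_k) : dot (u + v) w = dot u w + dot v w.
Proof. by rewrite /dot -big_split; apply: eq_bigr => i _; rewrite mxE mulrDl. Qed.

Lemma dotZl (k : nat) a (v w : 'cV[R]_k) : dot (a *: v) w = a * dot v w.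
Proof. by rewrite /dot mulr_sumr; apply: eq_bigr => i _; rewrite mxE mulrA. Qed.

Lemma dotNl (k : nat) (v w : 'cV[R]_k) : dot (- v) w = - dot v w.
Proof. by rewrite -scaleN1r dotZl mulN1r. Qed.

Lemma dotBl (k : nat) (u v w : 'cV[R]_k) : dot (u - v) w = dot u w - dot v w.
Proof. by rewrite dotDl dotNl. Qed.

Lemma dotDr (k : nat) (u v w : 'cV[R]_k) : dot w (u + v) = dot w u + dot w v.
Proof. by rewrite dotC dotDl !(dotC w). Qed.

Lemma dotBr (k : nat) (u v w : 'cV[R]_k) : dot w (u - v) = dot w u - dot w v.
Proof. by rewrite dotC dotBl !(dotC w). Qed.

Lemma dot_mulmxl (k l : nat) (A : 'M[R]_(k, l)) v w : dot (A *m v) w = dot v (A^T *m w).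
Proof.
rewrite /dot; under eq_bigr do rewrite mxE mulr_suml.
rewrite exchange_big; apply: eq_bigr => j _; rewrite mxE mulr_sumr.
by apply: eq_bigr => i _; rewrite mxE mulrCA mulrA.
Qed.

Lemma dot_delta (k : nat) (v : 'cV[R]_k) i : dot v (delta_mx i ord0) = v i ord0.
Proof.
rewrite /dot (bigD1 i)//= mxE !eqxx mulr1 big1 ?addr0// => j ji.
by rewrite mxE (negbTE ji) mulr0.
Qed.

Lemma mulmx_le (k l m : nat) (A : 'M[R]_(k, l)) (B : 'M[R]_(l, m)) :
  `|A *m B| <= l%:R * `|A| * `|B|.
Proof.
apply/mx_norm_leP; split=> [|i j]; first by rewrite !mulr_ge0.
rewrite mxE; apply: (le_trans (ler_norm_sum _ _ _)).
apply: (@le_trans _ _ (\sum_(i < l) `|A| * `|B|)).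
  by apply: ler_sum => h _; rewrite normrM ler_pM// mx_entry_le.
by rewrite sumr_const card_ord -[X in X <= _]mulr_natl mulrA.
Qed.

Lemma trmx_norm (k l : nat) (A : 'M[R]_(k, l)) : `|A^T| = `|A|.
Proof.
suff h k' l' (B : 'M[R]_(k', l')) : `|B^T| <= `|B|.
  by apply/le_anti; rewrite h /= -{1}[A]trmxK h.
by apply/mx_norm_leP; split=> // i j; rewrite mxE mx_entry_le.
Qed.

(** A [sup] is informative only for a nonempty bounded set, so this comes before any use of
    [opnorm]. *)
Lemma opnorm_has_sup (k l : nat) (A : 'M[R]_(k, l)) :
  has_sup [set l2norm (A *m v) | v in [set v | l2norm v <= 1]].
Proof.
split; first by exists (l2norm (A *m 0)), 0 => //=; rewrite (le_trans (l2norm_le _))// normr0 mulr0.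
exists (k%:R * (l%:R * `|A|)) => _ [v v1 <-].
apply: (le_trans (l2norm_le _)); rewrite ler_wpM2l//.
apply: (le_trans (mulmx_le _ _)); rewrite ler_piMr ?mulr_ge0//.
exact: le_trans (norm_le_l2norm v) v1.
Qed.

(** Transfers upper bounds on operator norms, the form in which they occur in the hypotheses, to the
    maximum norm; entries are read off on basis vectors. *)
Lemma norm_le_opnorm (k l : nat) (A : 'M[R]_(k, l)) : `|A| <= opnorm A.
Proof.
have ge : forall v, l2norm v <= 1 -> l2norm (A *m v) <= opnorm A.
  by move=> v v1; apply: ub_le_sup; [case: (opnorm_has_sup A)|exists v].
apply/mx_norm_leP; split=> [|i j].
  apply: le_trans (l2norm_ge0 (A *m 0)) (ge 0 _).
  by rewrite (le_trans (l2norm_le _))// normr0 mulr0.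
have d1 : l2norm (delta_mx j ord0 : 'cV[R]_l) <= 1.
  by rewrite /l2norm dot_delta mxE !eqxx sqrtr1.
apply: le_trans (ge _ d1); apply: le_trans (norm_le_l2norm _).
have := mx_entry_le (A *m (delta_mx j ord0 : 'cV[R]_l)) i ord0.
by rewrite -colE mxE.
Qed.

Lemma opnorm_ge0 (k l : nat) (A : 'M[R]_(k, l)) : 0 <= opnorm A.
Proof. exact: le_trans (norm_le_opnorm A). Qed.

End Euclidean.

(** * From the regularity hypotheses to Caratheodory functions *)

Section RegularFunctions.
Context {R : realType}.

(** [N2] is abstract so that one statement serves vector fields with [l2norm] and matrix fields with
    [opnorm]. *)
Lemma regular_caratheodory (m k l : nat) (F : 'cV[R]_m -> R -> 'M[R]_(k, l))
    (N2 : 'M[R]_(k, l) -> R) (b : R) i j :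
  (forall A, `|A| <= N2 A) -> 0 <= b ->
  locally_lipschitz (@l2norm R m) N2 F -> locally_bounded (@l2norm R m) N2 F ->
  (forall x, mx_measurable `[0, b] (F x)) -> caratheodory b (fun x t => F x t i j).
Proof.
move=> N2E b0 lF bF mF; split=> [z|r]; first exact: mF.
pose r' := m%:R * `|r| + 1; have r'0 : 0 < r' by rewrite ltr_wpDl// mulr_ge0.
have [M hM] := bF r' r'0.
(* The Lipschitz hypothesis asks for a positive horizon, and [b] may be 0. *)
have [|L hL] := lF (b + 1) r' _ r'0; first by rewrite ltr_wpDl.
have l2r (z : 'cV[R]_m) : `|z| <= r -> l2norm z <= r'.
  move=> zr; apply: (le_trans (l2norm_le _)); apply: (@le_trans _ _ (m%:R * `|r|)).
    by apply: ler_wpM2l => //; exact: le_trans zr (ler_norm _).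
  by rewrite /r' lerDl.
exists (`|M| + `|L| * m%:R) => t z w tb zr wr; have /andP[t0 tb'] := tb; split.
  apply: (le_trans (mx_entry_le _ _ _)); apply: (le_trans (N2E _)).
  apply: (le_trans (hM t z t0 (l2r _ zr))); apply: (le_trans (ler_norm M)).
  by rewrite lerDl mulr_ge0.
have [->|zw] := eqVneq z w; first by rewrite !subrr !normr0 mulr0.
have := mx_entry_le (F z t - F w t) i j; rewrite !mxE => /le_trans; apply.
apply: (le_trans (N2E _)).
have zw0 : 0 < l2norm (z - w).
  rewrite lt_def l2norm_ge0 andbT; apply: contra zw => /eqP/l2norm_eq0/eqP.
  by rewrite subr_eq0.
have := hL t z w _ (l2r _ zr) (l2r _ wr) zw.
rewrite ler_pdivrMr// => /(_ _)/le_trans; apply.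
  by rewrite t0 (le_trans tb')// lerDl.
apply: (@le_trans _ _ (`|L| * (m%:R * `|z - w|))).
  apply: (@le_trans _ _ (`|L| * l2norm (z - w))).
    by apply: ler_wpM2r; [exact: l2norm_ge0|exact: ler_norm].
  by apply: ler_wpM2l => //; exact: l2norm_le.
by rewrite mulrA ler_wpM2r// lerDr.
Qed.

Lemma caratheodory_comp (V W : normedModType R) (b : R) (F : W -> R -> R) (p : V -> W) :
  (forall v, `|p v| <= `|v|) -> (forall v w, `|p v - p w| <= `|v - w|) ->
  caratheodory b F -> caratheodory b (fun v t => F (p v) t).
Proof.
move=> pn pl cF; split=> [z|r]; first by case: cF.
have [C C0 hC] := caratheodory_bound cF r; exists C => t z w tb zr wr.
have [|h1 h2] := hC t (p z) (p w) tb _ (le_trans (pn _) wr); first exact: le_trans (pn _) zr.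
by split=> //; apply: (le_trans h2); rewrite ler_wpM2l.
Qed.

Lemma usubmx_norm (n s : nat) (v : 'cV[R]_(n + s)) : `|usubmx v| <= `|v|.
Proof. by apply: cV_norm_le => // i; rewrite mxE mx_entry_le. Qed.

Lemma dsubmx_norm (n s : nat) (v : 'cV[R]_(n + s)) : `|dsubmx v| <= `|v|.
Proof. by apply: cV_norm_le => // i; rewrite mxE mx_entry_le. Qed.

Lemma col_mx_norm (n s : nat) (v : 'cV[R]_n) (w : 'cV[R]_s) :
  `|col_mx v w| <= Num.max `|v| `|w|.
Proof.
apply: cV_norm_le => [|i]; first by rewrite le_max normr_ge0.
by rewrite mxE le_max; case: split_ordP => j _; rewrite mx_entry_le ?orbT.
Qed.

Lemma usubmxB (n s : nat) (v w : 'cV[R]_(n + s)) : usubmx v - usubmx w = usubmx (v - w).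
Proof. by apply/matrixP => i j; rewrite !mxE. Qed.

Lemma dsubmxB (n s : nat) (v w : 'cV[R]_(n + s)) : dsubmx v - dsubmx w = dsubmx (v - w).
Proof. by apply/matrixP => i j; rewrite !mxE. Qed.

End RegularFunctions.

(** * Hilbert spaces *)

Section Hilbert.
Context {R : realType} {H : completeNormedModType R} (ip : H -> H -> R).
Context (hip : inner_product ip).

Lemma ipDl u v w : ip (u + v) w = ip u w + ip v w.
Proof. by have := ip_linear hip 1 u v w; rewrite scale1r mul1r. Qed.

Lemma ip0l w : ip 0 w = 0.
Proof. by apply: (addIr (ip 0 w)); rewrite -ipDl !add0r. Qed.

Lemma ipZl a v w : ip (a *: v) w = a * ip v w.
Proof. by have := ip_linear hip a v 0 w; rewrite !addr0 ip0l addr0. Qed.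

Lemma ipNl v w : ip (- v) w = - ip v w.
Proof. by rewrite -scaleN1r ipZl mulN1r. Qed.

Lemma ipBl u v w : ip (u - v) w = ip u w - ip v w.
Proof. by rewrite ipDl ipNl. Qed.

Lemma ipBr u v w : ip w (u - v) = ip w u - ip w v.
Proof. by rewrite (ip_sym hip) ipBl !(ip_sym hip _ w). Qed.

Lemma ip_sqrD u v : `|u + v| ^+ 2 = `|u| ^+ 2 + 2 * ip u v + `|v| ^+ 2.
Proof.
rewrite -!(ip_norm hip) ipDl (ip_sym hip u) (ip_sym hip v) !ipDl (ip_sym hip v u); ring.
Qed.

Lemma ip_sqrB u v : `|u - v| ^+ 2 = `|u| ^+ 2 - 2 * ip u v + `|v| ^+ 2.
Proof. by rewrite ip_sqrD (ip_sym hip u) ipNl normrN (ip_sym hip v) mulrN. Qed.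

(** The squared norm of |v| w - |w| v equals 2 |v| |w| (|v| |w| - <w, v>). *)
Lemma cauchy_schwarz u v : `|ip u v| <= `|u| * `|v|.
Proof.
suff h w : ip w v <= `|w| * `|v|.
  rewrite ler_norml h andbT; have := h (- u); rewrite ipNl normrN; lra.
have [v0|v0] := eqVneq `|v| 0.
  by rewrite v0 mulr0 (normr0_eq0 v0) (ip_sym hip) ip0l.
have vpos : 0 < `|v| by rewrite lt_def v0 normr_ge0.
have [w0|w0] := eqVneq `|w| 0; first by rewrite w0 mul0r (normr0_eq0 w0) ip0l.
have wpos : 0 < `|w| by rewrite lt_def w0 normr_ge0.
have := sqr_ge0 (`|(`|v| *: w) - (`|w| *: v)|); rewrite ip_sqrB !normrZ !normr_id.
rewrite ipZl (ip_sym hip) ipZl (ip_sym hip v).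
move: (ip w v) (`|v|) (`|w|) vpos wpos => p a c a0 c0.
have -> : (a * c) ^+ 2 - 2 * (a * (c * p)) + (c * a) ^+ 2 = 2 * (a * c) * (c * a - p).
  by ring.
by rewrite pmulr_rge0 ?mulr_gt0// subr_ge0.
Qed.

(* The representing vector minimises |v|^2 - 2 L v; minimising sequences are
   Cauchy by the parallelogram identity. *)
Lemma riesz_representation (L : H -> R) (C : R) :
  (forall a v w, L (a *: v + w) = a * L v + L w) ->
  (forall v, `|L v| <= C * `|v|) ->
  exists u, forall v, ip u v = L v.
Proof.
move=> Llin LC.
have LD v w : L (v + w) = L v + L w by rewrite -[v]scale1r Llin mul1r scale1r.
have L0 : L 0 = 0 by apply: (addIr (L 0)); rewrite -LD !add0r.
have LZ a v : L (a *: v) = a * L v by rewrite -[a *: v]addr0 Llin L0 addr0.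
have LB v w : L (v - w) = L v - L w by rewrite LD -scaleN1r LZ mulN1r.
pose J v := `|v| ^+ 2 - 2 * L v.
have Jlb v : - C ^+ 2 <= J v.
  have := LC v; rewrite ler_norml => /andP[_ h].
  have := sqr_ge0 (`|v| - C); rewrite /J sqrrB; lra.
have hinf : has_inf (range J).
  by split; [exists (J 0), 0|exists (- C ^+ 2) => _ [v _ <-]].
pose m := inf (range J).
have mJ v : m <= J v by apply: ge_inf; [case: hinf|exists v].
have /choice[u uP] : forall k : nat, exists v, J v < m + k.+1%:R^-1.
  move=> k; have k0 : 0 < k.+1%:R^-1 :> R by rewrite invr_gt0.
  by have [_ [v _ <-] h] := inf_adherent k0 hinf; exists v.
(* Uses that [J] is at least [m] at the midpoint of [v] and [w]. *)
have parallelogram v w : `|v - w| ^+ 2 <= 2 * (J v - m) + 2 * (J w - m).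
  have := mJ (2^-1 *: (v + w)); rewrite /J normrZ ger0_norm// LZ LD exprMn ip_sqrD ip_sqrB.
  lra.
have cu : cauchy (u @ \oo).
  apply/cauchy_exP => eps e0.
  have e4 : 0 < eps ^+ 2 / 4 by rewrite divr_gt0// exprn_gt0.
  have [N _ hN] := near_infty_natSinv_lt (PosNum e4).
  exists (u N); exists N => // k /= Nk; rewrite -ball_normE /=.
  rewrite -(@ltr_pXn2r _ 2)// ?nnegrE ?normr_ge0 ?ltW//.
  apply: (le_lt_trans (parallelogram _ _)).
  have h1 : N.+1%:R^-1 < eps ^+ 2 / 4 := hN N (leqnn N).
  have h2 : k.+1%:R^-1 < eps ^+ 2 / 4 := hN k Nk.
  move: (uP N) (uP k) h1 h2; move: (J _) (J _) (_^-1) (_^-1) (eps ^+ 2) => a1 a2 a3 a4 a5; lra.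
have uc : u @ \oo --> lim (u @ \oo) by exact: cauchy_cvg.
set l := lim (u @ \oo) in uc.
have Jl : J l <= m.
  apply/ler_addgt0Pr => eps e0.
  have cJ : J (u k) @[k --> \oo] --> J l.
    apply: cvgB; first by apply: cvgM; exact: (cvg_norm uc).
    apply: cvgM; first exact: cvg_cst.
    apply/cvgrPdist_lt => e e0'; have C1 : 0 < `|C| + 1 by rewrite ltr_wpDl.
    near=> k; rewrite -LB.
    apply: (le_lt_trans (LC _)); apply: (@le_lt_trans _ _ ((`|C| + 1) * `|l - u k|)).
      by rewrite ler_wpM2r// (le_trans (ler_norm C))// lerDl.
    rewrite mulrC -ltr_pdivlMr//; near: k; apply: cvgr_dist_lt => //; exact: divr_gt0.
  rewrite -(cvg_lim _ cJ)//; apply: limr_le; first by apply/cvg_ex; exists (J l).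
  near=> k; apply: (le_trans (ltW (uP k))); rewrite lerD2l ltW//.
  by near: k; exact: near_infty_natSinv_lt (PosNum e0).
exists l => w; apply/eqP; rewrite -subr_eq0; set dl := ip l w - L w.
have q t : 0 <= t ^+ 2 * `|w| ^+ 2 + 2 * t * dl.
  have := le_trans Jl (mJ (l + t *: w)).
  rewrite /J ip_sqrD LD LZ normrZ exprMn real_normK ?num_real// (ip_sym hip l) ipZl.
  rewrite (ip_sym hip w) /dl; lra.
(* The quadratic [q] is nonnegative for all [t], which forces [dl = 0]; it is tested near its
   minimum, the summand 1 avoiding a division by 0 when [w = 0]. *)
have w1 : 0 < `|w| ^+ 2 + 1 by rewrite ltr_wpDl ?sqr_ge0.
have := q (- dl / (`|w| ^+ 2 + 1)); move: (`|w| ^+ 2) w1 (sqr_ge0 `|w|) => a a1 a0.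
have -> : (- dl / (a + 1)) ^+ 2 * a + 2 * (- dl / (a + 1)) * dl =
    - (dl ^+ 2 * ((a + 2) / (a + 1) ^+ 2)).
  by field; rewrite lt0r_neq0.
rewrite oppr_ge0 pmulr_lle0 ?divr_gt0 ?exprn_gt0 ?ltr_wpDl// => h.
by rewrite -sqrf_eq0 eq_le h sqr_ge0.
Unshelve. all: by end_near. Qed.

End Hilbert.

(** * Kernel sections *)

Section FeatureIntegrals.
Context {R : realType} {dT : measure_display} {Theta : measurableType dT}.
Context (nu : probability Theta R).

(* Lets the operator norm of the features be used without proving it measurable. *)
Lemma ge0_le_integral_nonmeas (p g : Theta -> \bar R) :
  (forall x, (0 <= p x)%E) -> (forall x, (p x <= g x)%E) ->
  (\int[nu]_x p x <= \int[nu]_x g x)%E.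
Proof.
(* The integral of a nonnegative function is a supremum over the simple functions below it, hence
   monotone whether or not the function is measurable. *)
move=> p0 pg; rewrite !ge0_integralTE//; last by move=> x; exact: le_trans (pg x).
by apply: le_ereal_sup => _ [h /= hp <-]; exists h => // x; exact: le_trans (pg x).
Qed.

(** The left side is the integral of |Psi^T a|^2, whose integrand is at most a multiple of the
    squared operator norm. *)
Lemma quadratic_integral_le (d d1 : nat) (Psi : Theta -> 'M[R]_(d, d1)) (a : 'cV[R]_d)
    (B : R) :
  mx_integrable nu setT (fun th => Psi th *m (Psi th)^T) ->
  (\int[nu]_th (opnorm (Psi th) ^+ 2)%:E <= B%:E)%E ->
  dot (mx_integral nu setT (fun th => Psi th *m (Psi th)^T) *m a) a
    <= d1%:R * (d%:R * `|a|) ^+ 2 * B.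
Proof.
move=> iP PB; set c := _ * _ ^+ 2.
have c0 : 0 <= c by rewrite mulr_ge0// sqr_ge0.
pose q th := dot (Psi th *m (Psi th)^T *m a) a.
pose e i j th := a i ord0 * a j ord0 * (Psi th *m (Psi th)^T) i j.
have ie i j : nu.-integrable setT (EFin \o e i j).
  exact: eq_integrable (integrableZl measurableT (a i ord0 * a j ord0) (iP i j)).
have qE th : q th = \sum_i \sum_j e i j th.
  rewrite /q /dot; apply: eq_bigr => i _; rewrite mxE mulr_suml.
  by apply: eq_bigr => j _; rewrite /e; ring.
have [iq qI] : nu.-integrable setT (EFin \o q) /\
    dot (mx_integral nu setT (fun th => Psi th *m (Psi th)^T) *m a) a = \int[nu]_th q th.
  rewrite (_ : q = fun th => \sum_i \sum_j e i j th); last exact/funext.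
  have hs i := Rintegral_sum (index_enum 'I_d) measurableT (fun j => ie i j).
  have [iS ->] := Rintegral_sum (index_enum 'I_d) measurableT (fun i => (hs i).1).
  split=> //; rewrite /dot; apply: eq_bigr => i _; rewrite (hs i).2 mxE mulr_suml.
  by apply: eq_bigr => j _; rewrite mxE RintegralZl//; [ring|exact: iP].
have q_le th : 0 <= q th <= c * opnorm (Psi th) ^+ 2.
  rewrite /q -mulmxA dot_mulmxl dotvv_ge0/=.
  apply: (le_trans (ler_norm _)); apply: (le_trans (dot_le _ _)).
  have -> : c * opnorm (Psi th) ^+ 2 = d1%:R * (d%:R * `|a| * opnorm (Psi th)) ^+ 2.
    by rewrite /c; ring.
  rewrite -mulrA ler_wpM2l// -expr2 ler_pXn2r ?nnegrE ?mulr_ge0 ?opnorm_ge0//.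
  apply: (le_trans (mulmx_le _ _)); rewrite trmx_norm mulrAC ler_wpM2l ?mulr_ge0//.
  exact: norm_le_opnorm.
rewrite qI; have B0 : 0 <= B.
  by rewrite -lee_fin; apply: le_trans PB; apply: integral_ge0 => th _; rewrite lee_fin sqr_ge0.
(* For [c > 0] the constant is moved to the side of [q], which is known to be integrable; [c = 0]
   forces [q = 0]. *)
have [cE|c_neq0] := eqVneq c 0.
  have -> : \int[nu]_th q th = \int[nu]_(th in setT) (0 : R).
    by apply: eq_Rintegral => th _; have := q_le th; rewrite cE mul0r => /le_anti.
  by rewrite Rintegral_cst// mul0r mulr_ge0.
have {}c0 : 0 < c by rewrite lt_def c_neq0.
rewrite -ler_pdivrMl// -RintegralZl// -lee_fin; apply: le_trans PB.
rewrite /Rintegral fineK; last first.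
  apply: integrable_fin_num => //.
  exact: eq_integrable (integrableZl measurableT c^-1 iq).
apply: ge0_le_integral_nonmeas => th; have /andP[q0 qc] := q_le th.
  by rewrite lee_fin mulr_ge0// invr_ge0 ltW.
by rewrite lee_fin ler_pdivrMl.
Qed.

End FeatureIntegrals.

Section KernelSections.
Context {R : realType} {n d d1 : nat} {H : completeNormedModType R} (ip : H -> H -> R).
Context (ev : {linear H -> ('cV[R]_n -> 'cV[R]_d)}).
Context (K : 'cV[R]_n -> 'cV[R]_n -> 'M[R]_d).
Context {dT : measure_display} {Theta : measurableType dT} (nu : probability Theta R).
Context (Phi : 'cV[R]_n -> Theta -> 'M[R]_(d, d1)).

(** [k x a] is K(., x) a as an element of H. The last clause makes it locally bounded and locally
    Lipschitz in x, uniformly for [a] in the unit ball. *)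
Definition kernel_section_of (k : 'cV[R]_n -> 'cV[R]_d -> H) :=
  [/\ forall x a, ev (k x a) = fun z => K z x *m a,
      forall v x a, ip v (k x a) = dot (ev v x) a &
      forall r, exists2 C : R, 0 <= C & forall x y a, `|x| <= r -> `|y| <= r ->
        `|k x a| <= C * `|a| /\ `|k x a - k y a| <= C * `|x - y| * `|a|].

Lemma poweR_half_le (I : \bar R) (c : R) : (0 <= I)%E -> (I `^ 2^-1 <= c%:E)%E ->
  (I <= (c ^+ 2)%:E)%E.
Proof.
move=> I0 Ic; have c0 : 0 <= c.
  by rewrite -lee_fin; apply: le_trans Ic; exact: poweR_ge0.
case: I I0 Ic => [i| |]//.
- rewrite !lee_fin => i0; rewrite powR12_sqrt// => h.
  by rewrite -(sqr_sqrtr i0) ler_pXn2r// nnegrE sqrtr_ge0.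
- by rewrite poweRyr ?invr_neq0 ?pnatr_eq0// leye_eq.
Qed.

Lemma kernel_section_exists : is_rkhs ip ev K -> feature_representation nu Phi K ->
  second_moment nu Phi -> exists k, kernel_section_of k.
Proof.
move=> rk [mPhi iPhi KE] [mf ml]; have hip := rkhs_ip rk.
have /choice[k' hk'] : forall xa : 'cV[R]_n * 'cV[R]_d, exists v,
    ev v = fun z => K z xa.1 *m xa.2.
  by move=> [x a]; have [v _ <-] := rkhs_section rk x a; exists v.
pose k x a := k' (x, a).
have kE x a : ev (k x a) = fun z => K z x *m a by exact: hk'.
have repr v x a : ip v (k x a) = dot (ev v x) a := rkhs_reproducing rk v (kE x a).
have kk x y a : ip (k x a) (k y a) = dot (K y x *m a) a by rewrite repr kE.
(* The squared distance is the quadratic form at [a] of K(x,x) - K(x,y) - K(y,x) + K(y,y), the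
   second-moment matrix of the feature difference. *)
have kdist x y a B : (\int[nu]_th (opnorm (Phi x th - Phi y th) ^+ 2)%:E <= B%:E)%E ->
    `|k x a - k y a| ^+ 2 <= d1%:R * (d%:R * `|a|) ^+ 2 * B.
  move=> hB; rewrite (ip_sqrB hip) -!(ip_norm hip).
  have E i j th : ((Phi x th - Phi y th) *m (Phi x th - Phi y th)^T) i j =
      (Phi x th *m (Phi x th)^T) i j - (Phi x th *m (Phi y th)^T) i j -
      ((Phi y th *m (Phi x th)^T) i j - (Phi y th *m (Phi y th)^T) i j).
    by rewrite linearB/= mulmxBl !mulmxBr !mxE.
  have i1 i j := integrableB measurableT (iPhi x x i j) (iPhi x y i j).
  have i2 i j := integrableB measurableT (iPhi y x i j) (iPhi y y i j).
  have iD : mx_integrable nu setT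
      (fun th => (Phi x th - Phi y th) *m (Phi x th - Phi y th)^T).
    move=> i j; apply: eq_integrable (integrableB measurableT (i1 i j) (i2 i j)) => //.
    by move=> th _ /=; rewrite E !EFinB.
  apply: le_trans (quadratic_integral_le _ iD hB).
  have -> : mx_integral nu setT
      (fun th => (Phi x th - Phi y th) *m (Phi x th - Phi y th)^T) =
      K x x - K x y - (K y x - K y y).
    apply/matrixP => i j; rewrite !KE !mxE.
    under eq_Rintegral do rewrite E.
    rewrite RintegralB//; first rewrite !RintegralB//; try exact: iPhi.
    - exact: eq_integrable (i1 i j).
    - exact: eq_integrable (i2 i j).
  rewrite !mulmxBl !dotBl -!kk (ip_sym hip (k y a) (k x a)).
  by rewrite le_eqVlt; apply/orP; left; apply/eqP; ring.
have knorm x a B : (\int[nu]_th (opnorm (Phi x th) ^+ 2)%:E <= B%:E)%E ->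
    `|k x a| ^+ 2 <= d1%:R * (d%:R * `|a|) ^+ 2 * B.
  move=> hB; rewrite -(ip_norm hip) kk KE.
  exact: quadratic_integral_le (iPhi x x) hB.
exists k; split=> // r.
pose r' := n%:R * `|r| + 1; have r'0 : 0 < r' by rewrite ltr_wpDl// mulr_ge0.
have l2r (x : 'cV[R]_n) : `|x| <= r -> l2norm x <= r'.
  move=> xr; apply: (le_trans (l2norm_le _)); apply: (@le_trans _ _ (n%:R * `|r|)).
    by apply: ler_wpM2l => //; exact: le_trans xr (ler_norm _).
  by rewrite /r' lerDl.
have [L hL] := ml r' r'0.
pose c : R := d1%:R * d%:R ^+ 2 * (L * n%:R) ^+ 2.
(* Since c <= (c + 1)^2, the constant [c + 1] replaces the square root of [c]. *)
have lip x y a : `|x| <= r -> `|y| <= r ->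
    `|k x a - k y a| <= (c + 1) * `|x - y| * `|a|.
  move=> xr yr; have [->|xy] := eqVneq x y.
    by rewrite !subrr !normr0 mulr0 mul0r.
  have c0 : 0 <= c := mulr_ge0 (mulr_ge0 (ler0n _ _) (sqr_ge0 _)) (sqr_ge0 _).
  have h : `|k x a - k y a| ^+ 2 <= c * (`|x - y| * `|a|) ^+ 2.
    apply: (le_trans (kdist x y a _ (poweR_half_le _ (hL x y (l2r x xr) (l2r y yr) xy)))).
      by apply: integral_ge0 => th _; rewrite lee_fin sqr_ge0.
    have -> : c * (`|x - y| * `|a|) ^+ 2 =
      d1%:R * (d%:R * `|a|) ^+ 2 * (L ^+ 2 * (n%:R * `|x - y|) ^+ 2) by rewrite /c; ring.
    rewrite ler_wpM2l ?mulr_ge0 ?sqr_ge0// exprMn ler_wpM2l ?sqr_ge0//.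
    by rewrite ler_pXn2r ?nnegrE ?l2norm_ge0 ?mulr_ge0// l2norm_le.
  rewrite -(@ler_pXn2r _ 2) ?nnegrE ?mulr_ge0 ?addr_ge0//.
  apply: (le_trans h); rewrite -mulrA (exprMn _ (c + 1)) ler_wpM2r ?sqr_ge0//.
  by nra.
(* The second moment is assumed finite at each point separately; its value at 0 and the Lipschitz
   estimate bound the sections on the whole ball. *)
have mf0 := mf 0; set I0 := (\int[nu]_th _)%E in mf0.
have I00 : (0 <= I0)%E by apply: integral_ge0 => th _; rewrite lee_fin sqr_ge0.
have I0E : I0 = (fine I0)%:E by rewrite fineK// ge0_fin_numE.
pose c2 : R := d1%:R * d%:R ^+ 2 * fine I0.
have fI0 : 0 <= fine I0 by rewrite fine_ge0.
have c20 : 0 <= c2 := mulr_ge0 (mulr_ge0 (ler0n _ _) (sqr_ge0 _)) fI0.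
have k0 a : `|k 0 a| <= (c2 + 1) * `|a|.
  rewrite -(@ler_pXn2r _ 2) ?nnegrE ?mulr_ge0 ?addr_ge0//.
  apply: (le_trans (knorm 0 a (fine I0) _)); first by rewrite -I0E.
  have -> : d1%:R * (d%:R * `|a|) ^+ 2 * fine I0 = c2 * `|a| ^+ 2 by rewrite /c2; ring.
  rewrite exprMn ler_wpM2r ?sqr_ge0//; nra.
have c0 : 0 <= c := mulr_ge0 (mulr_ge0 (ler0n _ _) (sqr_ge0 _)) (sqr_ge0 _).
exists ((c + 1) * (1 + `|r|) + (c2 + 1)).
  by rewrite addr_ge0 ?mulr_ge0 ?addr_ge0.
move=> x y a xr yr; split.
  have r0 : 0 <= r := le_trans (normr_ge0 x) xr.
  have h := lip x 0 a xr; rewrite normr0 subr0 in h.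
  have h1 := ler_distD (k 0 a) (k x a) 0; rewrite !subr0 in h1.
  apply: (le_trans h1); rewrite [X in _ <= X]mulrDl; apply: lerD; last exact: k0.
  apply: (le_trans (h r0)); rewrite ler_wpM2r// ler_wpM2l ?addr_ge0//.
  by apply: (le_trans xr); rewrite (ger0_norm r0) lerDr.
apply: (le_trans (lip x y a xr yr)); rewrite -!mulrA ler_wpM2r ?mulr_ge0//.
by rewrite mulrDr mulr1 -addrA lerDl addr_ge0 ?mulr_ge0 ?addr_ge0.
Qed.

End KernelSections.

(** * Matrix-valued causal operators *)

Definition causal_mx (R : realType) (V : normedModType R) (r b : R) (k l : nat)
    (A : (R -> V) -> R -> 'M[R]_(k, l)) :=
  forall i j, causal_operator r b (fun y t => A y t i j).

Section CausalMatrices.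
Context {R : realType} {V : normedModType R} (r b : R).

Lemma causal_mxD (k l : nat) (A B : (R -> V) -> R -> 'M[R]_(k, l)) :
  causal_mx r b A -> causal_mx r b B -> causal_mx r b (fun y t => A y t + B y t).
Proof.
by move=> hA hB i j; apply: causal_ext (causal_add (hA i j) (hB i j)) => y _ t _; rewrite mxE.
Qed.

Lemma causal_mxB (k l : nat) (A B : (R -> V) -> R -> 'M[R]_(k, l)) :
  causal_mx r b A -> causal_mx r b B -> causal_mx r b (fun y t => A y t - B y t).
Proof.
move=> hA hB i j; apply: causal_ext (causal_add (hA i j) (causal_opp (hB i j))) => y _ t _.
by rewrite !mxE.
Qed.

Lemma causal_mxT (k l : nat) (A : (R -> V) -> R -> 'M[R]_(k, l)) :
  causal_mx r b A -> causal_mx r b (fun y t => (A y t)^T).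
Proof. by move=> hA i j; apply: causal_ext (hA j i) => y _ t _; rewrite mxE. Qed.

Lemma causal_mxM (k l m : nat) (A : (R -> V) -> R -> 'M[R]_(k, l))
    (B : (R -> V) -> R -> 'M[R]_(l, m)) :
  causal_mx r b A -> causal_mx r b B -> causal_mx r b (fun y t => A y t *m B y t).
Proof.
move=> hA hB i j.
apply: causal_ext (causal_sum (index_enum 'I_l) (fun h => causal_mul (hA i h) (hB h j))).
by move=> y _ t _; rewrite mxE.
Qed.

Lemma causal_dot (k : nat) (A B : (R -> V) -> R -> 'cV[R]_k) :
  causal_mx r b A -> causal_mx r b B -> causal_operator r b (fun y t => dot (A y t) (B y t)).
Proof.
by move=> hA hB; apply: causal_sum => i; apply: causal_mul; [exact: hA|exact: hB].
Qed.

Lemma causal_mx_bound (k l : nat) (A : (R -> V) -> R -> 'M[R]_(k, l)) :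
  causal_mx r b A -> exists2 C : R, 0 <= C & forall y, admissible r b y ->
    forall t, 0 <= t <= b -> `|A y t| <= C.
Proof.
move=> hA; have /choice[C hC] : forall ij : 'I_k * 'I_l, exists C : R, 0 <= C /\
    forall y, admissible r b y -> forall t, 0 <= t <= b -> `|A y t ij.1 ij.2| <= C.
  by move=> ij; have [C [C0 _ bC _]] := hA ij.1 ij.2; exists C.
have S0 : 0 <= \sum_ij C ij by apply: sumr_ge0 => ij _; case: (hC ij).
exists (\sum_ij C ij) => // y hy t tb; apply/mx_norm_leP; split=> // i j.
have [_ h] := hC (i, j); apply: (le_trans (h y hy t tb)).
by rewrite (bigD1 (i, j))//= lerDl; apply: sumr_ge0 => ij _; case: (hC ij).
Qed.

End CausalMatrices.

(** * Regularity of the kernel and of the functions in H *)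

Section KernelBounds.
Context {R : realType} {n d s : nat} {H : completeNormedModType R} (ip : H -> H -> R).
Context (ev : {linear H -> ('cV[R]_n -> 'cV[R]_d)}).
Context (K : 'cV[R]_n -> 'cV[R]_n -> 'M[R]_d) (k : 'cV[R]_n -> 'cV[R]_d -> H).
Context (hip : inner_product ip) (hk : kernel_section_of ip ev K k).

Lemma delta_norm (i : 'I_d) : `|delta_mx i ord0 : 'cV[R]_d| <= 1.
Proof.
by apply: cV_norm_le => // j; rewrite mxE; case: (_ && _); rewrite ?normr1 ?normr0.
Qed.

Lemma kernel_entry z x i j : K z x i j = ip (k x (delta_mx j ord0)) (k z (delta_mx i ord0)).
Proof. by case: hk => kE repro _; rewrite repro kE dot_delta -colE mxE. Qed.

(** The arguments are joint states (x, e), of which the kernel sees the first block. An entry is an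
    inner product of two sections and inherits their estimates by Cauchy-Schwarz. *)
Lemma kernel_lipschitz2 i j :
  locally_lipschitz2 (fun v w : 'cV[R]_(n + s) => K (usubmx v) (usubmx w) i j).
Proof.
move=> r'; have [_ _ hC] := hk; have [C C0 {}hC] := hC r'.
exists (C * C) => v w v' w' vr wr vr' wr'.
set ei : 'cV[R]_d := delta_mx i ord0; set ej : 'cV[R]_d := delta_mx j ord0.
have u (p : 'cV[R]_(n + s)) : `|p| <= r' -> `|usubmx p| <= r'.
  exact: le_trans (usubmx_norm _).
have kb p a (q : 'cV[R]_d) : `|p| <= r' -> `|q| <= 1 -> `|a| <= r' ->
    `|k p q| <= C /\ `|k p q - k a q| <= C * `|p - a|.
  move=> pr q1 ar; have [h1 h2] := hC p a q pr ar; split.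
    by apply: (le_trans h1); rewrite ler_piMr.
  by apply: (le_trans h2); rewrite ler_piMr// mulr_ge0.
rewrite !kernel_entry -/ei -/ej.
have [h1 h2] := kb _ _ ej (u _ wr) (delta_norm j) (u _ wr').
have [h3 h4] := kb _ _ ei (u _ vr) (delta_norm i) (u _ vr').
have [h5 _] := kb _ _ ej (u _ wr') (delta_norm j) (u _ wr').
split; first by apply: (le_trans (cauchy_schwarz hip _ _)); exact: ler_pM.
set a1 := k (usubmx w) ej in h1 h2 *; set a2 := k (usubmx w') ej in h2 h5 *.
set b1 := k (usubmx v) ei in h3 h4 *; set b2 := k (usubmx v') ei in h4 *.
have -> : ip a1 b1 - ip a2 b2 = ip a2 (b1 - b2) + ip (a1 - a2) b1.
  by rewrite (ipBl hip) (ipBr hip); ring.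
apply: (le_trans (ler_normD _ _)); rewrite mulrDr; apply: lerD.
  apply: (le_trans (cauchy_schwarz hip _ _)).
  rewrite -mulrA; apply: ler_pM => //; apply: (le_trans h4).
  by rewrite ler_wpM2l// usubmxB usubmx_norm.
apply: (le_trans (cauchy_schwarz hip _ _)).
rewrite mulrAC; apply: ler_pM => //; apply: (le_trans h2).
by rewrite ler_wpM2l// usubmxB usubmx_norm.
Qed.

(** Evaluation of [v] is its inner product with a section, which is locally bounded and Lipschitz in
    the point. *)
Lemma ev_caratheodory b v i : caratheodory b (fun (x : 'cV[R]_n) (_ : R) => ev v x i ord0).
Proof.
split=> [z|r']; first exact: measurable_cst.
have [_ repro hC] := hk; have [C C0 {}hC] := hC r'; exists (C * `|v|) => _ z w _ zr wr.
have E x : ev v x i ord0 = ip v (k x (delta_mx i ord0)) by rewrite repro dot_delta.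
have [h1 h2] := hC z w (delta_mx i ord0) zr wr; have d1 := delta_norm i.
rewrite !E -(ipBr hip); split.
  apply: (le_trans (cauchy_schwarz hip _ _)); rewrite mulrC ler_wpM2r//.
  by apply: (le_trans h1); rewrite ler_piMr.
apply: (le_trans (cauchy_schwarz hip _ _)); rewrite mulrC mulrAC ler_wpM2r//.
by apply: (le_trans h2); rewrite ler_piMr// mulr_ge0.
Qed.

End KernelBounds.

(** * Continuity along trajectories *)

Section JointContinuity.
Context {R : realType}.

Lemma time_interval_pinfty : @time_interval R +oo%E = `[0, +oo[%classic.
Proof.
apply/seteqP; split=> t /=; rewrite in_itv/= andbT; first by case.
by move=> t0; split; rewrite ?ltry.
Qed.

Lemma mx_measurable_sub (k l : nat) (b : R) (F : R -> 'M[R]_(k, l)) :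
  mx_measurable (time_interval +oo%E) F -> mx_measurable `[0, b] F.
Proof.
move=> mF i j; apply: measurable_funS (mF i j).
  by rewrite time_interval_pinfty; exact: measurable_itv.
by move=> t /=; rewrite in_itv/= => /andP[t0 _]; split; rewrite ?ltry.
Qed.

Lemma joint_continuous_on (W V : normedModType R) (b : R) (G : W -> R -> V) (e : R -> W) :
  {within [set p : W * R | 0 <= p.2], continuous (fun p => G p.1 p.2)} ->
  continuous_on b e -> continuous_on b (fun t => G (e t) t).
Proof.
move=> /subspace_continuousP cG ce t tb eps e0; have /andP[t0 _] := tb.
have /cvgrPdist_lt/(_ _ e0) := cG (e t, t) t0.
move=> /nbhs_ballP[dl dl0 hdl].
have [dlt d0 hd] := ce t tb dl dl0.
exists (Num.min dlt dl); first by rewrite lt_min d0.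
move=> u ub; rewrite lt_min => /andP[u1 u2]; rewrite distrC.
apply: (hdl (e u, u)) => /=; last by case/andP: ub.
by split; rewrite -ball_normE /ball_/= distrC//; exact: hd.
Qed.

Lemma entry_continuous_on (m : nat) (b : R) (p : R -> 'cV[R]_m) i :
  continuous_on b p -> continuous_on b (fun t => p t i ord0).
Proof.
move=> cp t tb eps ep; have [dlt d0 hd] := cp t tb eps ep; exists dlt => // u ub ut.
apply: le_lt_trans (hd u ub ut).
by have := mx_entry_le (p u - p t) i ord0; rewrite !mxE.
Qed.

Lemma admissible_sub (V : normedModType R) r b c (y : R -> V) :
  c <= b -> admissible r b y -> admissible r c y.
Proof.
move=> cb [cy yr]; split; first exact: continuous_on_sub cy.
by move=> t /andP[t0 tc]; apply: yr; rewrite t0 (le_trans tc).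
Qed.

(** Brings any continuous trajectory within reach of the causal estimates, the radius being chosen
    after the trajectory. *)
Lemma continuous_on_bounded (V : normedModType R) (b : R) (y : R -> V) : 0 <= b ->
  continuous_on b y -> exists r, admissible r b y.
Proof.
move=> b0 cy; have cn : continuous_on b (fun t => `|y t|).
  move=> t tb eps ep; have [dlt d0 hd] := cy t tb eps ep; exists dlt => // u ub ut.
  by apply: le_lt_trans (hd u ub ut); exact: ler_dist_dist.
have [c _ hc] := EVT_max b0 (continuous_on_within cn).
by exists (`|y c|); split=> // t tb; apply: hc; rewrite in_itv.
Qed.

Lemma cV_continuous_on (m : nat) (b : R) (p : R -> 'cV[R]_m) :
  (forall i, continuous_on b (fun t => p t i ord0)) -> continuous_on b p.
Proof.
move=> cp t tb eps ep.
have ep2 : 0 < eps / 2 by rewrite divr_gt0.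
have /choice[dlt hd] : forall i, exists dlt, 0 < dlt /\ forall u, 0 <= u <= b ->
    `|u - t| < dlt -> `|p u i ord0 - p t i ord0| < eps / 2.
  by move=> i; have [dlt d0 hd] := cp i t tb _ ep2; exists dlt.
exists (\big[Num.min/1]_i dlt i).
  by apply: lt_bigmin => // i _; case: (hd i).
move=> u ub; move=> /bigmin_gtP[_ ut]; apply: (@le_lt_trans _ _ (eps / 2)); last by lra.
apply: cV_norm_le => [|i]; first exact: ltW.
by rewrite !mxE ltW//; case: (hd i) => _; apply => //; exact: ut.
Qed.

End JointContinuity.

(** * The closed loop as a causal map *)

Section ClosedLoopOperators.
Context {R : realType} {n d s : nat} (gamma : R).
Context (f : 'cV[R]_n -> R -> 'cV[R]_n) (g : 'cV[R]_n -> R -> 'M[R]_(n, d))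
  (h : 'cV[R]_n -> 'cV[R]_d)
  (fe : 'cV[R]_s -> R -> 'cV[R]_s) (ge : 'cV[R]_n -> R -> 'M[R]_(s, d)).
Context (x0 : 'cV[R]_n) (e0 : 'cV[R]_s).
Context (gradQ : 'cV[R]_s -> R -> 'cV[R]_s).
Context {H : completeNormedModType R} (ip : H -> H -> R)
  (ev : {linear H -> ('cV[R]_n -> 'cV[R]_d)}).
Context (K : 'cV[R]_n -> 'cV[R]_n -> 'M[R]_d) (k : 'cV[R]_n -> 'cV[R]_d -> H).

Definition x_of (y : R -> 'cV[R]_(n + s)) t : 'cV[R]_n := usubmx (y t).
Definition e_of (y : R -> 'cV[R]_(n + s)) t : 'cV[R]_s := dsubmx (y t).

(** The kernel acts on this vector in the input, and the same vector pairs with the mismatch in the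
    derivative of Q. *)
Definition weight y t : 'cV[R]_d := (ge (x_of y t) t)^T *m gradQ (e_of y t) t.

Definition input y t : 'cV[R]_d :=
  adaptive_control ge gamma K gradQ (x_of y) (e_of y) (x_of y t) t.

Definition velocity_x y t := f (x_of y t) t + g (x_of y t) t *m (input y t - h (x_of y t)).
Definition velocity_e y t := fe (e_of y t) t + ge (x_of y t) t *m (input y t - h (x_of y t)).
Definition velocity y t := col_mx (velocity_x y t) (velocity_e y t).

Context (meas : measurable_in_time f g fe ge) (dyn : dynamics_regularity f g h).
Context (fe_lip : locally_lipschitz (@l2norm R s) (@l2norm R s) fe)
  (ge_lip : locally_lipschitz (@l2norm R n) (@opnorm R s d) ge)
  (fe_bnd : locally_bounded (@l2norm R s) (@l2norm R s) fe)
  (ge_bnd : locally_bounded (@l2norm R n) (@opnorm R s d) ge).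
Context (gradQ_cont : {within [set p : 'cV[R]_s * R | 0 <= p.2],
                        continuous (fun p => gradQ p.1 p.2)})
  (gradQ_bnd : locally_bounded (@l2norm R s) (@l2norm R s) gradQ)
  (gradQ_lip : locally_lipschitz (@l2norm R s) (@l2norm R s) gradQ).
Context (hip : inner_product ip) (hk : kernel_section_of ip ev K k).

Lemma causal_of_x (r b : R) (F : 'cV[R]_n -> R -> R) : caratheodory b F ->
  causal_operator r b (fun y t => F (x_of y t) t).
Proof.
move=> cF; apply: (@causal_caratheodory R _ r b (fun v t => F (usubmx v) t)).
apply: (caratheodory_comp _ _ cF) => [v|v w]; first exact: usubmx_norm.
by rewrite usubmxB usubmx_norm.
Qed.

Lemma causal_of_e (r b : R) (F : 'cV[R]_s -> R -> R) : caratheodory b F ->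
  causal_operator r b (fun y t => F (e_of y t) t).
Proof.
move=> cF; apply: (@causal_caratheodory R _ r b (fun v t => F (dsubmx v) t)).
apply: (caratheodory_comp _ _ cF) => [v|v w]; first exact: dsubmx_norm.
by rewrite dsubmxB dsubmx_norm.
Qed.

Lemma causal_f r b : 0 <= b -> causal_mx r b (fun y t => f (x_of y t) t).
Proof.
case: meas dyn => mf _ _ _ [lf _ _ bf _ _] b0 i j.
apply: (@causal_of_x r b (fun x t => f x t i j)).
apply: regular_caratheodory lf bf _ => //; first exact: norm_le_l2norm.
by move=> x; exact: mx_measurable_sub.
Qed.

Lemma causal_g r b : 0 <= b -> causal_mx r b (fun y t => g (x_of y t) t).
Proof.
case: meas dyn => _ mg _ _ [_ lg _ _ bg _] b0 i j.
apply: (@causal_of_x r b (fun x t => g x t i j)).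
apply: regular_caratheodory lg bg _ => //; first exact: norm_le_opnorm.
by move=> x; exact: mx_measurable_sub.
Qed.

Lemma causal_h r b : 0 <= b -> causal_mx r b (fun y t => h (x_of y t)).
Proof.
case: dyn => _ _ lh _ _ bh b0 i j.
apply: (@causal_of_x r b (fun x t => h x i j)).
apply: (@regular_caratheodory R n d 1 (fun x _ => h x) (@l2norm R d)) => //; first exact: norm_le_l2norm.
by move=> x i' j'; exact: measurable_cst.
Qed.

Lemma causal_fe r b : 0 <= b -> causal_mx r b (fun y t => fe (e_of y t) t).
Proof.
case: meas => _ _ mfe _ b0 i j.
apply: (@causal_of_e r b (fun x t => fe x t i j)).
apply: regular_caratheodory fe_lip fe_bnd _ => //; first exact: norm_le_l2norm.
by move=> x; exact: mx_measurable_sub.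
Qed.

Lemma causal_ge r b : 0 <= b -> causal_mx r b (fun y t => ge (x_of y t) t).
Proof.
case: meas => _ _ _ mge b0 i j.
apply: (@causal_of_x r b (fun x t => ge x t i j)).
apply: regular_caratheodory ge_lip ge_bnd _ => //; first exact: norm_le_opnorm.
by move=> x; exact: mx_measurable_sub.
Qed.

(** [measurable_in_time] does not mention [gradQ]; measurability in [t] comes from joint
    continuity. *)
Lemma causal_gradQ r b : 0 <= b -> causal_mx r b (fun y t => gradQ (e_of y t) t).
Proof.
move=> b0 i j; apply: (@causal_of_e r b (fun x t => gradQ x t i j)).
apply: regular_caratheodory gradQ_lip gradQ_bnd _ => //; first exact: norm_le_l2norm.
move=> e i' j'; rewrite ord1; apply: continuous_on_measurable; apply: entry_continuous_on.
apply: (joint_continuous_on (e := fun=> e) gradQ_cont).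
by move=> t _ eps ep; exists 1 => // u _ _; rewrite subrr normr0.
Qed.

Lemma causal_weight r b : 0 <= b -> causal_mx r b weight.
Proof.
move=> b0; apply: causal_mxM; last exact: causal_gradQ.
by apply: causal_mxT; exact: causal_ge.
Qed.

Lemma control_integrandE y z t i :
  control_integrand ge K gradQ (x_of y) (e_of y) z t i ord0 =
  \sum_j K z (x_of y t) i j * weight y t j ord0.
Proof. by rewrite /control_integrand -mulmxA mxE. Qed.

Lemma kernel_weight_integrable r b y (z : 'cV[R]_n) i j : 0 <= b -> admissible r b y ->
  (@lebesgue_measure R).-integrable `[0, b]
    (EFin \o (fun u => K z (x_of y u) i j * weight y u j ord0)).
Proof.
move=> b0 hy; have lk := kernel_lipschitz2 (s := s) hip hk i j.
(* The kernel on joint states ignores the second block, so [z] is padded with 0. *)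
have := kernel_product_integrable (col_mx z 0) lk (causal_weight r b0 j ord0) hy.
by apply: eq_integrable => // u _ /=; rewrite col_mxKu.
Qed.

Lemma control_integrand_integrable r b y z : 0 <= b -> admissible r b y ->
  mx_integrable (@lebesgue_measure R) `[0, b]
    (control_integrand ge K gradQ (x_of y) (e_of y) z).
Proof.
move=> b0 hy i j; rewrite ord1.
have [hS _] := @Rintegral_sum _ _ R (@lebesgue_measure R) `[0, b]%classic _
  (index_enum 'I_d) (fun j u => K z (x_of y u) i j * weight y u j ord0) (measurable_itv _)
  (fun j => kernel_weight_integrable z i j b0 hy).
by apply: eq_integrable hS => // u _; rewrite /= control_integrandE.
Qed.

Lemma adaptive_controlE y z t i : 0 <= t -> (exists r, admissible r t y) ->
  adaptive_control ge gamma K gradQ (x_of y) (e_of y) z t i ord0 =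
  - gamma * \sum_j \int[@lebesgue_measure R]_(u in `[0, t])
    (K z (x_of y u) i j * weight y u j ord0).
Proof.
move=> t0 [r hy]; rewrite !mxE; congr (_ * _).
have [_ <-] := @Rintegral_sum _ _ R (@lebesgue_measure R) `[0, t]%classic _
  (index_enum 'I_d) (fun j u => K z (x_of y u) i j * weight y u j ord0) (measurable_itv _)
  (fun j => kernel_weight_integrable z i j t0 hy).
by apply: eq_Rintegral => u _; rewrite control_integrandE.
Qed.

Lemma causal_input r b : 0 <= b -> causal_mx r b input.
Proof.
move=> b0 i j; rewrite ord1.
pose Phi j (y : R -> 'cV[R]_(n + s)) t := \int[@lebesgue_measure R]_(u in `[0, t])
    (K (x_of y t) (x_of y u) i j * weight y u j ord0).
have cPhi j' : causal_operator r b (Phi j').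
  exact: (causal_integral (kernel_lipschitz2 (s := s) hip hk i j')
           (causal_weight r b0 j' ord0)).
have := causal_mul (causal_cst r b (- gamma)) (causal_sum (index_enum 'I_d) cPhi).
apply: causal_ext => y hy t /andP[t0 tb].
by rewrite /input adaptive_controlE//; exists r; exact: admissible_sub hy.
Qed.

Lemma causal_mismatch r b : 0 <= b -> causal_mx r b (fun y t => input y t - h (x_of y t)).
Proof. by move=> b0; apply: causal_mxB; [exact: causal_input|exact: causal_h]. Qed.

Lemma causal_velocity_x r b : 0 <= b -> causal_mx r b velocity_x.
Proof.
move=> b0; apply: causal_mxD; first exact: causal_f.
by apply: causal_mxM; [exact: causal_g|exact: causal_mismatch].
Qed.

Lemma causal_velocity_e r b : 0 <= b -> causal_mx r b velocity_e.
Proof.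
move=> b0; apply: causal_mxD; first exact: causal_fe.
by apply: causal_mxM; [exact: causal_ge|exact: causal_mismatch].
Qed.

Lemma causal_velocity r b : 0 <= b -> causal_map r b velocity.
Proof.
move=> b0; apply: causal_mapP => i; case: (split_ordP i) => j ->.
  apply: causal_ext (causal_velocity_x r b0 j ord0) => y _ t _.
  by rewrite /velocity col_mxEu.
apply: causal_ext (causal_velocity_e r b0 j ord0) => y _ t _.
by rewrite /velocity col_mxEd.
Qed.

Lemma solution_of_velocity (T : \bar R) y :
  (forall t, time_interval T t ->
     continuous_on t y /\ y t = picard velocity (col_mx x0 e0) y t) ->
  closed_loop_solution f g h fe ge gamma K gradQ x0 e0 T (x_of y) (e_of y).
Proof.
move=> hy; split=> [z t hT|Fx Fe t hT]; have [cy yE] := hy t hT; case: (hT) => t0 _.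
  have [r ar] := continuous_on_bounded t0 cy; exact: control_integrand_integrable ar.
have [r ar] := continuous_on_bounded t0 cy; split.
- by move=> i j; apply: causal_integrable (causal_velocity_x r t0 i j) ar.
- by move=> i j; apply: causal_integrable (causal_velocity_e r t0 i j) ar.
- rewrite /x_of [in LHS]yE /picard; apply/matrixP => i j; rewrite !mxE.
  rewrite (unsplitK (inl i)); congr (_ + _); apply: eq_Rintegral => u _.
  by rewrite ord1 /velocity col_mxEu.
- rewrite /e_of [in LHS]yE /picard; apply/matrixP => i j; rewrite !mxE.
  rewrite (unsplitK (inr i)); congr (_ + _); apply: eq_Rintegral => u _.
  by rewrite ord1 /velocity col_mxEd.
Qed.

(** [solution] does not ask for continuity; it follows from the integral form of the equations. *)
Lemma velocity_of_solution (T : \bar R) x e :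
  closed_loop_solution f g h fe ge gamma K gradQ x0 e0 T x e ->
  let y t := col_mx (x t) (e t) in
  [/\ x_of y = x, e_of y = e & forall t, time_interval T t -> continuous_on t y].
Proof.
move=> [_ sol] y.
have xE : x_of y = x by apply/funext => t; rewrite /x_of col_mxKu.
have eE : e_of y = e by apply/funext => t; rewrite /e_of col_mxKd.
split=> // t [t0 tT]; apply: cV_continuous_on => i.
have sub u : 0 <= u <= t -> time_interval T u.
  by move=> /andP[u0 ut]; split=> //; apply: le_lt_trans tT; rewrite lee_fin.
have [ix ie _ _] := sol t (conj t0 tT).
have addc (c : R) (p : R -> R) : continuous_on t p -> continuous_on t (fun u => c + p u).
  move=> cp v vt eps ep; have [dlt d0 hd] := cp v vt eps ep; exists dlt => // u ut uv.
  by rewrite opprD addrACA subrr add0r; exact: hd.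
case: (split_ordP i) => j ->.
  apply: continuous_on_ext (addc (x0 j ord0) _ (indefinite_continuous (ix j ord0))) => u ut.
  by rewrite /y col_mxEu; have [_ _ -> _] := sol u (sub u ut); rewrite !mxE.
apply: continuous_on_ext (addc (e0 j ord0) _ (indefinite_continuous (ie j ord0))) => u ut.
by rewrite /y col_mxEd; have [_ _ _ ->] := sol u (sub u ut); rewrite !mxE.
Qed.

End ClosedLoopOperators.

(** * Energy balance *)

(** phi(s) = o(|s - t|) relative to [0, b]; for phi(s) = W(s) - W(t) it says that W has derivative
    zero at t. *)
Definition flat_at (R : realType) (b t : R) (phi : R -> R) :=
  forall eps, 0 < eps -> exists2 dlt, 0 < dlt &
    forall s, 0 <= s <= b -> `|s - t| < dlt -> `|phi s| <= eps * `|s - t|.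

Section Flat.
Context {R : realType} (b t : R).
Notation mu := (@lebesgue_measure R).

Lemma flatD phi psi : flat_at b t phi -> flat_at b t psi ->
  flat_at b t (fun s => phi s + psi s).
Proof.
move=> h1 h2 eps e0; have e2 : 0 < eps / 2 by rewrite divr_gt0.
have [d1 d10 {}h1] := h1 _ e2; have [d2 d20 {}h2] := h2 _ e2.
exists (Num.min d1 d2); first by rewrite lt_min d10.
move=> s sb; rewrite lt_min => /andP[s1 s2]; apply: (le_trans (ler_normD _ _)).
have -> : eps * `|s - t| = eps / 2 * `|s - t| + eps / 2 * `|s - t| by field.
by rewrite lerD ?h1 ?h2.
Qed.

Lemma flatZ c phi : flat_at b t phi -> flat_at b t (fun s => c * phi s).
Proof.
move=> h eps e0; have c1 : 0 < `|c| + 1 by rewrite ltr_wpDl.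
have [dlt d0 {}h] := h _ (divr_gt0 e0 c1); exists dlt => // s sb st.
rewrite normrM; apply: (@le_trans _ _ ((`|c| + 1) * (eps / (`|c| + 1) * `|s - t|))).
  by apply: ler_pM => //; [rewrite lerDl|exact: h].
by rewrite mulrA (mulrC _ (eps / _)) divfK// lt0r_neq0.
Qed.

Lemma flat_quadratic C phi :
  (forall s, 0 <= s <= b -> `|phi s| <= C * `|s - t| ^+ 2) -> flat_at b t phi.
Proof.
move=> h eps e0; have C1 : 0 < `|C| + 1 by rewrite ltr_wpDl.
exists (eps / (`|C| + 1)); first exact: divr_gt0.
move=> s sb; rewrite ltr_pdivlMr// => st; apply: (le_trans (h s sb)).
rewrite expr2 mulrA ler_wpM2r// mulrC.
apply: le_trans (ltW st); rewrite ler_wpM2l// (le_trans (ler_norm C))// lerDl//.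
Qed.

(** The fundamental theorem at a single point: continuity of [p] at [t] with value 0 is enough, [p]
    being merely integrable elsewhere. *)
Lemma flat_integral p : mu.-integrable `[0, b] (EFin \o p) -> 0 <= t <= b ->
  (forall eps, 0 < eps -> exists2 dlt, 0 < dlt &
     forall u, 0 <= u <= b -> `|u - t| < dlt -> `|p u| <= eps) ->
  flat_at b t (fun s => \int[mu]_(u in `[0, s]) p u - \int[mu]_(u in `[0, t]) p u).
Proof.
move=> ip tb hp eps e0; have [dlt d0 {}hp] := hp eps e0; exists dlt => // s sb st.
apply: (indefinite_lipschitz ip) => // u /andP[h1 h2].
have /andP[t0 tb'] := tb; have /andP[s0 sb'] := sb.
have st' : `|u - t| <= `|s - t|.
  have := ler_norm (s - t); have := ler_norm (t - s); rewrite distrC ler_norml.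
  by move: h1 h2; rewrite ge_min le_max => /orP[h1|h1] /orP[h2|h2] *; apply/andP; split; lra.
apply: hp; last exact: le_lt_trans st.
by move: h1 h2; rewrite ge_min le_max => /orP[h1|h1] /orP[h2|h2]; apply/andP; split; lra.
Qed.

End Flat.

Lemma dot_integral (R : realType) (s : nat) (b : R) (p : R -> 'cV[R]_s) (w : 'cV[R]_s) :
  mx_integrable (@lebesgue_measure R) `[0, b] p ->
  (@lebesgue_measure R).-integrable `[0, b] (EFin \o (fun u => dot w (p u))) /\
  dot w (mx_integral (@lebesgue_measure R) `[0, b] p) = \int[@lebesgue_measure R]_(u in `[0, b]) dot w (p u).
Proof.
move=> ip0.
have ij i : (@lebesgue_measure R).-integrable `[0, b] (EFin \o (fun u => w i ord0 * p u i ord0)).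
  exact: eq_integrable (integrableZl _ (w i ord0) (ip0 i ord0)).
have [h1 h2] := @Rintegral_sum _ _ R (@lebesgue_measure R) `[0, b]%classic _ (index_enum 'I_s) _
  (measurable_itv _) ij.
split=> //; rewrite /dot h2; apply: eq_bigr => i _; rewrite mxE RintegralZl//.
exact: ip0.
Qed.

(* G, v and qt are the gradient of Q, the velocity of e and the time derivative
   of Q along the trajectory; D is the input mismatch in the Hilbert space, and
   m z tau is the pairing of z(x(tau)) with the weight that drives D. *)
Lemma energy_balance (R : realType) (s : nat) (H : completeNormedModType R)
    (ip : H -> H -> R) (gamma b C : R) (e0 : 'cV[R]_s) (e G v : R -> 'cV[R]_s)
    (Qt qt : R -> R) (D : R -> H) (m : H -> R -> R) :
  inner_product ip -> 0 < gamma -> 0 <= b -> 0 <= C ->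
  mx_integrable (@lebesgue_measure R) `[0, b] v -> (forall t, 0 <= t <= b -> `|v t| <= C) ->
  (forall t, 0 <= t <= b -> e t = e0 + mx_integral (@lebesgue_measure R) `[0, t] v) ->
  continuous_on b G -> (@lebesgue_measure R).-integrable `[0, b] (EFin \o (fun u => dot (G u) (v u))) ->
  continuous_on b qt -> (@lebesgue_measure R).-integrable `[0, b] (EFin \o qt) ->
  (forall t, 0 <= t <= b -> forall eps, 0 < eps -> exists2 dlt, 0 < dlt &
     forall u, 0 <= u <= b -> `|u - t| < dlt ->
       `|Qt u - Qt t - (dot (G t) (e u - e t) + qt t * (u - t))|
         <= eps * (l2norm (e u - e t) + `|u - t|)) ->
  (forall z t, 0 <= t <= b -> ip (D t - D 0) z = - gamma * \int[@lebesgue_measure R]_(u in `[0, t]) m z u) ->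
  (forall z, (@lebesgue_measure R).-integrable `[0, b] (EFin \o m z)) ->
  (forall z t, 0 <= t <= b -> `|m z t| <= C * `|z|) ->
  (forall z z' t, m (z - z') t = m z t - m z' t) ->
  (@lebesgue_measure R).-integrable `[0, b] (EFin \o (fun u => m (D u) u)) ->
  Qt b + `|D b| ^+ 2 / (2 * gamma) = Qt 0 + `|D 0| ^+ 2 / (2 * gamma) +
    \int[@lebesgue_measure R]_(u in `[0, b]) (dot (G u) (v u) + qt u - m (D u) u).
Proof.
move=> hip g0 b0 C0 iv vC eE cG iGv cq iq hQ DE im mC mB imD.
have eL u t : 0 <= u <= b -> 0 <= t <= b -> `|e u - e t| <= C * `|u - t|.
  move=> ub tb; rewrite !eE// opprD addrACA subrr add0r.
  exact: (mx_indefinite_lipschitz iv C0 tb ub vC).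
(* Testing the weak equation for [D] against the increment [D u - D t] itself and dividing by its
   norm gives a Lipschitz bound. *)
have DL u t : 0 <= u <= b -> 0 <= t <= b -> `|D u - D t| <= gamma * C * `|u - t|.
  move=> ub tb; set z := D u - D t.
  have h : `|z| ^+ 2 <= gamma * C * `|u - t| * `|z|.
    have -> : `|z| ^+ 2 =
        - gamma * (\int[@lebesgue_measure R]_(u0 in `[0, u]) m z u0 - \int[@lebesgue_measure R]_(u0 in `[0, t]) m z u0).
      rewrite -(ip_norm hip) {1}/z -(subrKA (D 0)) -(opprB (D t)) (ipBl hip) !DE//; ring.
    apply: (le_trans (ler_norm _)); rewrite normrM normrN (gtr0_norm g0) -!mulrA ler_pM2l//.
    rewrite (mulrC `|u - t|) mulrA.
    apply: (indefinite_lipschitz (im z)) => // u0 /andP[h1 h2]; apply: mC.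
    move: ub tb h1 h2 => /andP[? ?] /andP[? ?]; rewrite ge_min le_max.
    by move=> /orP[h1|h1] /orP[h2|h2]; apply/andP; split; lra.
  have [z0|z0] := eqVneq `|z| 0; first by rewrite z0 !mulr_ge0// ltW.
  have zp : 0 < `|z| by rewrite lt_def z0 normr_ge0.
  by move: h; rewrite expr2 ler_pM2r.
pose I p t := \int[@lebesgue_measure R]_(u in `[0, t]) p u.
pose q u := dot (G u) (v u) + qt u - m (D u) u.
pose W t := Qt t + `|D t| ^+ 2 / (2 * gamma) - I q t.
have iGvq : (@lebesgue_measure R).-integrable `[0, b] (EFin \o (fun u => dot (G u) (v u) + qt u)).
  exact: eq_integrable (integrableD _ iGv iq).
have Isub p t : 0 <= t <= b -> (@lebesgue_measure R).-integrable `[0, b] (EFin \o p) ->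
    (@lebesgue_measure R).-integrable `[0, t] (EFin \o p).
  by move=> /andP[_ tb]; exact: integrable_sub.
have Iq t : 0 <= t <= b -> I q t =
    I (fun u => dot (G u) (v u)) t + I qt t - I (fun u => m (D u) u) t.
  move=> tb; rewrite /I RintegralB//; last 2 first.
  - exact: Isub iGvq.
  - exact: Isub imD.
  by rewrite RintegralD//; [exact: Isub iGv|exact: Isub iq].
suff : W b = W 0.
  rewrite /W [I q 0]/I indefinite0 subr0 => h.
  by rewrite -h /I /q; ring.
apply: zero_derivative_const => // t tb.
suff fl : flat_at b t (fun u => W u - W t).
  by move=> eps ep; exact: fl.
(* The errors made by freezing [G], [qt] and [D] at time [t]. They tend to 0 at [t] although [v] is
   only bounded and measurable. *)
pose p1 u := dot (G u) (v u) - dot (G t) (v u).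
pose p2 u := qt u - qt t.
pose p3 u := m (D u) u - m (D t) u.
have iGt : (@lebesgue_measure R).-integrable `[0, b] (EFin \o (fun u => dot (G t) (v u))).
  by have [] := dot_integral (G t) iv.
have ict : (@lebesgue_measure R).-integrable `[0, b] (EFin \o (fun=> qt t)).
  apply: (@bounded_itv_integrable _ _ _ `|qt t|) => //.
have i1 : (@lebesgue_measure R).-integrable `[0, b] (EFin \o p1).
  exact: eq_integrable (integrableB _ iGv iGt).
have i2 : (@lebesgue_measure R).-integrable `[0, b] (EFin \o p2).
  exact: eq_integrable (integrableB _ iq ict).
have i3 : (@lebesgue_measure R).-integrable `[0, b] (EFin \o p3).
  exact: eq_integrable (integrableB _ imD (im (D t))).
have I1 u : 0 <= u <= b -> I p1 u = I (fun u => dot (G u) (v u)) u - dot (G t) (e u - e0).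
  move=> ub; rewrite /I RintegralB//; [|exact: Isub iGv|exact: Isub iGt].
  rewrite eE// (addrC e0) addrK; congr (_ - _); have /andP[_ ub'] := ub.
  have ivu : mx_integrable (@lebesgue_measure R) `[0, u] v by move=> i j; exact: Isub (iv i j).
  by have [_ ->] := dot_integral (G t) ivu.
have I2 u : 0 <= u <= b -> I p2 u = I qt u - qt t * u.
  move=> ub; rewrite /I RintegralB//; [|exact: Isub iq|exact: Isub ict].
  rewrite Rintegral_cst//= lebesgue_measure_itv/= lte_fin.
  have /andP[u0 _] := ub; move: u0; rewrite le_eqVlt => /predU1P[<-|->/=].
    by rewrite ltxx/= !mulr0.
  by rewrite subr0.
have I3 u : 0 <= u <= b -> I p3 u = I (fun u => m (D u) u) u - I (m (D t)) u.
  by move=> ub; rewrite /I RintegralB//; [exact: Isub imD|exact: Isub (im (D t))].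
pose r0 u := Qt u - Qt t - (dot (G t) (e u - e t) + qt t * (u - t)).
have WE u : 0 <= u <= b -> W u - W t =
    r0 u + ((-1) * (I p1 u - I p1 t) + ((-1) * (I p2 u - I p2 t) +
      ((I p3 u - I p3 t) + (2 * gamma)^-1 * `|D u - D t| ^+ 2))).
  move=> ub; rewrite /W (Iq u)// (Iq t)// (I1 u)// (I1 t)// (I2 u)// (I2 t)// (I3 u)// (I3 t)//.
  (* The increment of [D] is paired with the fixed vector [D t], so the weak equation applies; the
     remaining square is quadratically small by [DL]. *)
  have Dsq : `|D u| ^+ 2 = `|D t| ^+ 2 + `|D u - D t| ^+ 2
      - 2 * gamma * (I (m (D t)) u - I (m (D t)) t).
    have E : ip (D u - D t) (D t) = - gamma * (I (m (D t)) u - I (m (D t)) t).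
      by rewrite -(subrKA (D 0)) -(opprB (D t)) (ipBl hip) !DE// /I; ring.
    have -> : D u = (D u - D t) + D t by rewrite subrK.
    rewrite (ip_sqrD hip) E addrK; ring.
  rewrite Dsq /r0 !dotBr; field; exact: lt0r_neq0.
have fW : flat_at b t (fun u => r0 u + ((-1) * (I p1 u - I p1 t) + ((-1) * (I p2 u - I p2 t) +
      ((I p3 u - I p3 t) + (2 * gamma)^-1 * `|D u - D t| ^+ 2)))).
  apply: flatD.
    move=> eps ep; pose c := s%:R * C + 1; have c0 : 0 < c by rewrite ltr_wpDl// mulr_ge0.
    have [dlt d0 hd] := hQ t tb _ (divr_gt0 ep c0); exists dlt => // u ub ut.
    apply: (le_trans (hd u ub ut)); rewrite -mulrA ler_pM2l// mulrC ler_pdivrMr// mulrC.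
    rewrite /c mulrDl mul1r lerD2r; apply: (le_trans (l2norm_le _)).
    by rewrite -mulrA ler_wpM2l// eL.
  apply: flatD; first apply: flatZ; first apply: flat_integral => //.
    move=> eps ep; have c0 : 0 < s%:R * C + 1 by rewrite ltr_wpDl// mulr_ge0.
    have [dlt d0 hd] := cG t tb _ (divr_gt0 ep c0); exists dlt => // u ub ut.
    rewrite /p1 -dotBl; apply: (le_trans (dot_le _ _)).
    have h1 := ltW (hd u ub ut); rewrite ler_pdivlMr// in h1; apply: le_trans h1.
    rewrite mulrAC mulrC ler_wpM2l//; apply: (@le_trans _ _ (s%:R * C)); last by rewrite lerDl.
    by rewrite ler_wpM2l// vC.
  apply: flatD; first apply: flatZ; first apply: flat_integral => //.
    move=> eps ep; have [dlt d0 hd] := cq t tb _ ep; exists dlt => // u ub ut.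
    exact: ltW (hd u ub ut).
  apply: flatD; first apply: flat_integral => //.
    move=> eps ep; have c0 : 0 < C * (gamma * C) + 1 by rewrite ltr_wpDl// !mulr_ge0// ltW.
    exists (eps / (C * (gamma * C) + 1)); first exact: divr_gt0.
    move=> u ub; rewrite ltr_pdivlMr// => ut; rewrite /p3 -mB.
    apply: (le_trans (mC _ u ub)).
    apply: (@le_trans _ _ (C * (gamma * C * `|u - t|))); first by rewrite ler_wpM2l// DL.
    by apply: le_trans (ltW ut); rewrite mulrA mulrC ler_wpM2l// lerDl.
  apply: (@flat_quadratic _ _ _ ((2 * gamma)^-1 * (gamma * C) ^+ 2)) => u ub.
  have g2 : 0 <= (2 * gamma)^-1 by rewrite invr_ge0 mulr_ge0// ltW.
  rewrite normrM (ger0_norm g2) -mulrA ler_wpM2l// ger0_norm ?sqr_ge0// -exprMn.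
  by rewrite ler_pXn2r ?nnegrE ?mulr_ge0 ?DL// ltW.
move=> eps ep; have [dlt d0 hd] := fW eps ep; exists dlt => // u ub ut.
by rewrite WE//; exact: hd.
Qed.

(** * Stability *)

Section ClassK.
Context {R : realType}.

Lemma class_Kinf_ge0 (r : R -> R) a : class_Kinf r -> 0 <= a -> 0 <= r a.
Proof.
move=> [r0 _ rinc _]; rewrite le_eqVlt => /predU1P[<-|a0]; first by rewrite r0.
by rewrite -r0 ltW// rinc.
Qed.

Lemma class_Kinf_gt0 (r : R -> R) a : class_Kinf r -> 0 < a -> 0 < r a.
Proof. by move=> [r0 _ rinc _] a0; rewrite -r0 rinc. Qed.

Lemma class_Kinf_le (r : R -> R) a b : class_Kinf r -> 0 <= a -> a <= b -> r a <= r b.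
Proof.
by move=> [_ _ rinc _] a0; rewrite le_eqVlt => /predU1P[->//|ab]; rewrite ltW// rinc.
Qed.

(** Applied to [mu1], it turns a bound on the stored energy into a bound on the error. *)
Lemma class_Kinf_bounded (r : R -> R) (C : R) : class_Kinf r ->
  exists A, forall a, r a <= C -> a <= A.
Proof.
move=> [_ _ _ /cvgryPgt/(_ C)[A [_ hA]]]; exists A => a; apply: contraTT.
by rewrite -!ltNge => /hA.
Qed.

Lemma time_interval_sub (T : \bar R) t u : time_interval T t -> 0 <= u <= t -> time_interval T u.
Proof. by move=> [t0 tT] /andP[u0 ut]; split=> //; apply: le_lt_trans tT; rewrite lee_fin. Qed.

End ClassK.

(** * Lyapunov analysis of the closed loop *)

Section ClosedLoopStability.
Context {R : realType} {n d s : nat} (gamma : R).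
Context (f : 'cV[R]_n -> R -> 'cV[R]_n) (g : 'cV[R]_n -> R -> 'M[R]_(n, d))
  (h : 'cV[R]_n -> 'cV[R]_d)
  (fe : 'cV[R]_s -> R -> 'cV[R]_s) (ge : 'cV[R]_n -> R -> 'M[R]_(s, d)).
Context (x0 : 'cV[R]_n) (e0 : 'cV[R]_s) (xd : R -> 'cV[R]_n).
Context (Q : 'cV[R]_s -> R -> R) (gradQ : 'cV[R]_s -> R -> 'cV[R]_s)
  (dtQ : 'cV[R]_s -> R -> R) (rho mu1 mu2 : R -> R).
Context {H : completeNormedModType R} (ip : H -> H -> R)
  (ev : {linear H -> ('cV[R]_n -> 'cV[R]_d)}) (hH : H).
Context (K : 'cV[R]_n -> 'cV[R]_n -> 'M[R]_d) (k : 'cV[R]_n -> 'cV[R]_d -> H).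
Context (gamma_gt0 : 0 < gamma).
Context (meas : measurable_in_time f g fe ge)
  (xd_bounded : bounded_signal (time_interval +oo%E) xd)
  (dyn : dynamics_regularity f g h)
  (err : error_regularity fe ge xd
           (closed_loop_solution f g h fe ge gamma K gradQ x0 e0))
  (lyap : lyapunov_stability fe Q gradQ dtQ rho mu1 mu2).
Context (hip : inner_product ip) (hk : kernel_section_of ip ev K k) (hHE : ev hH = h).

(** The function V, with [D t] standing for the mismatch u(., t) - h in H. *)
Definition stored_energy (e : R -> 'cV[R]_s) (D : R -> H) (t : R) : R :=
  Q (e t) t + `|D t| ^+ 2 / (2 * gamma).

Definition dissipation (e : R -> 'cV[R]_s) (t : R) : R :=
  dot (gradQ (e t) t) (fe (e t) t) + dtQ (e t) t.

Lemma Q_expansion (b C : R) (e : R -> 'cV[R]_s) :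
  (forall t u, 0 <= t <= b -> 0 <= u <= b -> `|e u - e t| <= C * `|u - t|) ->
  forall t, 0 <= t <= b -> forall eps, 0 < eps -> exists2 dlt, 0 < dlt &
     forall u, 0 <= u <= b -> `|u - t| < dlt ->
       `|Q (e u) u - Q (e t) t - (dot (gradQ (e t) t) (e u - e t) + dtQ (e t) t * (u - t))|
         <= eps * (l2norm (e u - e t) + `|u - t|).
Proof.
move=> eC t tb eps ep; have [dQ _ _] := lyap_C1 lyap; have /andP[t0 _] := tb.
have /nbhs_ballP[dl dl0 hdl] := dQ (e t) t t0 eps ep.
have ce : continuous_on b e.
  by apply: (@lipschitz_continuous_on _ _ _ C) => u v ub vb; exact: eC.
have [dlt d0 hd] := ce t tb dl dl0.
exists (Num.min dlt dl); first by rewrite lt_min d0.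
move=> u ub; rewrite lt_min => /andP[u1 u2].
apply: (hdl (e u, u)) => /=; last by case/andP: ub.
by split; rewrite -ball_normE /ball_/= distrC//; exact: hd.
Qed.

(** Holds on any [0, T), because it must be available before the solution is known to be global. *)
Lemma closed_loop_energy (T : \bar R) x e :
  closed_loop_solution f g h fe ge gamma K gradQ x0 e0 T x e ->
  exists D : R -> H, [/\
    (forall t, time_interval T t ->
       ev (D t + hH) = (adaptive_control ge gamma K gradQ x e)^~ t),
    (forall b, time_interval T b ->
       (@lebesgue_measure R).-integrable `[0, b] (EFin \o dissipation e)) &
    (forall b, time_interval T b -> stored_energy e D b = stored_energy e D 0 +
       \int[@lebesgue_measure R]_(u in `[0, b]) dissipation e u)].
Proof.
move=> sol; have [xE eE cy] := velocity_of_solution sol.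
set y := fun t => col_mx (x t) (e t) in xE eE cy.
have [lf lg bf bg] : [/\ locally_lipschitz (@l2norm R s) (@l2norm R s) fe,
    locally_lipschitz (@l2norm R n) (@opnorm R s d) ge,
    locally_bounded (@l2norm R s) (@l2norm R s) fe &
    locally_bounded (@l2norm R n) (@opnorm R s d) ge] by case: err.
have [_ cG cdtQ] := lyap_C1 lyap.
have bG := lyap_gradQ_bounded lyap; have lG := lyap_gradQ_lipschitz lyap.
have cw r b (b0 : 0 <= b) := causal_weight meas lg bg cG bG lG r b0.
pose w t := weight ge gradQ y t.
pose m z t := dot (ev z (x t)) (w t).
have mD a z z' t : m (a *: z + z') t = a * m z t + m z' t.
  by rewrite /m linearP/= dotDl dotZl.
have adm b : time_interval T b -> exists r, admissible r b y.
  by move=> hb; apply: continuous_on_bounded (cy b hb); case: hb.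
have [kE repro kb] := hk.
have mC b : time_interval T b -> exists2 C, 0 <= C &
    forall z t, 0 <= t <= b -> `|m z t| <= C * `|z|.
  move=> hb; have [r hr] := adm b hb; case: (hb) => b0 _.
  have [C C0 hC] := kb r; have [C' C'0 hC'] := causal_mx_bound (cw r b b0).
  exists (C * C') => [|z t tb]; first exact: mulr_ge0.
  rewrite /m -repro; apply: (le_trans (cauchy_schwarz hip _ _)); rewrite mulrC ler_wpM2r//.
  have xr : `|x t| <= r.
    by rewrite -xE; apply: le_trans (usubmx_norm _) _; case: hr => _; exact.
  have [h1 _] := hC (x t) (x t) (w t) xr xr.
  by apply: (le_trans h1); rewrite ler_wpM2l//; exact: hC'.
have im b z : time_interval T b -> (@lebesgue_measure R).-integrable `[0, b] (EFin \o m z).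
  move=> hb; have [r hr] := adm b hb; case: (hb) => b0 _.
  have cev : causal_mx r b (fun (y : R -> 'cV[R]_(n + s)) t => ev z (x_of y t)).
    by move=> i j; rewrite ord1; apply: (@causal_of_x R n s r b (fun x _ => ev z x i ord0));
      exact: ev_caratheodory hip hk _ _ _.
  have := causal_integrable (causal_dot cev (cw r b b0)) hr.
  by rewrite xE.
(* [U t] is the input as an element of H, defined weakly by its inner products; outside the time
   interval its value is arbitrary. *)
have /choice[U hU] : forall t, exists u, time_interval T t -> forall z,
    ip u z = - gamma * \int[@lebesgue_measure R]_(u in `[0, t]) m z u.
  move=> t; have [ht|] := pselect (time_interval T t); last by exists 0.
  have [C C0 hC] := mC t ht; case: (ht) => t0 _.
  have [u hu] : exists u, forall z,
      ip u z = - gamma * \int[@lebesgue_measure R]_(u in `[0, t]) m z u.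
    apply: (riesz_representation hip (C := gamma * (C * t))) => [a z z'|z].
      have iaz : (@lebesgue_measure R).-integrable `[0, t] (EFin \o (fun u => a * m z u)).
        by apply: eq_integrable (integrableZl _ a (im t z ht)).
      under eq_Rintegral do rewrite mD.
      by rewrite RintegralD ?RintegralZl//; [ring|exact: im..].
    rewrite normrM normrN (gtr0_norm gamma_gt0) -mulrA ler_wpM2l ?(ltW gamma_gt0)//.
    rewrite mulrAC; apply: (indefinite_bound (im t z ht)); first by rewrite t0 lexx.
    by move=> u ut; exact: hC.
  by exists u.
(* Testing [U t] against a section at [z] evaluates it at [z]; symmetry of the inner product then
   exchanges [z] and [x u] in the kernel. *)
have evU t : time_interval T t -> ev (U t) = (adaptive_control ge gamma K gradQ x e)^~ t.
  move=> ht; apply/funext => z; apply/matrixP => i j; rewrite ord1; case: (ht) => t0 _.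
  rewrite -(dot_delta (ev (U t) z) i) -repro hU// !mxE; congr (_ * _).
  apply: eq_Rintegral => u _; rewrite -(dot_delta (control_integrand _ _ _ _ _ _ _) i).
  have wE : w u = (ge (x u) u)^T *m gradQ (e u) u by rewrite /w /weight xE eE.
  rewrite /control_integrand -mulmxA -wE /m.
  have -> : K z (x u) *m w u = ev (k (x u) (w u)) z by rewrite kE.
  by rewrite -!repro (ip_sym hip).
pose D t := U t - hH.
have mis t : time_interval T t ->
    ev (D t) (x t) = adaptive_control ge gamma K gradQ x e (x t) t - h (x t).
  by move=> ht; rewrite /D linearB /= evU// hHE.
(* The cancellation: by transposition the mismatch contributes <u - h, w> to the derivative of Q,
   which is [m (D u) u]. *)
have disE b u : time_interval T b -> 0 <= u <= b ->
    dot (gradQ (e u) u) (velocity_e gamma h fe ge gradQ K y u) + dtQ (e u) u - m (D u) u =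
    dissipation e u.
  move=> hb ub; have hu := time_interval_sub hb ub.
  rewrite /velocity_e /input /dissipation /m xE eE dotDr mis//.
  have -> : dot (gradQ (e u) u) (ge (x u) u *m (adaptive_control ge gamma K gradQ x e (x u) u - h (x u)))
      = dot (adaptive_control ge gamma K gradQ x e (x u) u - h (x u)) (w u).
    by rewrite dotC dot_mulmxl /w /weight xE eE.
  by rewrite addrAC addrK.
have facts b : time_interval T b -> exists2 C, 0 <= C & [/\
    mx_integrable (@lebesgue_measure R) `[0, b] (velocity_e gamma h fe ge gradQ K y),
    (forall t, 0 <= t <= b -> `|velocity_e gamma h fe ge gradQ K y t| <= C),
    (@lebesgue_measure R).-integrable `[0, b]
      (EFin \o (fun u => dot (gradQ (e u) u) (velocity_e gamma h fe ge gradQ K y u))) &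
    (@lebesgue_measure R).-integrable `[0, b] (EFin \o (fun u => m (D u) u))].
  move=> hb; have [r hr] := adm b hb; case: (hb) => b0 _.
  have cv := causal_velocity_e gamma meas dyn lf lg bf bg cG bG lG hip hk r b0.
  have [C C0 hC] := causal_mx_bound cv; exists C => //; split.
  - by move=> i j; apply: causal_integrable (cv i j) hr.
  - by move=> t tb; exact: hC.
  - have := causal_integrable (causal_dot (causal_gradQ (n := n) cG bG lG r b0) cv) hr.
    by rewrite eE.
  - have := causal_integrable
      (causal_dot (causal_mismatch gamma meas dyn lg bg cG bG lG hip hk r b0) (cw r b b0)) hr.
    apply: eq_integrable => // u; rewrite inE/= in_itv/= => ub.
    by rewrite /m mis ?/input ?xE ?eE//; exact: time_interval_sub hb ub.
have eI b t : time_interval T b -> 0 <= t <= b -> e t = e0 +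
    mx_integral (@lebesgue_measure R) `[0, t] (velocity_e gamma h fe ge gradQ K y).
  move=> hb tb; have ht := time_interval_sub hb tb; have [_ sol'] := sol.
  have [_ _ _ {1}->] := sol' t ht; congr (_ + _); apply: eq_mx_integral => u _.
  by rewrite /velocity_e /input xE eE.
have ce b : time_interval T b -> continuous_on b e.
  move=> hb; have [C C0 [iv vC _ _]] := facts b hb.
  apply: (@lipschitz_continuous_on _ _ _ C) => t u tb ub.
  rewrite (eI b t)// (eI b u)// opprD addrACA subrr add0r.
  exact: (mx_indefinite_lipschitz iv C0 ub tb vC).
have iq b : time_interval T b ->
    (@lebesgue_measure R).-integrable `[0, b] (EFin \o (fun u => dtQ (e u) u)).
  move=> hb; have cq := joint_continuous_on cdtQ (ce b hb); case: (hb) => b0 _.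
  have [r [_ hr]] := continuous_on_bounded b0 cq.
  exact: bounded_itv_integrable (continuous_on_measurable cq) hr.
have idis b : time_interval T b ->
    (@lebesgue_measure R).-integrable `[0, b] (EFin \o dissipation e).
  move=> hb; have [C C0 [_ _ i1 i3]] := facts b hb.
  apply: eq_integrable (integrableB _ (integrableD _ i1 (iq b hb)) i3) => // u.
  by rewrite inE/= in_itv/= => ub; rewrite -(disE b).
exists D; split=> // [t ht|b hb]; first by rewrite /D subrK; exact: evU.
case: (hb) => b0 _; have h0 : time_interval T 0.
  by apply: time_interval_sub hb _; rewrite lexx.
have [C C0 [iv vC i1 i3]] := facts b hb; have [C' C'0 hC'] := mC b hb.
have -> : \int[@lebesgue_measure R]_(u in `[0, b]) dissipation e u =
    \int[@lebesgue_measure R]_(u in `[0, b])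
      (dot (gradQ (e u) u) (velocity_e gamma h fe ge gradQ K y u) + dtQ (e u) u - m (D u) u).
  by apply: eq_Rintegral => u; rewrite inE/= in_itv/= => ub; rewrite (disE b).
apply: (@energy_balance R s H ip gamma b (C + C') e0 e (fun u => gradQ (e u) u)
  (velocity_e gamma h fe ge gradQ K y) (fun u => Q (e u) u) (fun u => dtQ (e u) u) D m) => //.
- exact: addr_ge0.
- by move=> t tb; apply: (le_trans (vC t tb)); rewrite lerDl.
- by move=> t tb; exact: eI hb tb.
- exact: joint_continuous_on cG (ce b hb).
- exact: joint_continuous_on cdtQ (ce b hb).
- exact: iq.
- apply: (@Q_expansion b C) => t u tb ub; rewrite (eI b t)// (eI b u)//.
  rewrite opprD addrACA subrr add0r; exact: (mx_indefinite_lipschitz iv C0 tb ub vC).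
- move=> z t tb; have ht := time_interval_sub hb tb.
  rewrite /D opprB addrA subrK (ipBl hip) (hU t ht) (hU 0 h0).
  by rewrite indefinite0 mulr0 subr0.
- by move=> z; exact: im.
- move=> z t tb; apply: (le_trans (hC' z t tb)); rewrite ler_wpM2r// lerDr//.
- by move=> z z' t; rewrite /m linearB/= dotBl.
Qed.


(** With [c = 0] this is monotonicity of the energy; with [c > 0] it is the price of an excursion of
    the error. *)
Lemma energy_decrease (T : \bar R) (e : R -> 'cV[R]_s) (D : R -> H) c t u :
  (forall b, time_interval T b ->
     (@lebesgue_measure R).-integrable `[0, b] (EFin \o dissipation e)) ->
  (forall b, time_interval T b -> stored_energy e D b = stored_energy e D 0 +
     \int[@lebesgue_measure R]_(u in `[0, b]) dissipation e u) ->
  time_interval T u -> 0 <= t -> t <= u ->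
  (forall v, t <= v <= u -> c <= rho (l2norm (e v))) ->
  stored_energy e D u <= stored_energy e D t - c * (u - t).
Proof.
move=> ie sE hu t0 tu ce; have ht : time_interval T t.
  by apply: time_interval_sub hu _; rewrite t0.
rewrite (sE u hu) (sE t ht).
have := indefinite_le (C := - c) (ie u hu) t0 tu (lexx u).
have hdis v : t <= v <= u -> dissipation e v <= - c.
  move=> /[dup] vtu /andP[tv _]; apply: (le_trans (lyap_decrease lyap _ (le_trans t0 tv))).
  by rewrite lerN2 ce.
move=> /(_ hdis); lra.
Qed.

Lemma stored_energy_ge (e : R -> 'cV[R]_s) (D : R -> H) t : 0 <= t ->
  mu1 (l2norm (e t)) <= stored_energy e D t /\ `|D t| ^+ 2 <= 2 * gamma * stored_energy e D t.
Proof.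
move=> t0; have /andP[h1 _] := lyap_bounds lyap (e t) t0.
have h0 := class_Kinf_ge0 (lyap_mu1 lyap) (l2norm_ge0 (e t)).
have g2 : 0 < 2 * gamma by rewrite mulr_gt0.
have hD : 0 <= `|D t| ^+ 2 / (2 * gamma) by rewrite divr_ge0 ?sqr_ge0 ?ltW.
rewrite /stored_energy; split; first by rewrite (le_trans h1)// lerDl.
rewrite mulrC -ler_pdivrMr//; lra.
Qed.

Lemma stored_energy_le0 (T : \bar R) (e : R -> 'cV[R]_s) (D : R -> H) t :
  (forall b, time_interval T b ->
     (@lebesgue_measure R).-integrable `[0, b] (EFin \o dissipation e)) ->
  (forall b, time_interval T b -> stored_energy e D b = stored_energy e D 0 +
     \int[@lebesgue_measure R]_(u in `[0, b]) dissipation e u) ->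
  time_interval T t -> stored_energy e D t <= stored_energy e D 0.
Proof.
move=> ie sE ht; have [t0 _] := ht.
have := @energy_decrease T e D 0 0 t ie sE ht (lexx 0) t0.
rewrite mul0r subr0; apply=> v _; exact: class_Kinf_ge0 (lyap_rho lyap) (l2norm_ge0 _).
Qed.

(** For finite [T] this contradicts blow-up; for [T = +oo] it is part of the conclusion. *)
Lemma closed_loop_bounded (T : \bar R) x e : (0 < T)%E ->
  closed_loop_solution f g h fe ge gamma K gradQ x0 e0 T x e ->
  bounded_signal (time_interval T) x /\ bounded_signal (time_interval T) e.
Proof.
move=> T0 sol; have [D [_ ie sE]] := closed_loop_energy sol.
have be : bounded_signal (time_interval T) e.
  have [A hA] := class_Kinf_bounded (stored_energy e D 0) (lyap_mu1 lyap).
  exists A => t ht; apply: hA; have [t0 _] := ht.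
  by have [h1 _] := stored_energy_ge e D t0; apply: (le_trans h1); exact: stored_energy_le0 ht.
split=> //; have [M hM] := err_bounded err T0 sol be; have [M' hM'] := xd_bounded.
exists (n%:R * (M + M')) => t ht; have [t0 _] := ht.
apply: (le_trans (l2norm_le _)); rewrite ler_wpM2l//.
rewrite -[x t](subrK (xd t)); apply: (le_trans (ler_normD _ _)); apply: lerD.
  exact: le_trans (norm_le_l2norm _) (hM t ht).
apply: le_trans (norm_le_l2norm _) (hM' t _); split=> //; exact: ltry.
Qed.

(** The bound is uniform over the half-line, hence a global Lipschitz constant for [e]. It rests on
    local boundedness uniform in time, and on the sections at [x t] for the mismatch. *)
Lemma velocity_e_bounded x e (D : R -> H) (Cx Ce CD : R) :
  (forall t, 0 <= t -> [/\ l2norm (x t) <= Cx, l2norm (e t) <= Ce & `|D t| <= CD]) ->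
  exists2 C, 0 < C & forall t, 0 <= t ->
    `|fe (e t) t + ge (x t) t *m ev (D t) (x t)| <= C.
Proof.
move=> hC; have [_ repro kb] := hk.
have Cx1 : 0 < `|Cx| + 1 by rewrite ltr_wpDl.
have Ce1 : 0 < `|Ce| + 1 by rewrite ltr_wpDl.
have [Mf hMf] := err_fe_bnd err Ce1; have [Mg hMg] := err_ge_bnd err Cx1.
have [Ck Ck0 hCk] := kb Cx.
have CD0 : 0 <= CD by have [_ _] := hC 0 (lexx 0); exact: le_trans.
exists (`|Mf| + d%:R * `|Mg| * (CD * Ck) + 1).
  by rewrite ltr_wpDl// !(addr_ge0, mulr_ge0).
move=> t t0; have [h1 h2 h3] := hC t t0.
have xr : `|x t| <= Cx by exact: le_trans (norm_le_l2norm _) h1.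
apply: (le_trans (ler_normD _ _)); apply: ler_wpDr => //; apply: lerD.
  apply: (le_trans (norm_le_l2norm _)); apply: le_trans (ler_norm Mf).
  by apply: hMf => //; apply: (le_trans h2); rewrite ler_wpDr// ler_norm.
apply: (le_trans (mulmx_le _ _)); apply: ler_pM => //.
  rewrite ler_wpM2l//; apply: (le_trans (norm_le_opnorm _)); apply: le_trans (ler_norm Mg).
  by apply: hMg => //; apply: (le_trans h1); rewrite ler_wpDr// ler_norm.
apply: cV_norm_le => [|i]; first exact: mulr_ge0.
rewrite -dot_delta -repro; apply: (le_trans (cauchy_schwarz hip _ _)); apply: ler_pM => //.
have [h4 _] := hCk (x t) (x t) (delta_mx i ord0) xr xr.
by apply: (le_trans h4); rewrite ler_piMr// delta_norm.
Qed.

(* Barbalat: e is Lipschitz, so each excursion of |e| above eps costs a fixed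
   amount of the stored energy, which is nonincreasing and nonnegative. *)
Lemma error_vanishes x e :
  closed_loop_solution f g h fe ge gamma K gradQ x0 e0 +oo%E x e ->
  l2norm (e t) @[t --> +oo] --> 0.
Proof.
move=> sol; have [D [evD ie sE]] := closed_loop_energy sol.
have [[Cx hCx] [Ce hCe]] := closed_loop_bounded lt0y sol.
have ge0T (t : R) : 0 <= t -> time_interval +oo%E t by move=> t0; split=> //; exact: ltry.
pose V := stored_energy e D.
have V0 t : 0 <= t -> 0 <= V t.
  move=> t0; have [h1 _] := stored_energy_ge e D t0; apply: le_trans h1.
  exact: class_Kinf_ge0 (lyap_mu1 lyap) (l2norm_ge0 _).
(* From N <= N^2 + 1, in place of a square root. *)
pose CD := 2 * gamma * V 0 + 1.
have hD t : 0 <= t -> `|D t| <= CD.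
  move=> t0; have [_ h2] := stored_energy_ge e D t0.
  have h3 := stored_energy_le0 ie sE (ge0T t t0).
  have h4 : `|D t| ^+ 2 <= 2 * gamma * V 0.
    by apply: (le_trans h2); rewrite ler_wpM2l// mulr_ge0// ltW.
  have h5 : 0 <= (`|D t| - 1) * (`|D t| - 1) by rewrite -expr2 sqr_ge0.
  by move: h4 h5; rewrite /CD expr2; move: (2 * gamma * V 0) (`|D t|) => X N; nra.
have [C C0 hC] : exists2 C, 0 < C & forall t, 0 <= t ->
    `|fe (e t) t + ge (x t) t *m ev (D t) (x t)| <= C.
  by apply: (velocity_e_bounded (Cx := Cx) (Ce := Ce) (CD := CD)) => t t0; split;
    [exact: hCx (ge0T t t0)|exact: hCe (ge0T t t0)|exact: hD].
have eL t u : 0 <= t -> t <= u -> `|e u - e t| <= C * (u - t).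
  move=> t0 tu; have u0 := le_trans t0 tu; have [_ sol'] := sol.
  have [_ iu _ eu] := sol' u (ge0T u u0); have [_ _ _ et] := sol' t (ge0T t t0).
  rewrite eu et opprD addrACA subrr add0r -[u - t]ger0_norm ?subr_ge0//.
  apply: (mx_indefinite_lipschitz iu (ltW C0)).
  - by rewrite t0.
  - by rewrite u0 lexx.
  - move=> v /andP[v0 _].
    have <- : ev (D v) (x v) = adaptive_control ge gamma K gradQ x e (x v) v - h (x v).
      have /(congr1 (fun F => F (x v))) /= <- := evD v (ge0T v v0).
      by rewrite linearD /= hHE addrK.
    exact: hC.
apply/cvgrPdist_lt => eps ep.
(* If the Euclidean norm reaches [eps], the maximum norm is at least [2 * eps']; the summand 1
   covers [s = 0]. *)
pose eps' := eps / (2 * (s%:R + 1)).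
have s1 : 0 < s%:R + 1 :> R by rewrite ltr_wpDl.
have ep' : 0 < eps' by rewrite divr_gt0// mulr_gt0.
(* During a time [eta] the error moves by at most [eps'], so it stays above [eps']. *)
pose eta := eps' / C; have eta0 : 0 < eta by rewrite divr_gt0.
have c0 := class_Kinf_gt0 (lyap_rho lyap) ep'; set c := rho eps' in c0.
have hinf : has_inf [set V t | t in [set t | 0 <= t]].
  by split; [exists (V 0), 0 => //=; exact: lexx|exists 0 => _ [t /= t0 <-]; exact: V0].
set m := inf [set V t | t in [set t | 0 <= t]] in hinf.
have mV t : 0 <= t -> m <= V t by move=> t0; apply: ge_inf; [case: hinf|exists t].
(* After [T0] the energy is less than [c * eta] above its infimum and cannot pay for another
   excursion. *)
have [_ [T0 /= T00 <-] hT0] := inf_adherent (mulr_gt0 c0 eta0) hinf.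
have Vdec t u c' : 0 <= t -> t <= u -> (forall v, t <= v <= u -> c' <= rho (l2norm (e v))) ->
    V u <= V t - c' * (u - t).
  move=> t0 tu; exact: energy_decrease ie sE (ge0T u (le_trans t0 tu)) t0 tu.
exists T0; split; first exact: num_real.
move=> t /ltW T0t; have t0 := le_trans T00 T0t.
rewrite sub0r normrN ger0_norm ?l2norm_ge0// ltNge; apply/negP => epse.
have e1 : 2 * eps' <= `|e t|.
  have h1 : eps <= (s%:R + 1) * `|e t|.
    apply: (le_trans epse); apply: (le_trans (l2norm_le _)).
    by rewrite ler_wpM2r// lerDl.
  have -> : 2 * eps' = eps / (s%:R + 1) by rewrite /eps'; field; rewrite lt0r_neq0.
  by rewrite ler_pdivrMr// mulrC.
have teta : t <= t + eta by rewrite lerDl ltW.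
have h1 : V (t + eta) <= V t - c * (t + eta - t).
  apply: Vdec => // v /andP[tv vt].
  apply: (class_Kinf_le (lyap_rho lyap)); first exact: ltW.
  apply: le_trans (norm_le_l2norm _).
  have h2 := eL t v t0 tv; have h3 := ler_distD (e v) (e t) 0; rewrite !subr0 distrC in h3.
  have h4 : C * (v - t) <= eps'.
    apply: (@le_trans _ _ (C * eta)); first by rewrite ler_pM2l//; lra.
    by rewrite /eta mulrC divfK// lt0r_neq0.
  lra.
have h2 : V t <= V T0 - 0 * (t - T0).
  by apply: Vdec => // v _; exact: class_Kinf_ge0 (lyap_rho lyap) (l2norm_ge0 _).
have h3 := mV _ (le_trans t0 teta).
have h4 : t + eta - t = eta by ring.
rewrite h4 in h1; rewrite mul0r subr0 in h2; move: h1 h2 h3 hT0; rewrite -/m; lra.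
Qed.

Lemma global_solution_exists :
  exists x e, closed_loop_solution f g h fe ge gamma K gradQ x0 e0 +oo%E x e.
Proof.
have [_ cG _] := lyap_C1 lyap.
have [T [y [T0 hy blowup]]] := maximal_solution (col_mx x0 e0) (fun r b _ b0 =>
  causal_velocity gamma meas dyn (err_fe_lip err) (err_ge_lip err) (err_fe_bnd err)
    (err_ge_bnd err) cG (lyap_gradQ_bounded lyap) (lyap_gradQ_lipschitz lyap) hip hk r b0).
have sol : closed_loop_solution f g h fe ge gamma K gradQ x0 e0 T (x_of y) (e_of y).
  exact: (solution_of_velocity meas dyn (err_fe_lip err) (err_ge_lip err) (err_fe_bnd err)
    (err_ge_bnd err) cG (lyap_gradQ_bounded lyap) (lyap_gradQ_lipschitz lyap) hip hk hy).
have [/eqP TE|Tn] := boolP (T == +oo%E); first by exists (x_of y), (e_of y); rewrite -TE.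
have [[M hM] [M' hM']] := closed_loop_bounded T0 sol.
have Ty : (T < +oo)%E by rewrite ltey.
exfalso; apply: (blowup Ty (Num.max M M')) => t ht; rewrite -[y t]vsubmxK.
apply: (le_trans (col_mx_norm _ _)); rewrite ge_max !le_max.
apply/andP; split; apply/orP; [left|right]; apply: le_trans (norm_le_l2norm _) _.
  exact: hM.
exact: hM'.
Qed.

End ClosedLoopStability.

Theorem theorem4p5 (R : realType) (n d s d1 : nat)
    (gamma : R)
    (f : 'cV[R]_n -> R -> 'cV[R]_n) (g : 'cV[R]_n -> R -> 'M[R]_(n, d))
    (h : 'cV[R]_n -> 'cV[R]_d)
    (fe : 'cV[R]_s -> R -> 'cV[R]_s) (ge : 'cV[R]_n -> R -> 'M[R]_(s, d))
    (x0 : 'cV[R]_n) (e0 : 'cV[R]_s) (xd : R -> 'cV[R]_n)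
    (Q : 'cV[R]_s -> R -> R) (gradQ : 'cV[R]_s -> R -> 'cV[R]_s)
    (dtQ : 'cV[R]_s -> R -> R) (rho mu1 mu2 : R -> R)
    (H : completeNormedModType R) (ip : H -> H -> R)
    (ev : {linear H -> ('cV[R]_n -> 'cV[R]_d)})
    (K : 'cV[R]_n -> 'cV[R]_n -> 'M[R]_d)
    (dT : measure_display) (Theta : measurableType dT) (nu : probability Theta R)
    (Phi : 'cV[R]_n -> Theta -> 'M[R]_(d, d1))
    (gamma_gt0 : 0 < gamma) (d1_le_d : (d1 <= d)%N)
    (meas : measurable_in_time f g fe ge)
    (xd_bounded : bounded_signal (time_interval +oo%E) xd)
    (dyn : dynamics_regularity f g h)
    (err : error_regularity fe ge xd
             (closed_loop_solution f g h fe ge gamma K gradQ x0 e0))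
    (lyap : lyapunov_stability fe Q gradQ dtQ rho mu1 mu2)
    (rkhs : is_rkhs ip ev K)
    (h_in_H : range ev h)
    (feat : feature_representation nu Phi K)
    (moment : second_moment nu Phi) :
  let closed_loop := closed_loop_solution f g h fe ge gamma K gradQ x0 e0 +oo%E in
  (exists x e, closed_loop x e) /\
  (forall x e, closed_loop x e ->
    [/\ bounded_signal (time_interval +oo%E) x,
        bounded_signal (time_interval +oo%E) e,
        (forall t : R, 0 <= t -> range ev ((adaptive_control ge gamma K gradQ x e)^~ t)) &
        l2norm (x t - xd t) @[t --> +oo] --> 0]).

Proof.
have [hH _ hHE] := h_in_H; have [k hk] := kernel_section_exists rkhs feat moment.
have hip := rkhs_ip rkhs.
split=> [|x e sol].
  exact: (global_solution_exists gamma_gt0 meas xd_bounded dyn err lyap hip hk hHE).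
have [bx be] := closed_loop_bounded gamma_gt0 meas xd_bounded dyn err lyap hip hk hHE lt0y sol.
have [D [evD _ _]] := closed_loop_energy gamma_gt0 meas dyn err lyap hip hk hHE sol.
split=> //.
- by move=> t t0; exists (D t + hH) => //; rewrite evD//; split=> //; exact: ltry.
- have e0lim := error_vanishes gamma_gt0 meas xd_bounded dyn err lyap hip hk hHE sol.
  exact: err_limit err _ _ sol e0lim.
Qed.
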